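(* Let $\mu>0$, $v>0$, $\tau\in\mathbb{R}\setminus\{0,1,-1\}$ and let $\omega>\frac{v^2}{(\tau^2+1)^2}$. Then there exists $u\in H^1_\tau\setminus\{0\}$ with $I_\omega(u)=0$ that minimizes $S_\omega$ on the Nehari manifold, i.e. $S_\omega(u)\le S_\omega(w)$ for every $w\in H^1_\tau\setminus\{0\}$ with $I_\omega(w)=0$.
   Context: Functions are complex-valued. $H^1_\tau:=\{u\in H^1(\mathbb{R}_-)\oplus H^1(\mathbb{R}_+): u(0+)=\tau u(0-)\}$, where $\mathbb{R}_-=(-\infty,0)$, $\mathbb{R}_+=(0,+\infty)$. Write $\|u\|_p$ for the $L^p(\mathbb{R})$ norm and $\|u'\|_2^2:=\|u'\|_{L^2(\mathbb{R}_-)}^2+\|u'\|_{L^2(\mathbb{R}_+)}^2$. The action is $$S_\omega(u)=\tfrac12\|u'\|_2^2-\tfrac{1}{2\mu+2}\|u\|_{2\mu+2}^{2\mu+2}-\tfrac v2|u(0-)|^2+\tfrac\omega2\|u\|_2^2,$$ and the Nehari functional is $$I_\omega(u)=\|u'\|_2^2-\|u\|_{2\mu+2}^{2\mu+2}-v|u(0-)|^2+\omega\|u\|_2^2 .$$ The Nehari manifold is $\{u\in H^1_\tau\setminus\{0\}: I_\omega(u)=0\}$. *)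

(* Defs.v *)
From HB Require Import structures.
From mathcomp Require Import all_boot all_order all_algebra.
From mathcomp Require Import all_classical all_reals all_analysis.
From mathcomp.real_closed Require Import complex.

Set Implicit Arguments.
Unset Strict Implicit.
Unset Printing Implicit Defensive.

Import Order.TTheory GRing.Theory Num.Theory.
Import numFieldNormedType.Exports.
Import Normc.

Local Open Scope classical_set_scope.
Local Open Scope ring_scope.
Local Open Scope complex_scope.

Section sobolev_half_lines.
Context {R : realType}.

Local Notation leb := (@lebesgue_measure R).

Implicit Types (I : set R) (u g : R -> R[i]) (phi : R -> R) (p : R).

Definition Rminus : set R := `]-oo, 0[.
Definition Rplus : set R := `]0, +oo[.

Definition cintegral I u : R[i] :=
  (\int[leb]_(x in I) complex.Re (u x)) +i* (\int[leb]_(x in I) complex.Im (u x)).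

(* The p-th power of the L^p(I) norm, for 0 < p; the real-valued integral is 0
   by convention when |u|^p is not integrable. *)
Definition Lpnorm_pow p I u : R := \int[leb]_(x in I) (normc (u x) `^ p).

Definition L2 I u : Prop :=
  [/\ measurable_fun I (fun x => complex.Re (u x)),
      measurable_fun I (fun x => complex.Im (u x)) &
      leb.-integrable I (fun x => (normc (u x) `^ 2)%:E)].

(* C^1 functions with compact support in the open set I; real-valued ones
   suffice to test complex-valued u and g, by linearity. *)
Definition test_fun I phi : Prop :=
  [/\ forall x, derivable phi x 1,
      continuous (derive1 phi) &
      exists K : set R,
        [/\ compact K, K `<=` I & forall x, ~ K x -> phi x = 0]].

Definition is_weak_deriv I u g : Prop :=
  forall phi, test_fun I phi ->
    cintegral I (fun x => u x * (derive1 phi x)%:C) =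
    - cintegral I (fun x => g x * (phi x)%:C).

Definition H1 I u : Prop := L2 I u /\ exists g, L2 I g /\ is_weak_deriv I u g.

(* For u in H1 I the weak derivative exists and is unique almost everywhere in
   I; [weak_deriv] picks a representative (and is 0 outside H1 I). *)
Definition weak_deriv I u : R -> R[i] :=
  xget (fun=> 0) [set g | L2 I g /\ is_weak_deriv I u g].

(* l is the limit at 0, from inside I, of the continuous representative of u.
   The values of u on a null set are irrelevant. *)
Definition is_trace0 I u (l : R[i]) : Prop :=
  exists ut : R -> R[i]^o,
    [/\ {in I, continuous ut},
        {ae leb, forall x, I x -> u x = ut x} &
        ut @ within I (nbhs 0) --> (l : R[i]^o)].

Definition trace0 I u : R[i] := xget 0 [set l | is_trace0 I u l].

(* An element of H^1(R_-) (+) H^1(R_+) is encoded by a single function on R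
   whose restrictions to the two half-lines are its components. *)
Definition H1tau (tau : R) u : Prop :=
  [/\ H1 Rminus u, H1 Rplus u & trace0 Rplus u = tau%:C * trace0 Rminus u].

Definition kinetic u : R :=
  Lpnorm_pow 2 Rminus (weak_deriv Rminus u) +
  Lpnorm_pow 2 Rplus (weak_deriv Rplus u).

Definition action (mu v omega : R) u : R :=
  2^-1 * kinetic u
  - (2 * mu + 2)^-1 * Lpnorm_pow (2 * mu + 2) setT u
  - v / 2 * normc (trace0 Rminus u) ^+ 2
  + omega / 2 * Lpnorm_pow 2 setT u.

Definition nehari_fun (mu v omega : R) u : R :=
  kinetic u
  - Lpnorm_pow (2 * mu + 2) setT u
  - v * normc (trace0 Rminus u) ^+ 2
  + omega * Lpnorm_pow 2 setT u.

(* Being nonzero in H^1_tau means not vanishing almost everywhere. *)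
Definition nehari_manifold (mu v tau omega : R) u : Prop :=
  [/\ H1tau tau u,
      ~ {ae leb, forall x, u x = 0} &
      nehari_fun mu v omega u = 0].

End sobolev_half_lines.

(* Main.v *)
(* For a half-line with boundary value rho(0), modulus rho = |w| <= N and speed
   k = |w'|, the pointwise inequality
     k^2 + omega rho^2 (1 - (rho/N)^(2 mu)) >= 2 k rho slope(rho/N)
   is a calibration: its right-hand side dominates N^2 |(calib(rho/N))'|, so the
   left-hand side integrates to at least a function of rho(0)/N, improved on the side where rho comes close to N. Under the
   transmission condition this leaves one boundary value b; minimizing over b
   gives a stationary point, realized with equality by two shifted pieces of the
   soliton pasted at 0 (omega > v^2 / (tau^2 + 1)^2 is what makes the stationary
   point exist). For w on the Nehari manifold the result reads
   K N^2 <= ||w||^p - omega N^(-2 mu) ||w||^p, with p = 2 mu + 2, and Young's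
   inequality in N turns it into ||u||^p <= ||w||^p for the pasted soliton u. This
   is the claim, since the action is mu / p times ||.||^p on the Nehari manifold. *)
Require Import Defs.
From mathcomp Require Import all_boot all_order all_algebra.
From mathcomp Require Import all_classical all_reals all_analysis.
From mathcomp Require Import measurable_realfun ring lra.
From mathcomp.real_closed Require Import complex.

Set Implicit Arguments.
Unset Strict Implicit.
Unset Printing Implicit Defensive.

Import Order.TTheory GRing.Theory Num.Theory.
Import numFieldNormedType.Exports.
Import Normc.

Local Open Scope classical_set_scope.
Local Open Scope ring_scope.

(** No minimizing sequence is taken, so no loss of compactness at infinity has to be excluded: the
    level of an explicit competitor is bounded below directly. The function [slope] comes from the
    first integral [phi'^2 = om * phi^2 * (1 - phi^(2 mu))] of the soliton with peak 1, so soliton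
    pieces give equality in the calibration.

    The obstacle is that a stationary boundary value need not be a minimum. If the pasted soliton
    peaks inside the side with the larger boundary value, the boundary energy is minimal there. If
    it decreases away from 0 on both sides, the boundary energy is maximal there, and comparing
    boundary values at one fixed [N] goes the wrong way. Hence [N] stays free above the supremum of
    [|w|]: either [N] is that supremum and the climb up to it pays for the difference, or [N] is
    raised until the normalized boundary value is exactly the stationary one.

    Only moduli enter the lower bound, so it depends on [|tau|]; the sign of [tau] reappears as the
    sign of the competitor on the right. *)

Section continuity.
Context {R : realType}.
Implicit Types f g : R -> R.

Lemma cts_cst (c : R) : continuous (fun _ : R => c).
Proof. by move=> x; exact: cvg_cst. Qed.

Lemma cts_id : continuous (fun x : R => x).
Proof. by move=> x; exact: cvg_id. Qed.

Lemma ctsD f g : continuous f -> continuous g -> continuous (fun x => f x + g x).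
Proof. by move=> cf cg x; apply: cvgD; [exact: cf|exact: cg]. Qed.

Lemma ctsN f : continuous f -> continuous (fun x => - f x).
Proof. by move=> cf x; apply: cvgN; exact: cf. Qed.

Lemma ctsM f g : continuous f -> continuous g -> continuous (fun x => f x * g x).
Proof. by move=> cf cg x; apply: cvgM; [exact: cf|exact: cg]. Qed.

Lemma ctsX f n : continuous f -> continuous (fun x => f x ^+ n).
Proof.
move=> cf x; apply: (@continuous_comp _ _ _ f (fun y => y ^+ n)); first exact: cf.
exact: exprn_continuous.
Qed.

Lemma cts_norm f : continuous f -> continuous (fun x => `|f x|).
Proof. by move=> cf x; apply: cvg_norm; exact: cf. Qed.

Lemma cts_comp f g : continuous f -> continuous g -> continuous (fun x => g (f x)).
Proof. by move=> cf cg x; apply: continuous_comp; [exact: cf|exact: cg]. Qed.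

End continuity.

Section derivatives.
Context {R : realType}.
Implicit Types (f g : R -> R) (x a b c : R).

Lemma derD f g x a b : is_derive x 1 f a -> is_derive x 1 g b ->
  is_derive x 1 (fun y => f y + g y) (a + b).
Proof. by move=> df dg; exact: is_deriveD. Qed.

Lemma derN f x a : is_derive x 1 f a -> is_derive x 1 (fun y => - f y) (- a).
Proof. by move=> df; exact: is_deriveN. Qed.

Lemma derM f g x a b : is_derive x 1 f a -> is_derive x 1 g b ->
  is_derive x 1 (fun y => f y * g y) (f x * b + g x * a).
Proof. by move=> df dg; exact: (is_deriveM df dg). Qed.

Lemma derZ c f x a : is_derive x 1 f a -> is_derive x 1 (fun y => c * f y) (c * a).
Proof. by move=> df; exact: (is_deriveZ c df). Qed.

Lemma der_comp f g x a b : is_derive x 1 f a -> is_derive (f x) 1 g b ->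
  is_derive x 1 (fun y => g (f y)) (b * a).
Proof. by move=> df dg; exact: (is_derive1_comp dg df). Qed.

Lemma der_cts f (g : R -> R) : (forall x, is_derive x 1 f (g x)) -> continuous f.
Proof.
by move=> df x; apply: differentiable_continuous; apply/derivable1_diffP.
Qed.

End derivatives.

(** * Primitives of locally integrable functions *)

Section primitive.
Context {R : realType}.
Local Notation leb := (@lebesgue_measure R).
Implicit Types (f g k : R -> R) (a b c x : R).

Definition loc_int f := forall a b, leb.-integrable `[a, b] (EFin \o f).

(** Two integrals, so that the base point 0 serves both half-lines: for [x != 0] one of the two
    segments is empty and contributes 0. *)
Definition prim f x : R :=
  \int[leb]_(t in `[0, x]) f t - \int[leb]_(t in `[x, 0]) f t.

Lemma Rintegral_itv_split f a b c : loc_int f -> a <= b -> b <= c ->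
  \int[leb]_(t in `[a, c]) f t =
  \int[leb]_(t in `[a, b]) f t + \int[leb]_(t in `[b, c]) f t.
Proof.
move=> lf ab bc.
have := @Rintegral_itvB R f (BLeft a) (BRight c) b (lf a c).
rewrite !bnd_simp => /(_ ab bc) H.
rewrite -[in RHS](@Rintegral_itv_obnd_cbnd _ b) -?H; first by ring.
apply: integrableS (lf b c) => //.
by apply: subset_itv; rewrite bnd_simp.
Qed.

Lemma Rintegral_itv_split3 f a b c d : loc_int f -> a <= b -> b <= c -> c <= d ->
  \int[leb]_(t in `[a, d]) f t = \int[leb]_(t in `[a, b]) f t +
  (\int[leb]_(t in `[b, c]) f t + \int[leb]_(t in `[c, d]) f t).
Proof.
move=> lf ab bc cd; rewrite (Rintegral_itv_split lf ab (le_trans bc cd)).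
by rewrite (Rintegral_itv_split lf bc cd).
Qed.

Lemma Rintegral_itvxx f a : \int[leb]_(t in `[a, a]) f t = 0.
Proof. by rewrite set_itv1 Rintegral_set1. Qed.

Lemma Rintegral_itv_gt f a b : b < a -> \int[leb]_(t in `[a, b]) f t = 0.
Proof. by move=> ba; rewrite set_itv_ge ?Rintegral_set0// bnd_simp -ltNge. Qed.

Lemma prim_ge0 f x : 0 <= x -> prim f x = \int[leb]_(t in `[0, x]) f t.
Proof.
rewrite le_eqVlt => /predU1P[<-|x0]; rewrite /prim.
  by rewrite Rintegral_itvxx subr0.
by rewrite [X in _ - X]Rintegral_itv_gt// subr0.
Qed.

Lemma prim_le0 f x : x <= 0 -> prim f x = - \int[leb]_(t in `[x, 0]) f t.
Proof.
rewrite le_eqVlt => /predU1P[->|x0]; rewrite /prim.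
  by rewrite Rintegral_itvxx subr0 oppr0.
by rewrite Rintegral_itv_gt// sub0r.
Qed.

Lemma prim0 f : prim f 0 = 0.
Proof. by rewrite prim_ge0// Rintegral_itvxx. Qed.

Lemma primB f a b : loc_int f -> a <= b ->
  prim f b - prim f a = \int[leb]_(t in `[a, b]) f t.
Proof.
move=> lf ab; have [a0|a0] := leP 0 a.
  rewrite !prim_ge0// ?(le_trans a0)//.
  by rewrite (@Rintegral_itv_split f 0 a b)//; ring.
have [b0|b0] := leP 0 b.
  rewrite (prim_ge0 _ b0) (prim_le0 _ (ltW a0)).
  by rewrite (@Rintegral_itv_split f a 0 b)//; [ring|exact: ltW].
rewrite !prim_le0 ?ltW// (@Rintegral_itv_split f a b 0)//; first by ring.
exact: ltW.
Qed.

Lemma continuous_loc_int f : continuous f -> loc_int f.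
Proof.
move=> cf a b; apply: continuous_compact_integrable; first exact: segment_compact.
exact: continuous_subspaceT.
Qed.

Lemma loc_intM f k : continuous f -> loc_int k -> loc_int (fun x => f x * k x).
Proof.
move=> cf lk a b.
have : leb.-integrable `[a, b] ((EFin \o f) \* (EFin \o k))%E.
  apply: integrableMr => //.
    by apply: measurable_funTS; exact: continuous_measurable_fun.
  have /compact_bounded[M [Mr MP]] : compact (f @` `[a, b]).
    apply: continuous_compact; last exact: segment_compact.
    exact: continuous_subspaceT.
  exists M; split => // x Mx y yab.
  by apply: (MP x Mx); exists y.
by [].
Qed.

Lemma loc_intD f g : loc_int f -> loc_int g -> loc_int (fun x => f x + g x).
Proof.
move=> lf lg a b.
by have := @integrableD _ _ _ leb `[a, b]%classic _ _ _ (lf a b) (lg a b); exact.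
Qed.

Lemma loc_intZ c f : loc_int f -> loc_int (fun x => c * f x).
Proof. by move=> lf a b; apply: (integrableZl _ c (lf a b)). Qed.

Lemma loc_int_norm f : loc_int f -> loc_int (fun x => `|f x|).
Proof. by move=> lf a b; exact: integrable_norm (lf a b). Qed.

Lemma prim_shift f a x : loc_int f -> a <= x ->
  prim f x = parameterized_integral leb a x f + prim f a.
Proof. by move=> lf ax; rewrite /parameterized_integral -primB//; ring. Qed.

Lemma continuous_prim f : loc_int f -> continuous (prim f).
Proof.
move=> lf x.
have := @parameterized_integral_continuous R (x - 1) (x + 1) f.
have -> : x - 1 <= x + 1 by lra.
move=> /(_ erefl (lf _ _)).
rewrite continuous_within_itvP; last by lra.
case=> + _ _ => /(_ x); rewrite in_itv/=.
have -> /= : x - 1 < x by lra.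
have -> /= : x < x + 1 by lra.
move=> /(_ erefl) cx.
have {}cx : {for x, continuous (fun y => parameterized_integral leb (x - 1) y f + prim f (x - 1))}.
  by apply: cvgD; [exact: cx|exact: cvg_cst].
rewrite /continuous_at (@prim_shift f (x - 1) x)//; last by lra.
apply: cvg_trans cx; apply: near_eq_cvg.
near=> y; rewrite (@prim_shift f (x - 1) y)//.
by apply: ltW; near: y; apply: lt_nbhsr; lra.
Unshelve. all: by end_near. Qed.

Lemma is_derive_prim_lebesgue_pt f x : loc_int f -> lebesgue_pt f x ->
  is_derive x 1 (prim f) (f x).
Proof.
move=> lf fx.
have [] := @FTC1_lebesgue_pt R f (BLeft (x - 1)) x (x + 1) _ (lf _ _) _ fx.
- by lra.
- by rewrite lte_fin; lra.
set G := fun y => _; move=> dG G'x.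
have E : \forall y \near x, G y + prim f (x - 1) = prim f y.
  near=> y; rewrite /G -primB ?subrK//.
  by apply: ltW; near: y; apply: lt_nbhsr; lra.
have dGc : is_derive x 1 (fun y => G y + prim f (x - 1)) (f x).
  rewrite -[f x]addr0; apply: is_deriveD.
  by apply: DeriveDef; [exact: dG|rewrite -derive1E].
exact: near_eq_is_derive E dGc.
Unshelve. all: by end_near. Qed.

Lemma is_derive_prim f x : continuous f -> is_derive x 1 (prim f) (f x).
Proof.
move=> cf; apply: is_derive_prim_lebesgue_pt; first exact: continuous_loc_int.
apply: (@continuous_lebesgue_pt _ f x setT) => //.
- by split => //; exact: openT.
- exact: continuous_measurable_fun.
- exact: cf.
Qed.

Lemma loc_int_locally_integrable f : measurable_fun setT f -> loc_int f ->
  locally_integrable setT f.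
Proof.
move=> mf lf; split => //; first exact: openT.
move=> K _ cK.
have [M [Mr MP]] := compact_bounded cK.
have KM : K `<=` `[- (`|M| + 1), `|M| + 1].
  move=> x Kx /=; rewrite in_itv/= -ler_norml.
  apply: (MP (`|M| + 1)) => //.
  by rewrite (le_lt_trans (ler_norm M))// ltrDl.
have /integrableP[_] := lf (- (`|M| + 1)) (`|M| + 1).
apply: le_lt_trans.
apply: ge0_subset_integral => //=.
- exact: compact_measurable.
- by do 2 apply: measurableT_comp => //; exact: measurable_funTS.
Qed.

Lemma ae_is_derive_prim f : measurable_fun setT f -> loc_int f ->
  {ae leb, forall x, is_derive x 1 (prim f) (f x)}.
Proof.
move=> mf lf.
have := lebesgue_differentiation (loc_int_locally_integrable mf lf).
apply: filterS; first exact: (ae_filter_ringOfSetsType leb).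
by move=> x; exact: is_derive_prim_lebesgue_pt.
Qed.

(** Induction along a segment: the local hypothesis at the supremum of the points reachable from [a]
    shows both that it is reached and that it cannot stop short of [b]. Only intervals containing
    [x] are asked for locally, which is what estimates centred at [x] provide. *)
Lemma local_to_global (P : R -> R -> Prop) :
  (forall a b c, a <= b -> b <= c -> P a b -> P b c -> P a c) ->
  (forall x, exists2 e, 0 < e & forall s t, x - e < s -> s <= x -> x <= t ->
     t < x + e -> P s t) ->
  forall a b, a <= b -> P a b.
Proof.
move=> Ptr Ploc a b ab.
pose A := [set t | a <= t <= b /\ P a t].
have Aa : A a.
  split; first by rewrite lexx.
  by have [e e0 H] := Ploc a; apply: H; lra.
have supA : has_sup A by split; [exists a|exists b => t [/andP[]]].
set c := sup A.
have ac : a <= c by apply: sup_upper_bound.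
have cb : c <= b by apply: ge_sup => [|t [/andP[]]]; first by exists a.
have [e e0 H] := Ploc c.
have [s [/andP[as_ sb] Pas] cs] := sup_adherent e0 supA.
have sc : s <= c by apply: sup_upper_bound => //; split => //; rewrite as_.
have Pac t : c <= t -> t < c + e -> P a t.
  by move=> ct te; apply: (Ptr a s t) => //; [exact: le_trans ct|exact: H].
have [bc|bc] := ltP b (c + e); first exact: Pac.
have : A (c + e / 2) by split; [lra|apply: Pac; lra].
by move=> /(sup_upper_bound supA); rewrite -/c; lra.
Qed.

End primitive.

(** * A chain rule for functions with integrable speed *)

Section chain_rule.
Context {R : realType}.
Local Notation leb := (@lebesgue_measure R).
Implicit Types (F k H h : R -> R) (a b x y : R).

Lemma MVT_between H h x y : (forall t : R, is_derive t 1 H (h t)) ->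
  exists xi, [/\ Num.min x y <= xi, xi <= Num.max x y &
    H y - H x = h xi * (y - x)].
Proof.
move=> dH.
have cH : continuous H by exact: der_cts dH.
have [xy|yx] := leP x y.
  have [//|xi + E] := @MVT_segment R H h x y xy (fun t _ => dH t).
    exact: continuous_subspaceT.
  by rewrite in_itv/= => /andP[? ?]; exists xi; split.
have [//|xi + E] := @MVT_segment R H h y x (ltW yx) (fun t _ => dH t).
  exact: continuous_subspaceT.
rewrite in_itv/= => /andP[? ?]; exists xi; split => //.
by rewrite -opprB E; ring.
Qed.

(** [F] need not be differentiable; [k] merely dominates its increments. Near each point the mean
    value theorem gives the bound up to a small error, and [local_to_global] adds up the local
    bounds. *)
Lemma chain_le F k H h a b :
  continuous F -> loc_int k -> (forall x, 0 <= k x) ->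
  (forall x y, x <= y -> `|F y - F x| <= \int[leb]_(t in `[x, y]) k t) ->
  (forall t : R, is_derive t 1 H (h t)) -> continuous h ->
  a <= b ->
  `|H (F b) - H (F a)| <= \int[leb]_(t in `[a, b]) (`|h (F t)| * k t).
Proof.
move=> cF lk k0 Fk dH ch ab.
have cn : continuous (fun t => `|h (F t)|).
  by apply: cts_norm; exact: cts_comp.
have lhk : loc_int (fun t => `|h (F t)| * k t) by exact: loc_intM.
(* The slack [e * k] absorbs the oscillation of [h] along [F] near a point; without it the estimate
   would not be local. *)
have eps_le e : 0 < e -> forall x y, x <= y ->
    `|H (F y) - H (F x)| <=
    \int[leb]_(t in `[x, y]) (`|h (F t)| * k t + e * k t).
  move=> e0; have lI : loc_int (fun t => `|h (F t)| * k t + e * k t).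
    by apply: loc_intD => //; exact: loc_intZ.
  apply: local_to_global => [x y z xy yz Hxy Hyz|x].
    rewrite (@Rintegral_itv_split _ _ x y z)//.
    have -> : H (F z) - H (F x) = (H (F z) - H (F y)) + (H (F y) - H (F x)).
      by ring.
    by rewrite (le_trans (ler_normD _ _))// addrC lerD.
  have chn : continuous (fun z => `|h z|).
    exact: cts_norm.
  have e2 : 0 < e / 2 by rewrite divr_gt0.
  have /cvgrPdist_lt/(_ _ e2) := chn (F x).
  move=> /nbhs_ballP[d /= d0 Hd].
  have /cvgrPdist_lt/(_ _ d0) := cF x.
  move=> /nbhs_ballP[r /= r0 Hr].
  exists r => // s t xs sx xt tx.
  have Fnear y : s <= y <= t -> `|F x - F y| < d.
    move=> /andP[sy yt]; apply: Hr; rewrite /ball/= ltr_norml.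
    by apply/andP; split; lra.
  have [xi [xi1 xi2 ->]] := MVT_between (F s) (F t) dH.
  have hnear z : `|F x - z| < d -> `| `|h (F x)| - `|h z| | < e / 2.
    by move=> xz; apply: Hd; rewrite /ball/=.
  have hxi : `|h xi| <= `|h (F x)| + e / 2.
    have /hnear : `|F x - xi| < d.
      have := Fnear s; have := Fnear t; rewrite !lexx (le_trans sx xt).
      move=> /(_ isT) + /(_ isT); rewrite !ltr_norml => /andP[t1 t2] /andP[s1 s2].
      move: xi1 xi2; rewrite minEle maxEle.
      by case: ifPn => _ xi1 xi2; apply/andP; split; lra.
    by rewrite ltr_norml => /andP[]; lra.
  rewrite normrM.
  apply: (@le_trans _ _ ((`|h (F x)| + e / 2) * \int[leb]_(y in `[s, t]) k y)).
    by apply: ler_pM => //; exact: Fk (le_trans sx xt).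
  rewrite -RintegralZl//.
  apply: le_Rintegral => //; [exact: loc_intZ|].
  move=> y /=; rewrite in_itv/= -mulrDl => yst.
  rewrite ler_wpM2r//.
  by have /hnear := Fnear _ yst; rewrite ltr_norml => /andP[]; lra.
apply/ler_addgt0Pr => e e0.
have K0 : 0 <= \int[leb]_(t in `[a, b]) k t by exact: Rintegral_ge0.
(* Adding 1 keeps the denominator positive when the integral of [k] vanishes. *)
have e1 : 0 < e / (\int[leb]_(t in `[a, b]) k t + 1).
  by rewrite divr_gt0// ltr_wpDl.
apply: le_trans (eps_le _ e1 _ _ ab) _.
rewrite RintegralD//; last exact: loc_intZ.
rewrite RintegralZl//.
rewrite lerD2l mulrAC ler_pdivrMr ?ltr_wpDl//.
by rewrite ler_wpM2l ?ltW// ltrDl.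
Qed.

(** Meant for a path from the boundary to a high point and on towards infinity: the rise and the
    fall are both paid for by the same integral of [E]. *)
Lemma chain_le_triple F k H h (E : R -> R) (D : set R) a b c :
  continuous F -> loc_int k -> (forall x, 0 <= k x) ->
  (forall x y, x <= y -> `|F y - F x| <= \int[leb]_(t in `[x, y]) k t) ->
  (forall t : R, is_derive t 1 H (h t)) -> continuous h ->
  measurable D -> leb.-integrable D (EFin \o E) ->
  {in D, forall t, `|h (F t)| * k t <= E t} ->
  a <= b -> b <= c -> `[a, c] `<=` D ->
  `|H (F b) - H (F a)| + `|H (F c) - H (F b)| <= \int[leb]_(t in D) E t.
Proof.
move=> cF lk k0 Fk dH ch mD iE hE ab bc acD.
have cn : continuous (fun t => `|h (F t)|).
  by apply: cts_norm; exact: cts_comp.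
have lhk : loc_int (fun t => `|h (F t)| * k t) by exact: loc_intM.
apply: (@le_trans _ _ (\int[leb]_(t in `[a, c]) (`|h (F t)| * k t))).
  by rewrite (@Rintegral_itv_split _ _ a b c)// lerD//; exact: chain_le.
have iEac : leb.-integrable `[a, c] (EFin \o E) by exact: integrableS iE.
apply: (@le_trans _ _ (\int[leb]_(t in `[a, c]) E t)).
  by apply: le_Rintegral => // t /acD /mem_set; exact: hE.
rewrite /Rintegral fine_le ?integrable_fin_num//.
apply: ge0_subset_integral => //.
  by case/integrableP : iE.
move=> t /mem_set /hE; rewrite lee_fin; apply: le_trans.
by rewrite mulr_ge0.
Qed.

End chain_rule.

Section small_values.
Context d (T : measurableType d) (R : realType).

(** A lower bound [e] on a set of infinite measure would make the integral infinite. This stands in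
    for decay at infinity: one small value far out is enough. *)
Lemma integrable_small_value (mu : {measure set T -> \bar R}) (D : set T)
    (f : T -> R) (e : R) :
  measurable D -> mu D = +oo%E -> mu.-integrable D (EFin \o f) -> 0 < e ->
  exists2 y, D y & f y < e.
Proof.
move=> mD Doo /integrableP[mf foo] e0; apply: contrapT => /forall2NP H.
have : (+oo%E <= \int[mu]_(x in D) `|(EFin \o f) x|)%E.
  rewrite -[leLHS](_ : \int[mu]_(x in D) (cst e%:E x) = _)%E; last first.
    by rewrite integral_cst// Doo gt0_muley ?lte_fin.
  apply: ge0_le_integral => //=.
  - by move=> x _; rewrite lee_fin ltW.
  - apply/measurable_EFinP; apply: measurableT_comp => //.
    exact/measurable_EFinP.
  - move=> x Dx; rewrite lee_fin; case: (H x) => // /negP.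
    by rewrite -leNgt => /le_trans; apply; rewrite ler_norm.
by rewrite leNgt foo.
Qed.

End small_values.

(** * The calibration on a half-line *)

Section calibration.
Context {R : realType}.
Local Notation leb := (@lebesgue_measure R).
Implicit Types (D : set R) (r k G f : R -> R) (om q x y t N : R).

Lemma continuous_powR_gt0 q x : 0 < x -> {for x, continuous (fun t => t `^ q)}.
Proof.
move=> x0; apply: differentiable_continuous; apply/derivable1_diffP.
by apply: derivable_powR; rewrite in_itv/= x0.
Qed.

(** The absolute value matters at 0: the default value of [powR] at negative bases would destroy
    continuity there. Continuity on the whole line lets the functions below be integrated and
    differentiated everywhere. *)
Lemma continuous_norm_powR q : 0 < q -> continuous (fun t => `|t| `^ q).
Proof.
move=> q0 x; have [->|x0] := eqVneq x 0.
  apply/cvgrPdist_lt => e e0; near=> t.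
  rewrite normr0 powR0 ?gt_eqF// sub0r normrN ger0_norm ?powR_ge0//.
  have -> : e = (e `^ q^-1) `^ q by rewrite -powRrM mulVf ?gt_eqF// powRr1// ltW.
  apply: gt0_ltr_powR; rewrite ?nnegrE ?powR_ge0//.
  near: t; exists (e `^ q^-1); first exact: powR_gt0.
  by move=> t /=; rewrite sub0r normrN.
apply: (@continuous_comp R R R (fun t : R => `|t| : R) (fun t : R => t `^ q)).
  exact: norm_continuous.
by apply: continuous_powR_gt0; rewrite normr_gt0.
Unshelve. all: by end_near. Qed.

(* The soliton equation is phi'^2 = (phi * slope phi)^2. *)
Definition slope om q t := Num.sqrt (om * (1 - `|t| `^ q)).

Definition calib_deriv om q t := 2 * t * slope om q t.

Fact calib_key : unit. Proof. exact: tt. Qed.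

(* Locked, so that conversion does not unfold the integral. *)
Definition calib om q : R -> R := locked_with calib_key (prim (calib_deriv om q)).

Lemma calibE om q : calib om q = prim (calib_deriv om q).
Proof. by rewrite /calib unlock. Qed.

Lemma continuous_slope om q : 0 < q -> continuous (slope om q).
Proof.
move=> q0; apply: (@cts_comp R (fun t => om * (1 - `|t| `^ q)) Num.sqrt); last exact: sqrt_continuous.
apply: ctsM; first exact: cts_cst.
by apply: ctsD; [exact: cts_cst|apply: ctsN; exact: continuous_norm_powR].
Qed.

Lemma slope_ge0 om q t : 0 <= slope om q t.
Proof. exact: sqrtr_ge0. Qed.

(** Beyond [|t| = 1] the radicand is not positive and the square root is 0 by convention, so the
    identity is confined to values below the peak. *)
Lemma sqr_slope om q t : 0 <= om -> 0 <= q -> `|t| <= 1 ->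
  slope om q t ^+ 2 = om * (1 - `|t| `^ q).
Proof.
move=> om0 q0 t1; rewrite sqr_sqrtr// mulr_ge0// subr_ge0.
have -> : 1 = 1 `^ q :> R by rewrite powR1.
by apply: ge0_ler_powR; rewrite ?nnegrE.
Qed.

Lemma slope0 om q : 0 < q -> slope om q 0 = Num.sqrt om.
Proof. by move=> q0; rewrite /slope normr0 powR0 ?gt_eqF// subr0 mulr1. Qed.

Lemma slope1 om q : slope om q 1 = 0.
Proof. by rewrite /slope normr1 powR1 subrr mulr0 sqrtr0. Qed.

Lemma slope_nonincreasing om q x y : 0 <= om -> 0 <= q -> 0 <= x -> x <= y ->
  slope om q y <= slope om q x.
Proof.
move=> om0 q0 x0 xy; apply: ler_wsqrtr; rewrite ler_wpM2l// lerD2l lerN2.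
have y0 := le_trans x0 xy.
by rewrite !ger0_norm//; apply: ge0_ler_powR; rewrite ?nnegrE.
Qed.

Lemma continuous_calib_deriv om q : 0 < q -> continuous (calib_deriv om q).
Proof.
move=> q0; apply: ctsM; last exact: continuous_slope.
by apply: ctsM; [exact: cts_cst|exact: cts_id].
Qed.

Lemma is_derive_calib om q t : 0 < q ->
  is_derive t 1 (calib om q) (calib_deriv om q t).
Proof. by move=> q0; rewrite calibE; apply: is_derive_prim; exact: continuous_calib_deriv. Qed.

Lemma calib0 om q : calib om q 0 = 0.
Proof. by rewrite calibE prim0. Qed.

Lemma continuous_calib om q : 0 < q -> continuous (calib om q).
Proof.
move=> q0; rewrite calibE; apply: continuous_prim; apply: continuous_loc_int.
exact: continuous_calib_deriv.
Qed.

Lemma calib_nondecreasing om q x y : 0 < q -> 0 <= x -> x <= y ->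
  calib om q x <= calib om q y.
Proof.
move=> q0 x0 xy; rewrite calibE -subr_ge0 primB//; last first.
  by apply: continuous_loc_int; exact: continuous_calib_deriv.
apply: Rintegral_ge0 => t /=; rewrite in_itv/= => /andP[xt _].
by rewrite /calib_deriv !mulr_ge0 ?slope_ge0// (le_trans x0).
Qed.

Definition half_line D := D = `[0, +oo[%classic \/ D = `]-oo, 0]%classic.

Lemma half_line_measurable D : half_line D ->
  measurable (D : set (measurableTypeR R)).
Proof. by case=> ->. Qed.

(** Beyond [x] the half-line still has infinite measure, so [f] is small somewhere farther out. The
    points 0, [x], [y] come in increasing or decreasing order according to the side, and the bound
    is symmetric enough to cover both. *)
Lemma half_line_far D G f C : half_line D ->
  (forall a b c, a <= b -> b <= c -> `[a, c] `<=` D ->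
     `|G b - G a| + `|G c - G b| <= C) ->
  leb.-integrable D (EFin \o f) ->
  forall x e, D x -> 0 < e ->
  exists y, [/\ D y, f y < e & `|G x - G 0| + `|G y - G x| <= C].
Proof.
move=> + GC fi x e Dx e0; case=> DE.
  have x0 : 0 <= x by move: Dx; rewrite DE /= in_itv/= andbT.
  have [||| y] := @integrable_small_value _ (measurableTypeR R) R leb `[x, +oo[%classic f e _ _ _ e0.
  - exact: measurable_itv.
  - by rewrite [LHS](lebesgue_measure_itv `[x, +oo[)/= ltry.
  - apply: integrableS fi => //; first by rewrite DE.
    by rewrite DE; apply: subset_itvr; rewrite bnd_simp.
  rewrite /= in_itv/= andbT => xy fy; exists y; split => //.
    by rewrite DE /= in_itv/= (le_trans x0).
  apply: GC => //; rewrite DE; apply: subset_itv; rewrite bnd_simp//.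
have x0 : x <= 0 by move: Dx; rewrite DE.
have [||| y] := @integrable_small_value _ (measurableTypeR R) R leb `]-oo, x]%classic f e _ _ _ e0.
- exact: measurable_itv.
- by rewrite [LHS](lebesgue_measure_itv `]-oo, x])/= ltNyr.
- apply: integrableS fi => //; first by rewrite DE.
  by rewrite DE; apply: subset_itvl; rewrite bnd_simp.
rewrite /= in_itv/= => yx fy; exists y; split => //.
  by rewrite DE /= in_itv/= (le_trans yx).
rewrite addrC (distrC (G y)) (distrC (G x) (G 0)).
apply: GC => //; rewrite DE; apply: subset_itv; rewrite bnd_simp//.
Qed.

Section half_line_energy.
Variables (D : set R) (r k : R -> R).
Hypothesis hD : half_line D.
Hypotheses (cr : continuous r) (r0 : forall x, 0 <= r x).
Hypotheses (lk : loc_int k) (k0 : forall x, 0 <= k x).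
Hypothesis rk : forall x y, x <= y -> `|r y - r x| <= \int[leb]_(t in `[x, y]) k t.
Hypothesis r2 : leb.-integrable D (EFin \o (fun x => r x ^+ 2)).
Hypothesis k2 : leb.-integrable D (EFin \o (fun x => k x ^+ 2)).

(** The variation of [r^2] is integrable because [2 * r * k <= k^2 + r^2], and [r^2] is below 1 at
    some far point. *)
Lemma half_line_bounded : exists M, forall x, D x -> r x <= M.
Proof.
pose C := \int[leb]_(t in D) (k t ^+ 2 + r t ^+ 2).
have iE : leb.-integrable D (EFin \o (fun t => k t ^+ 2 + r t ^+ 2)).
  by have := integrableD (half_line_measurable hD) k2 r2; exact.
have H := @chain_le_triple R r k (fun t => t ^+ 2) (fun t => 2 * t)
  (fun t => k t ^+ 2 + r t ^+ 2) D _ _ _ cr lk k0 rk _ _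
  (half_line_measurable hD) iE.
have dsqr (t : R) : is_derive t 1 (fun t : R => t ^+ 2) (2 * t).
  by apply: is_derive_eq; rewrite /= scaler1 mulr_natl.
have c2 : continuous (fun t : R => 2 * t).
  by apply: ctsM; [exact: cts_cst|exact: cts_id].
have le2 : {in D, forall t, `|2 * r t| * k t <= k t ^+ 2 + r t ^+ 2}.
  move=> t _; rewrite ger0_norm ?mulr_ge0//.
  by have := sqr_ge0 (r t - k t); rewrite sqrrB; lra.
have {}H := fun a b c => H a b c dsqr c2 le2.
have [M0 HM] : exists M0, forall x, D x -> r x ^+ 2 <= M0.
  exists (1 + C) => x Dx.
  have [y [Dy y1]] := half_line_far hD H r2 Dx ltr01.
  rewrite -/C => HC.
  have : r x ^+ 2 - r y ^+ 2 <= `|r y ^+ 2 - r x ^+ 2| by rewrite distrC ler_norm.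
  have : 0 <= `|r x ^+ 2 - r 0 ^+ 2| by [].
  by lra.
(* [r <= r^2 + 1] passes from squares to values. *)
exists (M0 + 1) => x Dx.
have := HM x Dx; have := sqr_ge0 (r x - 1); rewrite sqrrB expr1n mulr1.
by have := r0 x; lra.
Qed.

(** Going from 0 to [x], [calib (r / N)] changes by at least the difference of its values; from [x]
    outwards it falls to nearly 0. The two variations add up to the left-hand side. The choice
    [x = 0] gives the plain bound, [x] near the supremum the improved one. *)
Lemma half_line_calib om q N : 0 < om -> 0 < q -> 0 < N ->
  (forall x, D x -> r x <= N) ->
  leb.-integrable D
    (EFin \o (fun t => k t ^+ 2 + om * r t ^+ 2 * (1 - (r t / N) `^ q))) /\
  forall x, D x ->
    2 * calib om q (r x / N) - calib om q (r 0 / N) <=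
    N ^- 2 *
      \int[leb]_(t in D) (k t ^+ 2 + om * r t ^+ 2 * (1 - (r t / N) `^ q)).
Proof.
move=> om0 q0 N0 rN.
have rN1 t : D t -> 0 <= r t / N <= 1.
  by move=> Dt; rewrite divr_ge0 ?r0 ?(ltW N0)//= ler_pdivrMr// mul1r rN.
have pN1 t : D t -> 0 <= (r t / N) `^ q <= 1.
  move=> /rN1/andP[r1 r2']; rewrite powR_ge0/=.
  have -> : 1 = 1 `^ q :> R by rewrite powR1.
  by apply: ge0_ler_powR; rewrite ?nnegrE// ltW.
have mD := half_line_measurable hD.
set E := fun t => _ + _.
have cE : continuous (fun t : R => om * r t ^+ 2 * (1 - (r t / N) `^ q)).
  have -> : (fun t => om * r t ^+ 2 * (1 - (r t / N) `^ q)) =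
      (fun t : R => om * r t ^+ 2 * (1 - `|r t / N| `^ q)).
    by apply/funext => t; rewrite ger0_norm// divr_ge0// ltW.
  apply: ctsM; first by apply: ctsM; [exact: cts_cst|exact: ctsX].
  apply: ctsD; [exact: cts_cst|apply: ctsN].
  apply: (@cts_comp R (fun t => r t / N) (fun t => `|t| `^ q)).
    by apply: ctsM => //; exact: cts_cst.
  exact: continuous_norm_powR.
have iE : leb.-integrable D (EFin \o E).
  have i2 : leb.-integrable D (EFin \o (fun t => om * r t ^+ 2 * (1 - (r t / N) `^ q))).
    apply: (le_integrable mD _ _ (integrableZl mD om r2)).
      apply/measurable_EFinP; apply: measurable_funTS.
      exact: measurable_realfun.continuous_measurable_fun.
    move=> t Dt; have omr : 0 <= om * r t ^+ 2 by rewrite mulr_ge0 ?exprn_ge0// ltW.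
    rewrite /= lee_fin normrM ger0_norm// ler_piMr//.
    by rewrite ler_norml; have := pN1 _ Dt; lra.
  by have := integrableD mD k2 i2; exact.
split => // x Dx.
pose H := fun y => calib om q (y / N).
have cont_h : continuous (fun y => calib_deriv om q (y / N) / N).
  apply: ctsM; last exact: cts_cst.
  apply: (@cts_comp R (fun y => y / N)); last exact: continuous_calib_deriv.
  by apply: ctsM; [exact: cts_id|exact: cts_cst].
have dH (y : R) : is_derive y 1 H (calib_deriv om q (y / N) / N).
  have d1 : is_derive y 1 (fun y : R => y / N) N^-1.
    by apply: is_derive_eq; rewrite /= scaler0 add0r scaler1.
  by have := @is_derive1_comp R (calib om q) (fun y => y / N) y _ _ (is_derive_calib om (y / N) q0) d1.
(* The pointwise calibration is [2 * k * (r * s) <= k^2 + (r * s)^2]; its equality case [k = r * s]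
   is the soliton equation. *)
have hE : {in D, forall t, `|calib_deriv om q (r t / N) / N| * k t <= N ^- 2 * E t}.
  move=> t /set_mem Dt; have /andP[r1 r2'] := rN1 _ Dt.
  rewrite ger0_norm; last first.
    by rewrite /calib_deriv divr_ge0 ?(ltW N0)// mulr_ge0 ?slope_ge0// mulr_ge0.
  have Hs : slope om q (r t / N) ^+ 2 = om * (1 - (r t / N) `^ q).
    by rewrite (sqr_slope (ltW om0) (ltW q0)) ger0_norm.
  rewrite /E /calib_deriv; set s := slope _ _ _ in Hs *.
  have -> : om * r t ^+ 2 * (1 - (r t / N) `^ q) = (r t * s) ^+ 2.
    by rewrite exprMn Hs; ring.
  have -> : 2 * (r t / N) * s / N * k t = N ^- 2 * (2 * (k t * (r t * s))).
    by field; rewrite gt_eqF.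
  rewrite ler_wpM2l ?invr_ge0 ?exprn_ge0 ?(ltW N0)//.
  by have := sqr_ge0 (k t - r t * s); rewrite sqrrB; lra.
have iE2 : leb.-integrable D (EFin \o (fun t => N ^- 2 * E t)).
  exact: (integrableZl mD (N ^- 2) iE).
have HC a b c (ab : a <= b) (bc : b <= c) (acD : `[a, c] `<=` D) :=
  chain_le_triple cr lk k0 rk dH cont_h mD iE2 hE ab bc acD.
rewrite -RintegralZl//.
apply/ler_addgt0Pr => e e0.
have /cvgrPdist_lt/(_ _ e0) := @continuous_calib om q q0 0.
rewrite calib0 => /nbhs_ballP[d /= d0 Hd].
(* The threshold is a square because the integrable quantity is [r^2]; it yields [r y / N < d] at
   the far point. *)
have dN0 : 0 < (d * N) ^+ 2 by rewrite exprn_gt0 ?mulr_gt0.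
have [y [Dy yd HCx]] := half_line_far (G := H \o r) hD HC r2 Dx dN0.
have ryd : r y / N < d.
  rewrite ltr_pdivrMr//; rewrite -(@ltr_pXn2r _ 2)// nnegrE//.
  by rewrite mulr_ge0// ltW.
have : `|0 - calib om q (r y / N)| < e.
  apply: Hd; rewrite /ball/= sub0r normrN ger0_norm//.
  by rewrite divr_ge0// ltW.
rewrite sub0r normrN => He.
have H1 := ler_norm (calib om q (r y / N)).
have H2 := ler_norm (H (r x) - H (r 0)).
have H3 : H (r x) - H (r y) <= `|H (r y) - H (r x)| by rewrite distrC ler_norm.
by move: HCx; rewrite /= /H in H2 H3 *; lra.
Qed.

End half_line_energy.
End calibration.

(** * Optimizing the boundary value *)

Section boundary_optimization.
Context {R : realType}.
Variables om q : R.
Hypotheses (om0 : 0 < om) (q0 : 0 < q).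
Implicit Types (sg w b x y N M B : R) (e : bool).
Local Notation S := (slope om q).
Local Notation g := (calib om q).

(** Multiplying by sums of slopes turns the differences into differences of [om * z^q]. Scaling the
    arguments by [sg] multiplies these by [sg^q <= 1], while it can only enlarge the sums. The
    inequality expresses the monotonicity of [bdry false]. *)
Lemma slope_scale_le sg x y : 0 <= sg -> sg <= 1 -> 0 <= x -> x <= y -> y <= 1 ->
  sg ^+ 2 * (S (sg * x) - S (sg * y)) <= S x - S y.
Proof.
move=> sg0 sg1 x0 xy y1.
have y0 := le_trans x0 xy; have x1 := le_trans xy y1.
have sgle z : 0 <= z -> sg * z <= z by move=> z0; rewrite ler_piMl.
have sqS z : 0 <= z -> z <= 1 -> S z ^+ 2 = om * (1 - z `^ q).
  by move=> z0 z1; rewrite (sqr_slope (ltW om0) (ltW q0)) ger0_norm.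
have E z : 0 <= z -> z <= 1 -> S (sg * z) ^+ 2 = om * (1 - sg `^ q * z `^ q).
  move=> z0 z1; rewrite sqS ?mulr_ge0//; last exact: le_trans (sgle _ z0) _.
  by rewrite powRM.
have Sm z : 0 <= z -> S z <= S (sg * z).
  move=> z0; apply: slope_nonincreasing; [exact: ltW|exact: ltW|exact: mulr_ge0|].
  exact: sgle.
have dS : 0 <= S (sg * x) - S (sg * y).
  rewrite subr_ge0; apply: slope_nonincreasing; rewrite ?(ltW om0) ?(ltW q0) ?mulr_ge0//.
  exact: ler_wpM2l.
have dS1 : 0 <= S x - S y.
  by rewrite subr_ge0; apply: slope_nonincreasing; rewrite ?(ltW om0) ?(ltW q0).
apply: (@le_trans _ _ (S (sg * x) - S (sg * y))).
  by rewrite ler_piMl// expr_le1.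
(* If the sum is not positive, both scaled slopes are 0 and so is their difference. *)
have [A0|A0] := leP (S (sg * x) + S (sg * y)) 0.
  have := slope_ge0 om q (sg * x); have := slope_ge0 om q (sg * y).
  by move=> h1 h2; apply: le_trans dS1; lra.
rewrite -(ler_pM2r A0).
apply: (@le_trans _ _ ((S x - S y) * (S x + S y))); last first.
  by rewrite ler_wpM2l// lerD// Sm.
rewrite -!subr_sqr !E// !sqS//.
have -> : om * (1 - sg `^ q * x `^ q) - om * (1 - sg `^ q * y `^ q) =
  sg `^ q * (om * (1 - x `^ q) - om * (1 - y `^ q)) by ring.
rewrite ler_piMl//.
  rewrite -!sqS// subr_ge0 ler_pXn2r ?nnegrE ?slope_ge0//.
  by rewrite -subr_ge0.
have -> : 1 = 1 `^ q :> R by rewrite powR1.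
by apply: ge0_ler_powR; rewrite ?nnegrE// ltW.
Qed.

(* [b] is the boundary value of the profile on the side where it is larger,
   [sg * b] the one on the other side; the peak lies inside the larger side
   exactly when [e] is false. Up to the factor [2 * b], [bdry] is the
   derivative in [b] of the energy [bdry_min]. *)
Definition bdry e w sg b := (if e then S b else - S b) + sg ^+ 2 * S (sg * b) - w.

(** A side that decays from [b] costs [g b], a side that first climbs to the peak costs
    [2 * g 1 - g b]; the last term is the point interaction. *)
Definition bdry_min e w sg b :=
  (if e then g b else 2 * g 1 - g b) + g (sg * b) - w * b ^+ 2.

(** Both branches agree at [b = 1], where [slope] vanishes. At 0 the branch [true] is positive by
    the bound on [w], and [false] is negative because [sg <= 1]. The sign at 1 thus selects a branch
    to which the intermediate value theorem applies. *)
Lemma exists_bdry sg w : 0 < sg -> sg <= 1 -> 0 < w ->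
  w < Num.sqrt om * (1 + sg ^+ 2) ->
  exists e b, [/\ 0 < b, b <= 1 & bdry e w sg b = 0].
Proof.
move=> sg0 sg1 w0 wlt.
have cS2 : continuous (fun b => sg ^+ 2 * S (sg * b)).
  apply: ctsM; first exact: cts_cst.
  apply: (@cts_comp R (fun b => sg * b)); last exact: continuous_slope.
  by apply: ctsM; [exact: cts_cst|exact: cts_id].
have cb e : continuous (bdry e w sg).
  apply: ctsD; last exact: cts_cst.
  apply: ctsD => //; case: e; first exact: continuous_slope.
  by apply: ctsN; exact: continuous_slope.
have b0 e : bdry e w sg 0 = (if e then 1 else -1) * Num.sqrt om +
   sg ^+ 2 * Num.sqrt om - w.
  by rewrite /bdry mulr0 slope0//; case: e; ring.
have b1 e : bdry e w sg 1 = sg ^+ 2 * S sg - w.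
  by rewrite /bdry mulr1 slope1; case: e; ring.
have nz e b : bdry e w sg b = 0 -> bdry e w sg 0 != 0 -> 0 <= b -> 0 < b.
  move=> Eb H b_ge0; rewrite lt_def b_ge0 andbT; apply/eqP => b0'.
  by move: H; rewrite -[X in bdry e w sg X]b0' Eb eqxx.
have [h|h] := leP (sg ^+ 2 * S sg) w.
  have ht : 0 < bdry true w sg 0.
    by rewrite b0 mul1r; move: wlt; rewrite mulrDr mulr1; lra.
  have [|b + Eb] := @IVT R (bdry true w sg) 0 1 0 ler01 (continuous_subspaceT (cb true)).
    by rewrite minEle maxEle; case: ifPn; rewrite b1; lra.
  rewrite in_itv/= => /andP[b_ge0 b_le1].
  by exists true, b; split => //; apply: nz Eb _ b_ge0; rewrite gt_eqF.
have so0 : 0 <= Num.sqrt om by exact: sqrtr_ge0.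
have ht : bdry false w sg 0 < 0.
  rewrite b0 mulN1r.
  have : sg ^+ 2 * Num.sqrt om <= Num.sqrt om.
    by rewrite ler_piMl// expr_le1// ltW.
  by lra.
have [|b + Eb] := @IVT R (bdry false w sg) 0 1 0 ler01 (continuous_subspaceT (cb false)).
  by rewrite minEle maxEle; case: ifPn; rewrite b1; lra.
rewrite in_itv/= => /andP[b_ge0 b_le1].
by exists false, b; split => //; apply: nz Eb _ b_ge0; rewrite lt_eqF.
Qed.

Lemma bdry_false_mono sg w x y : 0 <= sg -> sg <= 1 -> 0 <= x -> x <= y ->
  y <= 1 -> bdry false w sg x <= bdry false w sg y.
Proof.
move=> sg0 sg1 x0 xy y1.
by have := slope_scale_le sg0 sg1 x0 xy y1; rewrite /bdry mulrBr; lra.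
Qed.

Lemma is_derive_bdry_min sg w (b : R) :
  is_derive b 1 (bdry_min false w sg) (2 * b * bdry false w sg b).
Proof.
have d1 := is_derive_calib om b q0.
have dm : is_derive b 1 (fun b : R => sg * b) sg.
  by apply: is_derive_eq; rewrite /GRing.scale/=; ring.
have d2 := @is_derive1_comp R g (fun b => sg * b) b _ _ (is_derive_calib om (sg * b) q0) dm.
have d3 : is_derive b 1 (fun b : R => w * b ^+ 2) (w * (2 * b)).
  by apply: is_derive_eq; rewrite /GRing.scale/=; ring.
have d4 := is_deriveB (is_deriveD (is_deriveB (is_derive_cst (2 * g 1) b 1) d1) d2) d3.
apply: is_derive_eq d4 _; rewrite /bdry /calib_deriv; ring.
Qed.

(** As [bdry false] is nondecreasing, the derivative is nonpositive before [b0] and nonnegative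
    after it. *)
Lemma bdry_min_false_le sg w b0 b : 0 <= sg -> sg <= 1 -> 0 <= b0 -> b0 <= 1 ->
  bdry false w sg b0 = 0 -> 0 <= b -> b <= 1 ->
  bdry_min false w sg b0 <= bdry_min false w sg b.
Proof.
move=> sg0 sg1 b00 b01 Eb0 b_ge0 b_le1.
have [xi [xi1 xi2 E]] := MVT_between b0 b (is_derive_bdry_min sg w).
rewrite -subr_ge0 E; have [bb|bb] := leP b0 b.
  move: xi1 xi2; rewrite (min_idPl bb) (max_idPr bb) => xi1 xi2.
  apply: mulr_ge0; last by rewrite subr_ge0.
  apply: mulr_ge0; first by rewrite mulr_ge0// (le_trans b00).
  by rewrite -Eb0; apply: bdry_false_mono => //; exact: le_trans b_le1.
move: xi1 xi2; rewrite (min_idPr (ltW bb)) (max_idPl (ltW bb)) => xi1 xi2.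
apply: mulr_le0; last by rewrite subr_le0 ltW.
apply: mulr_ge0_le0; first by rewrite mulr_ge0// (le_trans b_ge0).
by rewrite -Eb0; apply: bdry_false_mono => //; exact: le_trans xi1.
Qed.

(** At [b0] itself the branch [true] has the lower energy, since [g b0 <= g 1]. To the left of [b0]
    the energy of [false] is nonincreasing, because [bdry false] is nondecreasing and at [b0] lies
    below [bdry true = 0]. *)
Lemma bdry_min_true_le sg w b0 b : 0 <= sg -> sg <= 1 -> 0 <= b0 -> b0 <= 1 ->
  bdry true w sg b0 = 0 -> 0 <= b -> b <= b0 ->
  bdry_min true w sg b0 <= bdry_min false w sg b.
Proof.
move=> sg0 sg1 b00 b01 Eb0 b_ge0 bb.
apply: (@le_trans _ _ (bdry_min false w sg b0)).
  have := calib_nondecreasing om q0 b00 b01.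
  by rewrite /bdry_min; lra.
have [xi [xi1 xi2 E]] := MVT_between b b0 (is_derive_bdry_min sg w).
rewrite -subr_le0 E.
move: xi1 xi2; rewrite (min_idPl bb) (max_idPr bb) => xi1 xi2.
apply: mulr_le0_ge0; last by rewrite subr_ge0.
apply: mulr_ge0_le0; first by rewrite mulr_ge0// (le_trans b_ge0).
apply: (@le_trans _ _ (bdry false w sg b0)).
  by apply: bdry_false_mono => //; exact: le_trans xi1.
by move: Eb0; rewrite /bdry; have := slope_ge0 om q b0; lra.
Qed.

(** [B] and [sg * B] stand for the boundary values, [M] for the supremum of the modulus, [Eb] and
    [Es] for the normalized energies of the two sides. The improved bound is available only at
    [N = M], the plain ones at every larger [N]; the latter serve the branch [true] when [B / M]
    exceeds [b0]. *)
Lemma energy_lower_bound sg w e b0 M B (Eb Es : R -> R) :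
  0 <= sg -> sg <= 1 -> 0 < b0 -> b0 <= 1 -> bdry e w sg b0 = 0 ->
  0 < M -> 0 <= B -> B <= M ->
  (forall N, M <= N -> g (B / N) <= Eb N) ->
  (forall N, M <= N -> g (sg * B / N) <= Es N) ->
  (2 * g 1 - g (B / M) <= Eb M \/ 2 * g 1 - g (sg * B / M) <= Es M) ->
  exists2 N, M <= N & bdry_min e w sg b0 <= Eb N + Es N - w * (B / N) ^+ 2.
Proof.
move=> sg0 sg1 b00 b01 Eb0 M0 B0 BM HEb HEs Hsup.
have BM1 : B / M <= 1 by rewrite ler_pdivrMr// mul1r.
have BM0 : 0 <= B / M by rewrite divr_ge0// ltW.
have HM : bdry_min false w sg (B / M) <= Eb M + Es M - w * (B / M) ^+ 2.
  have h1 := HEb M (lexx M); have h2 := HEs M (lexx M).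
  (* If the improved bound comes from the side with the smaller boundary value, the total is even
     larger, by [2 * (g (B / M) - g (sg * B / M))]. *)
  have h3 : g (sg * B / M) <= g (B / M).
    rewrite -mulrA; apply: calib_nondecreasing => //; first exact: mulr_ge0.
    exact: ler_piMl.
  by rewrite /bdry_min mulrA; case: Hsup; lra.
case: e Eb0 => Eb0; last first.
  exists M => //; apply: le_trans HM.
  exact: bdry_min_false_le (ltW b00) b01 Eb0 BM0 BM1.
have [h|h] := leP (B / b0) M.
  exists M => //; apply: le_trans HM.
  apply: bdry_min_true_le (ltW b00) b01 Eb0 BM0 _ => //.
  by move: h; rewrite !ler_pdivrMr// mulrC.
have Bgt0 : B != 0.
  by apply/eqP => B0'; move: h; rewrite B0' mul0r ltNge ltW.
(* This normalization moves the boundary value to [b0], where the plain bounds already give the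
   energy of the branch [true]. *)
exists (B / b0); first exact: ltW.
have EB : B / (B / b0) = b0 by field; rewrite Bgt0 gt_eqF.
have := HEb _ (ltW h); have := HEs _ (ltW h).
by rewrite -mulrA EB /bdry_min; lra.
Qed.

End boundary_optimization.

(** * Explicit C^1 cutoff functions *)

Section tent.
Context {R : realType}.
Local Notation leb := (@lebesgue_measure R).
Implicit Types (a b c e x s : R).

(** Cutoffs assembled from [s * |s|] have global formulas for themselves and their derivatives. At 0
    the difference quotient is [|s|], which is continuous. *)
Lemma is_derive_mul_norm x : is_derive x 1 (fun s : R => s * `|s|) (2 * `|x|).
Proof.
have sq (y : R) : is_derive y 1 (fun s : R => s * s) (2 * y).
  by apply: is_derive_eq; rewrite /GRing.scale/=; ring.
have [x0|x0|->] := ltgtP x 0.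
- rewrite ltr0_norm// mulrN; apply: near_eq_is_derive (is_deriveN (sq x)).
  by near=> y; rewrite ltr0_norm ?mulrN//; near: y; exact: lt_nbhsl.
- rewrite gtr0_norm//; apply: near_eq_is_derive (sq x).
  by near=> y; rewrite gtr0_norm//; near: y; exact: lt_nbhsr.
- rewrite normr0 mulr0; apply/is_derive1_caratheodory; exists Num.norm.
  split; [|exact: norm_continuous|exact: normr0].
  by move=> z; rewrite mul0r !subr0 mulrC.
Unshelve. all: by end_near. Qed.

(** The hat function of height [1 / e] on [[c - e, c + e]], written as a second difference of the
    absolute value. *)
Definition tent e c x : R := (`|x - c + e| + `|x - c - e| - 2 * `|x - c|) / (2 * e ^+ 2).

Definition ramp e c x : R :=
  ((x - c + e) * `|x - c + e| + (x - c - e) * `|x - c - e| -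
   2 * ((x - c) * `|x - c|)) / (4 * e ^+ 2).

Lemma continuous_tent e c : continuous (tent e c).
Proof.
have cl d : continuous (fun x : R => `|x - c + d|).
  by apply: cts_norm; apply: ctsD; [apply: ctsD; [exact: cts_id|]|]; exact: cts_cst.
apply: ctsM; last exact: cts_cst.
apply: ctsD; first by apply: ctsD; exact: cl.
apply: ctsN; apply: ctsM; first exact: cts_cst.
by apply: cts_norm; apply: ctsD; [exact: cts_id|exact: cts_cst].
Qed.

Lemma is_derive_ramp e c x : e != 0 -> is_derive x 1 (ramp e c) (tent e c x).
Proof.
move=> e0.
have dl d : is_derive x 1 (fun x : R => (x - c + d) * `|x - c + d|) (2 * `|x - c + d|).
  have d1 : is_derive x 1 (fun x : R => x - c + d) 1.
    by apply: is_derive_eq; ring.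
  by have := der_comp d1 (is_derive_mul_norm (x - c + d)); rewrite mulr1.
have d0 : is_derive x 1 (fun x : R => (x - c) * `|x - c|) (2 * `|x - c|).
  have := dl 0; rewrite addr0.
  by under [X in is_derive _ _ X]eq_fun do rewrite addr0.
have := derZ (4 * e ^+ 2)^-1 (derD (derD (dl e) (dl (- e))) (derN (derZ 2 d0))).
rewrite (_ : (fun y => (4 * e ^+ 2)^-1 * _) = ramp e c); last first.
  by apply/funext => y; rewrite /ramp mulrC.
by move=> H; apply: is_derive_eq H _; rewrite /tent; field.
Qed.

Lemma tent_bound e c x : 0 < e -> 0 <= tent e c x <= e^-1.
Proof.
move=> e0; have e2 : 0 < 2 * e ^+ 2 by rewrite mulr_gt0// exprn_gt0.
rewrite divr_ge0 ?(ltW e2)//=; last first.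
  rewrite subr_ge0; have := ler_normD (x - c + e) (x - c - e).
  have -> : x - c + e + (x - c - e) = 2 * (x - c) by ring.
  by rewrite normrM ger0_norm.
rewrite ler_pdivrMr//.
have -> : e^-1 * (2 * e ^+ 2) = 2 * e by field; rewrite gt_eqF.
have := ler_normD (x - c) e; have := ler_normD (x - c) (- e).
by rewrite normrN (gtr0_norm e0); lra.
Qed.

Lemma ramp_left e c x : 0 < e -> x <= c - e -> ramp e c x = - 2^-1.
Proof.
move=> e0 xe; rewrite /ramp !ler0_norm; [|lra..].
by field; rewrite gt_eqF.
Qed.

Lemma ramp_right e c x : 0 < e -> c + e <= x -> ramp e c x = 2^-1.
Proof.
move=> e0 xe; rewrite /ramp !ger0_norm; [|lra..].
by field; rewrite gt_eqF.
Qed.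

Lemma tent_left e c x : 0 < e -> x <= c - e -> tent e c x = 0.
Proof.
move=> e0 xe; rewrite /tent !ler0_norm; [|lra..].
by field; rewrite gt_eqF.
Qed.

Lemma tent_right e c x : 0 < e -> c + e <= x -> tent e c x = 0.
Proof.
move=> e0 xe; rewrite /tent !ger0_norm; [|lra..].
by field; rewrite gt_eqF.
Qed.

Lemma ramp_bound e c x : 0 < e -> `|ramp e c x| <= 2^-1.
Proof.
move=> e0.
have dr (y : R) : is_derive y 1 (ramp e c) (tent e c y).
  by apply: is_derive_ramp; rewrite gt_eqF.
have mono y z : y <= z -> ramp e c y <= ramp e c z.
  move=> yz; have [xi [_ _ E]] := MVT_between y z dr.
  rewrite -subr_ge0 E mulr_ge0 ?subr_ge0//.
  by case/andP: (tent_bound c xi e0).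
have [x1|x1] := leP x (c - e); first by rewrite ramp_left// normrN ger0_norm.
have [x2|x2] := leP (c + e) x; first by rewrite ramp_right// ger0_norm.
rewrite ler_norml -{1}(ramp_left e0 (lexx (c - e))) -(ramp_right e0 (lexx (c + e))).
by rewrite !mono// ltW.
Qed.

Lemma integral_tent e c : 0 < e ->
  \int[leb]_(x in `[c - e, c + e]) tent e c x = 1.
Proof.
move=> e0.
have dr (y : R) : is_derive y 1 (ramp e c) (tent e c y).
  by apply: is_derive_ramp; rewrite gt_eqF.
have cr : continuous (ramp e c).
  exact: der_cts dr.
rewrite /Rintegral (@continuous_FTC2 _ (tent e c) (ramp e c)); first last.
- by move=> x _; rewrite derive1E; exact: derive_val.
- split => //; [exact: cvg_at_right_filter (cr _)|exact: cvg_at_left_filter (cr _)].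
- by apply: continuous_subspaceT; exact: continuous_tent.
- by lra.
- by rewrite /= (ramp_left e0 (lexx _)) (ramp_right e0 (lexx _)); field.
Qed.

(** A C^1 approximation of the indicator of [[a, b]]; outside, the limits [1/2] or [-1/2] of the two
    ramps cancel, so the support is compact. *)
Definition plateau e a b x : R := ramp e a x - ramp e b x.

Definition dplateau e a b x : R := tent e a x - tent e b x.

Section plateau.
Variables e a b : R.
Hypotheses (e0 : 0 < e) (eab : a + e <= b - e).

Lemma is_derive_plateau x : is_derive x 1 (plateau e a b) (dplateau e a b x).
Proof. by apply: derD; [|apply: derN]; apply: is_derive_ramp; rewrite gt_eqF. Qed.

Lemma continuous_plateau : continuous (plateau e a b).
Proof. exact: der_cts is_derive_plateau. Qed.

Lemma derive1_plateau : derive1 (plateau e a b) = dplateau e a b.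
Proof.
by apply/funext => x; rewrite derive1E; have dx := is_derive_plateau x; exact: derive_val.
Qed.

Lemma continuous_dplateau : continuous (dplateau e a b).
Proof. by apply: ctsD; [|apply: ctsN]; exact: continuous_tent. Qed.

Lemma plateau_out x : ~ `[a - e, b + e]%classic x -> plateau e a b x = 0.
Proof.
move=> /negP; rewrite /= in_itv/= negb_and -!ltNge => /orP[h|h].
  have h1 : x <= a - e by exact: ltW.
  have h2 : x <= b - e by move: e0 eab h; lra.
  by rewrite /plateau !ramp_left// subrr.
have h1 : b + e <= x by exact: ltW.
have h2 : a + e <= x by move: e0 eab h; lra.
by rewrite /plateau !ramp_right// subrr.
Qed.

Lemma dplateau_out x : ~ `[a - e, b + e]%classic x -> dplateau e a b x = 0.
Proof.
move=> /negP; rewrite /= in_itv/= negb_and -!ltNge => /orP[h|h].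
  have h1 : x <= a - e by exact: ltW.
  have h2 : x <= b - e by move: e0 eab h; lra.
  by rewrite /dplateau !tent_left// subrr.
have h1 : b + e <= x by exact: ltW.
have h2 : a + e <= x by move: e0 eab h; lra.
by rewrite /dplateau !tent_right// subrr.
Qed.

Lemma plateau_mid x : a + e <= x -> x <= b - e -> plateau e a b x = 1.
Proof. by move=> x1 x2; rewrite /plateau ramp_right// (@ramp_left _ b)//; field. Qed.

Lemma dplateau_left x : x <= b - e -> dplateau e a b x = tent e a x.
Proof. by move=> x2; rewrite /dplateau (@tent_left _ b)// subr0. Qed.

Lemma dplateau_right x : a + e <= x -> dplateau e a b x = - tent e b x.
Proof. by move=> x1; rewrite /dplateau tent_right// sub0r. Qed.

Lemma plateau_le1 x : `|plateau e a b x| <= 1.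
Proof.
have := ramp_bound a x e0; have := ramp_bound b x e0.
have := ler_normB (ramp e a x) (ramp e b x).
by rewrite /plateau; lra.
Qed.

Lemma test_fun_plateau (I : set R) : `[a - e, b + e] `<=` I -> test_fun I (plateau e a b).
Proof.
move=> JI; split; first by move=> x; have dx := is_derive_plateau x; exact: ex_derive.
  by rewrite derive1_plateau; exact: continuous_dplateau.
exists `[a - e, b + e]%classic; split; first exact: segment_compact.
  exact: JI.
exact: plateau_out.
Qed.

End plateau.
End tent.

(** * Weak derivatives and primitives *)

Section weak_derivative.
Context {R : realType}.
Local Notation leb := (@lebesgue_measure R).
Implicit Types (I : set R) (U G f : R -> R) (a b c e x : R).

Lemma Rintegral_support (A B : set R) f : B `<=` A ->
  (forall x, A x -> ~ B x -> f x = 0) ->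
  \int[leb]_(x in A) f x = \int[leb]_(x in B) f x.
Proof.
move=> BA f0; rewrite Rintegral_mkcond [RHS]Rintegral_mkcond.
congr Rintegral; apply/funext => x; rewrite !patchE.
have [xB|xB] := boolP (x \in B).
  by rewrite mem_set//; exact/BA/set_mem.
case: ifPn => // /set_mem xA; apply: f0 => //.
by move=> /mem_set; rewrite (negbTE xB).
Qed.

Lemma measurable_restrict0 I f : measurable (I : set (measurableTypeR R)) ->
  measurable_fun I f -> measurable_fun setT (f \_ I).
Proof. by move=> mI mf; apply/(measurable_restrictT _ mI). Qed.

(** On a segment the function [1 + f^2] is integrable and dominates [|f|]. *)
Lemma loc_int_sqr I f : measurable (I : set (measurableTypeR R)) ->
  measurable_fun I f -> leb.-integrable I (EFin \o (fun x => f x ^+ 2)) ->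
  loc_int (f \_ I).
Proof.
move=> mI mf f2 a b.
have mfI := measurable_restrict0 mI mf.
have i2 : leb.-integrable `[a, b] (EFin \o (fun x => 1 + (f \_ I) x ^+ 2)).
  have H : leb.-integrable setT (EFin \o ((fun x => f x ^+ 2) \_ I)).
    by move: f2 => /(integrable_mkcond _ mI); rewrite restrict_EFin.
  have H2 : leb.-integrable `[a, b] (EFin \o (fun x => (f \_ I) x ^+ 2)).
    rewrite (_ : (fun x => _) = (fun x => f x ^+ 2) \_ I); last first.
      apply/funext => x; rewrite !patchE; case: ifPn => // _.
      by rewrite expr0n.
    exact: integrableS H.
  have H1 := continuous_loc_int (@cts_cst R 1) a b.
  by have := integrableD _ H1 H2; exact.
apply: le_integrable i2 => //.
  by apply/measurable_EFinP; exact: measurable_funTS.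
move=> x _; rewrite /= lee_fin [leRHS]ger0_norm ?addr_ge0 ?sqr_ge0//.
have := sqr_ge0 (`|(f \_ I) x| - 1); rewrite sqrrB real_normK ?num_real// expr1n.
by have := normr_ge0 ((f \_ I) x); lra.
Qed.

Lemma lebesgue_pt_average f c e : measurable_fun setT f -> loc_int f ->
  lebesgue_pt f c -> 0 < e ->
  \forall r \near 0^'+,
    \int[leb]_(x in `[c - r, c + r]) `|f x - f c| <= e * r.
Proof.
move=> mf lf fc e0.
(* Half of [e], because the average is taken over a ball of measure [2 * r]. *)
have e2 : 0 < e / 2 by rewrite divr_gt0.
have := fc; rewrite /lebesgue_pt => /fine_cvgP[ffin].
move=> /cvgrPdist_lt/(_ _ e2) H.
near=> r.
have r0 : 0 < r by near: r; exact: nbhs_right_gt.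
have : `|0 - fine (davg f c r)| < e / 2 by near: r.
have : davg f c r \is a fin_num by near: r.
rewrite sub0r normrN /davg /iavg.
have lg : loc_int (fun x => `|f x - f c|).
  apply: loc_int_norm; apply: loc_intD => //.
  by apply: continuous_loc_int; exact: cts_cst.
rewrite (lebesgue_measure_ball _ (ltW r0)) ball_itv.
have -> : (\int[leb]_(y in `](c - r)%R, (c + r)%R[) `|((center (f c) \o f) y)%:E| =
    (\int[leb]_(x in `[(c - r), (c + r)]) `|f x - f c|)%:E)%E.
  rewrite /Rintegral fineK; last by rewrite integrable_fin_num//; exact: lg.
  rewrite -(@integral_itv_bndoo _ _ _ _ true false).
    by apply: eq_integral => y _; rewrite /= addrC.
  apply/measurable_EFinP; apply: measurableT_comp => //.
  by apply: measurable_funD => //; exact: measurable_funTS.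
rewrite inver mulrn_eq0/= gt_eqF// -EFinM => _ /= /ltW.
set J := Rintegral _ _ _.
rewrite ger0_norm; last first.
  by rewrite mulr_ge0// ?invr_ge0 ?mulrn_wge0 ?(ltW r0)// Rintegral_ge0.
rewrite ler_pdivrMl ?pmulrn_lgt0//.
by have -> : r *+ 2 * (e / 2) = e * r by rewrite -mulr_natl; field.
Unshelve. all: by end_near. Qed.

(** The tents have integral 1 and height at most [1 / r] on an interval of radius [r], so a Lebesgue
    point suffices and [f] need not be continuous. *)
Lemma tent_average f c e : measurable_fun setT f -> loc_int f ->
  lebesgue_pt f c -> 0 < e ->
  \forall r \near 0^'+,
    `|\int[leb]_(x in `[c - r, c + r]) (f x * tent r c x) - f c| <= e.
Proof.
move=> mf lf fc e0; near=> r.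
have r0 : 0 < r by near: r; exact: nbhs_right_gt.
have H : \int[leb]_(x in `[c - r, c + r]) `|f x - f c| <= e * r.
  by near: r; exact: lebesgue_pt_average.
have ct := @continuous_tent R r c.
have lft : loc_int (fun x => f x * tent r c x).
  rewrite (_ : (fun x => _) = (fun x => tent r c x * f x)); last first.
    by apply/funext => x; rewrite mulrC.
  exact: loc_intM.
have lct : loc_int (fun x => f c * tent r c x).
  by apply: loc_intZ; exact: continuous_loc_int.
rewrite -[X in _ - X](mulr1 (f c)) -(integral_tent c r0) -RintegralZl//; last first.
  exact: continuous_loc_int.
rewrite -RintegralB//.
have ld : loc_int (fun x => `|f x - f c|).
  apply: loc_int_norm; apply: loc_intD => //.
  by apply: continuous_loc_int; exact: cts_cst.
have lB : loc_int (fun x => f x * tent r c x - f c * tent r c x).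
  rewrite (_ : (fun x => _) = (fun x => tent r c x * (f x - f c))); last first.
    by apply/funext => x; ring.
  apply: loc_intM => //; apply: loc_intD => //.
  by apply: continuous_loc_int; exact: cts_cst.
apply: le_trans (le_normr_Rintegral _ (lB _ _)) _ => //.
apply: (@le_trans _ _ (\int[leb]_(x in `[c - r, c + r]) (r^-1 * `|f x - f c|))).
  apply: le_Rintegral => //; [exact: loc_int_norm|exact: loc_intZ|].
  move=> x _; rewrite -mulrBl normrM mulrC ler_wpM2r//.
  by have /andP[t0 t1] := tent_bound c x r0; rewrite ger0_norm.
by rewrite RintegralZl// ?ler_pdivrMl// 1?mulrC//; exact: ld.
Unshelve. all: by end_near. Qed.

Lemma near_right_pm c (A : set R) : nbhs c A ->
  \forall r \near 0^'+, A (c + r) /\ A (c - r).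
Proof.
move=> /nbhs_ballP[d /= d0 Hd]; near=> r.
have r0 : 0 < r by near: r; exact: nbhs_right_gt.
have rd : r < d by near: r; exact: nbhs_right_lt.
split; apply: Hd; rewrite /ball/=.
  by rewrite opprD addrA subrr sub0r normrN gtr0_norm.
by rewrite opprB addrC subrK gtr0_norm.
Unshelve. all: by end_near. Qed.

(** Testing with [plateau r a b] compares weighted averages of [U] around [a] and [b] with an
    integral of [G]. At Lebesgue points the averages tend to the values of [U] as [r] tends to 0. *)
Lemma increment_weak_derivative I U G a b :
  open I -> (forall x y, I x -> I y -> `[x, y] `<=` I) ->
  measurable_fun setT (U \_ I) -> loc_int (U \_ I) -> loc_int (G \_ I) ->
  (forall phi, test_fun I phi ->
     \int[leb]_(x in I) (U x * derive1 phi x) =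
     - \int[leb]_(x in I) (G x * phi x)) ->
  I a -> I b -> a < b -> lebesgue_pt (U \_ I) a -> lebesgue_pt (U \_ I) b ->
  U b - U a = \int[leb]_(x in `[a, b]) (G \_ I) x.
Proof.
move=> oI itvI mU lU lG weak Ia Ib ab La Lb.
set Ue := U \_ I in mU lU La Lb *; set Ge := G \_ I in lG *.
have UeI x : I x -> Ue x = U x by move=> Ix; rewrite /Ue patchE mem_set.
have GeI x : I x -> Ge x = G x by move=> Ix; rewrite /Ge patchE mem_set.
have lnG := loc_int_norm lG.
pose P := prim (fun x => `|Ge x|).
have cP : continuous P by exact: continuous_prim.
apply/eqP; rewrite -subr_eq0 -normr_le0; apply/ler_addgt0Pl => e e0; rewrite addr0.
(* Six errors share [e]: two averages of [U], the two weighted integrals of [G] over the transition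
   zones, and the two pieces of [[a, b]] that lie in these zones. *)
have e6 : 0 < e / 6 by rewrite divr_gt0.
have Pc c : \forall r \near 0^'+, P (c + r) - P (c - r) <= e / 6.
  have e12 : 0 < e / 12 by rewrite divr_gt0.
  have /cvgrPdist_lt/(_ _ e12)/near_right_pm := cP c.
  apply: filterS => s; rewrite !ltr_norml => -[/andP[? ?] /andP[? ?]].
  by lra.
near (0%R : R)^'+ => r.
have r0 : 0 < r by near: r; exact: nbhs_right_gt.
have rab : a + r < b - r.
  have : r < (b - a) / 2.
    by near: r; apply: nbhs_right_lt; rewrite divr_gt0// subr_gt0.
  by rewrite ltr_pdivlMr//; lra.
have [_ Iar] : I (a + r) /\ I (a - r) by near: r; apply: near_right_pm; exact: open_nbhs_nbhs.
have [Ibr _] : I (b + r) /\ I (b - r) by near: r; apply: near_right_pm; exact: open_nbhs_nbhs.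
have JI : `[a - r, b + r] `<=` I by exact: itvI.
have Ta : `|\int[leb]_(x in `[a - r, a + r]) (Ue x * tent r a x) - Ue a| <= e / 6.
  by near: r; exact: tent_average.
have Tb : `|\int[leb]_(x in `[b - r, b + r]) (Ue x * tent r b x) - Ue b| <= e / 6.
  by near: r; exact: tent_average.
have Pa : P (a + r) - P (a - r) <= e / 6 by near: r; exact: Pc.
have Pb : P (b + r) - P (b - r) <= e / 6 by near: r; exact: Pc.
have h1 : a - r <= a + r by clear -r0; lra.
have h2 : a + r <= b - r by exact: ltW.
have h3 : b - r <= b + r by clear -r0; lra.
have h4 : a <= a + r by rewrite lerDl ltW.
have h5 : b - r <= b by rewrite gerBl ltW.
have h6 : a - r <= a by rewrite gerBl ltW.
have h7 : b <= b + r by rewrite lerDl ltW.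
pose phi := plateau r a b.
have d1phi : derive1 phi = dplateau r a b by exact: derive1_plateau.
have cphi : continuous phi by exact: continuous_plateau.
have cdphi : continuous (dplateau r a b) by exact: continuous_dplateau.
have tphi : test_fun I phi by exact: test_fun_plateau.
have := weak _ tphi.
rewrite d1phi (@Rintegral_support I `[a - r, b + r]%classic)//; last first.
  by move=> x _ /dplateau_out ->//; rewrite mulr0.
rewrite [in RHS](@Rintegral_support I `[a - r, b + r]%classic)//; last first.
  by move=> x _ xJ; rewrite /phi plateau_out// mulr0.
have lUp : loc_int (fun x => Ue x * dplateau r a b x).
  rewrite (_ : (fun x => _) = (fun x => dplateau r a b x * Ue x)); last first.
    by apply/funext => x; rewrite mulrC.
  exact: loc_intM.
have lGp : loc_int (fun x => Ge x * phi x).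
  rewrite (_ : (fun x => _) = (fun x => phi x * Ge x)); last first.
    by apply/funext => x; rewrite mulrC.
  exact: loc_intM.
have -> : \int[leb]_(x in `[a - r, b + r]) (U x * dplateau r a b x) =
    \int[leb]_(x in `[a - r, b + r]) (Ue x * dplateau r a b x).
  by apply: eq_Rintegral => x /set_mem/JI Ix; rewrite UeI.
have -> : \int[leb]_(x in `[a - r, b + r]) (G x * phi x) =
    \int[leb]_(x in `[a - r, b + r]) (Ge x * phi x).
  by apply: eq_Rintegral => x /set_mem/JI Ix; rewrite GeI.
rewrite !(Rintegral_itv_split3 _ h1 h2 h3)//.
have -> : \int[leb]_(x in `[a - r, a + r]) (Ue x * dplateau r a b x) =
    \int[leb]_(x in `[a - r, a + r]) (Ue x * tent r a x).
  apply: eq_Rintegral => x; rewrite inE /= in_itv/= => /andP[x1 x2].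
  by rewrite dplateau_left// (le_trans x2).
have -> : \int[leb]_(x in `[a + r, b - r]) (Ue x * dplateau r a b x) = 0.
  rewrite (@eq_Rintegral _ _ _ _ _ (cst 0)); first by rewrite Rintegral_cst// mul0r.
  move=> x; rewrite inE /= in_itv/= => /andP[x1 x2].
  by rewrite dplateau_left// tent_right// mulr0.
have -> : \int[leb]_(x in `[b - r, b + r]) (Ue x * dplateau r a b x) =
    -1 * \int[leb]_(x in `[b - r, b + r]) (Ue x * tent r b x).
  rewrite -RintegralZl//; last first.
    have -> : EFin \o (fun x => Ue x * tent r b x) = EFin \o (fun x => tent r b x * Ue x).
      by apply/funext => x; rewrite /= mulrC.
    by apply: loc_intM => //; exact: continuous_tent.
  apply: eq_Rintegral => x; rewrite inE /= in_itv/= => /andP[x1 x2].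
  by rewrite dplateau_right ?mulN1r ?mulrN// (le_trans h2).
have -> : \int[leb]_(x in `[a + r, b - r]) (Ge x * phi x) =
    \int[leb]_(x in `[a + r, b - r]) Ge x.
  apply: eq_Rintegral => x; rewrite inE /= in_itv/= => /andP[x1 x2].
  by rewrite /phi plateau_mid// mulr1.
have Gphi c : `|\int[leb]_(x in `[c - r, c + r]) (Ge x * phi x)| <= P (c + r) - P (c - r).
  apply: le_trans (le_normr_Rintegral _ (lGp _ _)) _ => //.
  rewrite /P primB//; last by clear -r0; lra.
  apply: le_Rintegral => //; [exact: loc_int_norm lGp _ _|].
  by move=> x _; rewrite normrM ler_piMr// plateau_le1.
have Gsub s t : s <= t -> `|\int[leb]_(x in `[s, t]) Ge x| <= P t - P s.
  move=> st; apply: le_trans (le_normr_Rintegral _ (lG _ _)) _ => //.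
  by rewrite /P primB.
rewrite (Rintegral_itv_split3 lG h4 h2 h5).
have G1 := Gsub _ _ h4; have G2 := Gsub _ _ h5.
have Pm s t : s <= t -> P s <= P t.
  by move=> st; rewrite -subr_ge0 /P primB// Rintegral_ge0.
have P1 := Pm _ _ h6; have P2 := Pm _ _ h7.
have := Gphi a; have := Gphi b.
rewrite -!UeI//.
move: Ta Tb Pa Pb G1 G2 P1 P2.
do 6 (let x := fresh "x" in set x := Rintegral _ _ _).
clear; rewrite !ler_norml.
move: (P _) (P _) (P _) (P _) (P _) (P _) => p1 p2 p3 p4 p5 p6.
move=> /andP[? ?] /andP[? ?] ? ? /andP[? ?] /andP[? ?] ? ? /andP[? ?] /andP[? ?] ?.
by apply/andP; split; lra.
Unshelve. all: by end_near. Qed.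

(** One Lebesgue point in [I] fixes the constant, and almost every point is one. If [I] contains
    none, the claim is vacuous almost everywhere. *)
Lemma weak_derivative_primitive I U G :
  open I -> (forall x y, I x -> I y -> `[x, y] `<=` I) ->
  measurable_fun setT (U \_ I) -> loc_int (U \_ I) -> loc_int (G \_ I) ->
  (forall phi, test_fun I phi ->
     \int[leb]_(x in I) (U x * derive1 phi x) =
     - \int[leb]_(x in I) (G x * phi x)) ->
  exists A, {ae leb, forall x, I x -> U x = A + prim (G \_ I) x}.
Proof.
move=> oI itvI mU lU lG weak.
have aeL := lebesgue_differentiation (loc_int_locally_integrable mU lU).
have incr x y : I x -> I y -> lebesgue_pt (U \_ I) x -> lebesgue_pt (U \_ I) y ->
    x < y -> U y - U x = prim (G \_ I) y - prim (G \_ I) x.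
  move=> Ix Iy Lx Ly xy; rewrite primB ?ltW//.
  exact: increment_weak_derivative weak Ix Iy xy Lx Ly.
have [[a [Ia La]]|noL] := pselect (exists a, I a /\ lebesgue_pt (U \_ I) a).
  exists (U a - prim (G \_ I) a).
  apply: filterS aeL; first exact: (ae_filter_ringOfSetsType leb).
  move=> x Lx Ix; have [xa|ax|->] := ltgtP x a; last by ring.
  - by have := incr _ _ Ix Ia Lx La xa; lra.
  - by have := incr _ _ Ia Ix La Lx ax; lra.
exists 0; apply: filterS aeL; first exact: (ae_filter_ringOfSetsType leb).
by move=> x Lx Ix; exfalso; apply: noL; exists x.
Qed.

End weak_derivative.

(** * Complex limits by components *)

Section complex_limits.
Context {R : realType}.
Local Open Scope complex_scope.

Lemma cvg_complex (T : Type) (F : set_system T) {FF : Filter F} (f1 f2 : T -> R)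
    (l1 l2 : R) : f1 @ F --> l1 -> f2 @ F --> l2 ->
  (fun t => (f1 t +i* f2 t : R[i]^o)) @ F --> (l1 +i* l2 : R[i]^o).
Proof.
move=> /cvgrPdist_lt h1 /cvgrPdist_lt h2; apply/cvgrPdist_lt => e.
(* In the order of [R[i]], [0 < e] forces [e] to be real with positive real part. *)
rewrite ltcE /= => /andP[/eqP Ime0 Ree0].
have e2 : 0 < complex.Re e / 2 by rewrite divr_gt0.
near=> t.
have t1 : `|l1 - f1 t| < complex.Re e / 2 by near: t; exact: h1.
have t2 : `|l2 - f2 t| < complex.Re e / 2 by near: t; exact: h2.
rewrite normc_def ltcE /= Ime0 eqxx /=.
apply: (@le_lt_trans _ _ (`|l1 - f1 t| + `|l2 - f2 t|)); last by lra.
rewrite -ler_sqr ?nnegrE ?sqrtr_ge0 ?addr_ge0// sqr_sqrtr ?addr_ge0 ?sqr_ge0//.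
rewrite [leRHS]sqrrD !real_normK ?num_real// -addrA lerD2l lerDr.
by rewrite mulrn_wge0// mulr_ge0.
Unshelve. all: by end_near. Qed.

Lemma normc_ge_absRe (z : R[i]) : `|complex.Re z| <= normc z.
Proof.
case: z => a b /=; rewrite -sqrtr_sqr ler_wsqrtr// lerDl; exact: sqr_ge0.
Qed.

Lemma normc_ge_absIm (z : R[i]) : `|complex.Im z| <= normc z.
Proof.
case: z => a b /=; rewrite -sqrtr_sqr ler_wsqrtr// lerDr; exact: sqr_ge0.
Qed.

Lemma ReB (z w : R[i]) : complex.Re z - complex.Re w = complex.Re (z - w).
Proof. by case: z => ? ?; case: w. Qed.

Lemma ImB (z w : R[i]) : complex.Im z - complex.Im w = complex.Im (z - w).
Proof. by case: z => ? ?; case: w. Qed.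

Lemma cvg_ReIm (T : Type) (F : set_system T) {FF : Filter F} (f : T -> R[i]^o)
    (l : R[i]^o) : f @ F --> l ->
  complex.Re (f t) @[t --> F] --> complex.Re l /\
  complex.Im (f t) @[t --> F] --> complex.Im l.
Proof.
move=> /cvgrPdist_lt h; split; apply/cvgrPdist_lt => e e0.
  have e0' : 0 < e%:C :> R[i] by rewrite ltcR.
  near=> t.
  have : `|l - f t| < e%:C by near: t; exact: h.
  rewrite normc_def ltcR; apply: le_lt_trans.
  have -> : complex.Re l - complex.Re (f t) = complex.Re (l - f t).
    exact: ReB.
  have := normc_ge_absRe (l - f t).
  by case: (l - f t).
have e0' : 0 < e%:C :> R[i] by rewrite ltcR.
near=> t.
have : `|l - f t| < e%:C by near: t; exact: h.
rewrite normc_def ltcR; apply: le_lt_trans.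
have -> : complex.Im l - complex.Im (f t) = complex.Im (l - f t).
  exact: ImB.
have := normc_ge_absIm (l - f t).
by case: (l - f t).
Unshelve. all: by end_near. Qed.

End complex_limits.

(** * Traces on open half-lines *)

Section rays.
Context {R : realType}.
Local Notation leb := (@lebesgue_measure R).
Implicit Types (I : set R) (f g : R -> R).
Local Open Scope complex_scope.

Definition ray I := I = @Rminus R \/ I = @Rplus R.

Lemma ray_open I : ray I -> open I.
Proof. by case=> ->; exact: interval_open. Qed.

Lemma ray_measurable I : ray I -> measurable (I : set (measurableTypeR R)).
Proof. by case=> ->; exact: measurable_itv. Qed.

Lemma ray_itv I : ray I -> forall x y, I x -> I y -> `[x, y] `<=` I.
Proof.
case=> -> x y; rewrite /Rminus /Rplus /= !in_itv/= ?andbT => Ix Iy z /=;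
  rewrite !in_itv/= ?andbT => /andP[xz zy].
- exact: le_lt_trans Iy.
- exact: lt_le_trans xz.
Qed.

(** 0 is a limit point of each open half-line; this makes limits along the filter, hence traces,
    unique. *)
Lemma ray_proper0 I : ray I -> ProperFilter (within I (nbhs (0 : R))).
Proof.
move=> rI; apply: within_nbhs_proper => B /nbhs_ballP[d /= d0 Hd].
case: rI => ->.
  exists (- (d / 2)); split; first by rewrite /Rminus /= in_itv/= oppr_lt0 divr_gt0.
  by apply: Hd; rewrite /ball/= opprK add0r gtr0_norm ?divr_gt0//; lra.
exists (d / 2); split; first by rewrite /Rplus /= in_itv/= andbT divr_gt0.
by apply: Hd; rewrite /ball/= sub0r normrN gtr0_norm ?divr_gt0//; lra.
Qed.

(** A point of disagreement would have a whole ball of such points around it, of positive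
    measure. *)
Lemma ae_eq_continuous I f g : open I -> {in I, continuous f} ->
  {in I, continuous g} -> {ae leb, forall x, I x -> f x = g x} ->
  forall x, I x -> f x = g x.
Proof.
move=> oI cf cg [A [mA A0 HA]] x Ix; apply/eqP; apply: contrapT => /negP fgx.
have d0 : 0 < `|f x - g x| / 2 by rewrite divr_gt0// normr_gt0 subr_eq0.
have : nbhs x A.
  have /cvgrPdist_lt/(_ _ d0) h1 := cf x (mem_set Ix).
  have /cvgrPdist_lt/(_ _ d0) h2 := cg x (mem_set Ix).
  near=> y; apply: HA => /= H.
  have Iy : I y by near: y; exact: open_nbhs_nbhs.
  have y1 : `|f x - f y| < `|f x - g x| / 2 by near: y.
  have y2 : `|g x - g y| < `|f x - g x| / 2 by near: y.
  have E : f x - g x = (f x - f y) - (g x - g y) by rewrite H//; ring.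
  have := ler_normB (f x - f y) (g x - g y).
  by rewrite -E; lra.
move=> /nbhs_ballP[d /= dpos Hd].
have : (leb (ball x d) <= leb A)%E.
  by apply: le_measure => //; rewrite inE//; exact: measurable_ball.
by rewrite A0 (lebesgue_measure_ball _ (ltW dpos)) leNgt lte_fin pmulrn_lgt0 ?dpos.
Unshelve. all: by end_near. Qed.

Lemma trace_exists I (u : R -> R[i]) f1 f2 : ray I -> continuous f1 ->
  continuous f2 ->
  {ae leb, forall x, I x -> complex.Re (u x) = f1 x} ->
  {ae leb, forall x, I x -> complex.Im (u x) = f2 x} ->
  is_trace0 I u (f1 0 +i* f2 0).
Proof.
move=> rI c1 c2 ae1 ae2; exists (fun x => f1 x +i* f2 x); split.
- by move=> x _; apply: cvg_complex; [exact: c1|exact: c2].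
- apply: filterS2 ae1 ae2; first exact: (ae_filter_ringOfSetsType leb).
  by move=> x h1 h2 Ix; rewrite -h1// -h2//; case: (u x).
- have pF := ray_proper0 rI.
  apply: cvg_complex.
    by apply: cvg_trans (c1 0); apply: cvg_app; exact: cvg_within.
  by apply: cvg_trans (c2 0); apply: cvg_app; exact: cvg_within.
Qed.

Lemma trace_unique I (u : R -> R[i]) f1 f2 l : ray I -> continuous f1 ->
  continuous f2 ->
  {ae leb, forall x, I x -> complex.Re (u x) = f1 x} ->
  {ae leb, forall x, I x -> complex.Im (u x) = f2 x} ->
  is_trace0 I u l -> l = f1 0 +i* f2 0.
Proof.
move=> rI c1 c2 ae1 ae2 [ut [cut aeut lut]].
have pF := ray_proper0 rI.
have [lRe lIm] := cvg_ReIm lut.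
have E1 : forall x, I x -> complex.Re (ut x) = f1 x.
  apply: ae_eq_continuous; first exact: ray_open.
  - by move=> x Ix; exact: (cvg_ReIm (cut x Ix)).1.
  - by move=> x _; exact: c1.
  apply: filterS2 ae1 aeut; first exact: (ae_filter_ringOfSetsType leb).
  by move=> x h1 h2 Ix; rewrite -h1// h2.
have E2 : forall x, I x -> complex.Im (ut x) = f2 x.
  apply: ae_eq_continuous; first exact: ray_open.
  - by move=> x Ix; exact: (cvg_ReIm (cut x Ix)).2.
  - by move=> x _; exact: c2.
  apply: filterS2 ae2 aeut; first exact: (ae_filter_ringOfSetsType leb).
  by move=> x h1 h2 Ix; rewrite -h1// h2.
have lim (f : R -> R) (h : R -> R) (L : R) : continuous f -> (forall x, I x -> h x = f x) ->
    h @ within I (nbhs 0) --> L -> L = f 0.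
  move=> cf hf hL; apply: (@cvg_unique _ (@Rhausdorff R) _ _ _ _ hL).
  have cf0 : f @ within I (nbhs 0) --> f 0.
    by apply: cvg_trans (cf 0); apply: cvg_app; exact: cvg_within.
  apply: cvg_trans cf0; apply: near_eq_cvg.
  by apply: filterS (@withinT _ (nbhs 0) I _) => x Ix; rewrite hf.
by rewrite -(lim _ _ _ c1 E1 lRe) -(lim _ _ _ c2 E2 lIm); case: (l).
Unshelve. all: by end_near. Qed.

(** [trace0] is a choice among admissible limits, so existence and uniqueness together determine
    it. *)
Lemma trace0E I (u : R -> R[i]) f1 f2 : ray I -> continuous f1 ->
  continuous f2 ->
  {ae leb, forall x, I x -> complex.Re (u x) = f1 x} ->
  {ae leb, forall x, I x -> complex.Im (u x) = f2 x} ->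
  trace0 I u = f1 0 +i* f2 0.
Proof.
move=> rI c1 c2 ae1 ae2; have ex := trace_exists rI c1 c2 ae1 ae2.
apply: (trace_unique rI c1 c2 ae1 ae2).
exact: (xgetPex 0 (ex_intro _ _ ex)).
Qed.

End rays.

(** * The modulus of a complex-valued primitive *)

Section modulus.
Context {R : realType}.
Local Notation leb := (@lebesgue_measure R).
Implicit Types (a b c d x y A B : R) (f g G : R -> R).

Definition modulus a b : R := Num.sqrt (a ^+ 2 + b ^+ 2).

Lemma modulus_ge0 a b : 0 <= modulus a b.
Proof. exact: sqrtr_ge0. Qed.

Lemma sqr_modulus a b : modulus a b ^+ 2 = a ^+ 2 + b ^+ 2.
Proof. by rewrite sqr_sqrtr// addr_ge0// sqr_ge0. Qed.

Lemma modulusN a b : modulus (- a) (- b) = modulus a b.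
Proof. by rewrite /modulus !sqrrN. Qed.

Lemma normcE_modulus (z : R[i]) : normc z = modulus (complex.Re z) (complex.Im z).
Proof. by case: z. Qed.

Lemma modulus_triangle a b c d : modulus (a + c) (b + d) <= modulus a b + modulus c d.
Proof. exact: (le_normcD (a +i* b)%C (c +i* d)%C). Qed.

Lemma modulus_dot a b c d : a * c + b * d <= modulus a b * modulus c d.
Proof.
rewrite -sqrtrM ?addr_ge0 ?sqr_ge0//.
apply: (le_trans (ler_norm _)); rewrite -sqrtr_sqr ler_wsqrtr//.
by rewrite -subr_ge0 (_ : _ - _ = (a * d - b * c) ^+ 2) ?sqr_ge0//; ring.
Qed.

Lemma continuous_modulus f g : continuous f -> continuous g ->
  continuous (fun x => modulus (f x) (g x)).
Proof.
move=> cf cg; apply: (@cts_comp R (fun x => f x ^+ 2 + g x ^+ 2) Num.sqrt).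
  by apply: ctsD; exact: ctsX.
exact: sqrt_continuous.
Qed.

(** This replaces differentiating the modulus, which may fail where the function vanishes. *)
Lemma modulus_prim_increment G1 G2 A B x y : loc_int G1 -> loc_int G2 ->
  loc_int (fun t => modulus (G1 t) (G2 t)) -> x <= y ->
  `|modulus (A + prim G1 y) (B + prim G2 y) -
    modulus (A + prim G1 x) (B + prim G2 x)| <=
  \int[leb]_(t in `[x, y]) modulus (G1 t) (G2 t).
Proof.
move=> l1 l2 lk xy.
set Z1 := prim G1 y - prim G1 x; set Z2 := prim G2 y - prim G2 x.
apply: (@le_trans _ _ (modulus Z1 Z2)).
  have h1 := modulus_triangle (A + prim G1 x) (B + prim G2 x) Z1 Z2.
  have h2 := modulus_triangle (A + prim G1 y) (B + prim G2 y) (- Z1) (- Z2).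
  move: h1 h2; rewrite modulusN.
  have -> : A + prim G1 x + Z1 = A + prim G1 y by rewrite /Z1; ring.
  have -> : B + prim G2 x + Z2 = B + prim G2 y by rewrite /Z2; ring.
  have -> : A + prim G1 y - Z1 = A + prim G1 x by rewrite /Z1; ring.
  have -> : B + prim G2 y - Z2 = B + prim G2 x by rewrite /Z2; ring.
  clear; move=> h1 h2; rewrite ler_norml; apply/andP; split; lra.
have k0 : 0 <= \int[leb]_(t in `[x, y]) modulus (G1 t) (G2 t).
  by apply: Rintegral_ge0 => t _; exact: modulus_ge0.
have [n0|n0] := leP (modulus Z1 Z2) 0; first exact: le_trans n0 k0.
(* Pairing the increment [Z] with itself writes [|Z|^2] as the integral of the dot product of [Z]
   and [G], at most [|Z|] times the integral of [|G|] by Cauchy-Schwarz. *)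
rewrite -(ler_pM2l n0) -expr2 sqr_modulus -RintegralZl//.
have -> : Z1 ^+ 2 + Z2 ^+ 2 = \int[leb]_(t in `[x, y]) (Z1 * G1 t + Z2 * G2 t).
  rewrite RintegralD//; [|exact: loc_intZ l1 _ _|exact: loc_intZ l2 _ _].
  rewrite !RintegralZl//.
  by rewrite -!primB// !expr2.
apply: le_Rintegral => //.
- by apply: loc_intD; exact: loc_intZ.
- exact: loc_intZ lk _ _.
- by move=> t _; exact: modulus_dot.
Qed.

End modulus.

(** * Sobolev functions on half-lines *)

Section sobolev_representation.
Context {R : realType}.
Local Notation leb := (@lebesgue_measure R).
Implicit Types (I : set R) (u g : R -> R[i]) (f : R -> R).

Lemma ae_Rintegral I (f1 f2 : R -> R) : measurable (I : set (measurableTypeR R)) ->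
  measurable_fun I f1 -> measurable_fun I f2 ->
  {ae leb, forall x, I x -> f1 x = f2 x} ->
  \int[leb]_(x in I) f1 x = \int[leb]_(x in I) f2 x.
Proof.
move=> mI m1 m2 ae; congr fine; apply: ae_eq_integral => //.
- exact/measurable_EFinP.
- exact/measurable_EFinP.
- apply: filterS ae; first exact: (ae_filter_ringOfSetsType leb).
  by move=> x h Ix; rewrite /= h.
Qed.

Lemma ae_integrable I (f1 f2 : R -> R) : measurable (I : set (measurableTypeR R)) ->
  measurable_fun I f1 -> measurable_fun I f2 ->
  {ae leb, forall x, I x -> f1 x = f2 x} ->
  leb.-integrable I (EFin \o f1) -> leb.-integrable I (EFin \o f2).
Proof.
move=> mI m1 m2 ae /integrableP[_ foo]; apply/integrableP; split.
  exact/measurable_EFinP.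
rewrite (_ : (\int[leb]_(x in I) _ = \int[leb]_(x in I) `|(EFin \o f1) x|)%E)//.
apply: ae_eq_integral => //.
- by apply/measurable_EFinP; apply: measurableT_comp.
- by apply/measurable_EFinP; apply: measurableT_comp.
- apply: filterS ae; first exact: (ae_filter_ringOfSetsType leb).
  by move=> x h Ix; rewrite /= h.
Qed.

Lemma measurable_modulus I (f1 f2 : R -> R) :
  measurable_fun I f1 -> measurable_fun I f2 ->
  measurable_fun I (fun x => modulus (f1 x) (f2 x)).
Proof.
move=> m1 m2.
have ms : measurable_fun setT (@Num.sqrt R).
  by apply: measurable_realfun.continuous_measurable_fun; exact: sqrt_continuous.
apply: (measurableT_comp ms).
by apply: measurable_funD; exact: measurable_funX.
Qed.

Lemma measurable_powR_fun I p (f : R -> R) : measurable_fun I f ->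
  measurable_fun I (fun x => f x `^ p).
Proof. by move=> mf; exact: (measurableT_comp (measurable_powR p) mf). Qed.

Lemma L2_components I u : measurable (I : set (measurableTypeR R)) -> L2 I u ->
  [/\ measurable_fun I (fun x => complex.Re (u x)),
      measurable_fun I (fun x => complex.Im (u x)),
      leb.-integrable I (EFin \o (fun x => complex.Re (u x) ^+ 2)),
      leb.-integrable I (EFin \o (fun x => complex.Im (u x) ^+ 2)) &
      leb.-integrable I (EFin \o (fun x => normc (u x) ^+ 2))].
Proof.
move=> mI [m1 m2 i]; have i2 : leb.-integrable I (EFin \o (fun x => normc (u x) ^+ 2)).
  apply: eq_integrable i => // x _ /=; congr EFin.
  by rewrite -powR_mulrn// normcE_modulus modulus_ge0.
split => //; apply: le_integrable i2 => //.
- by apply/measurable_EFinP; exact: measurable_funX.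
- move=> x _; rewrite /= lee_fin !ger0_norm ?sqr_ge0//.
  by rewrite normcE_modulus sqr_modulus lerDl sqr_ge0.
- by apply/measurable_EFinP; exact: measurable_funX.
- move=> x _; rewrite /= lee_fin !ger0_norm ?sqr_ge0//.
  by rewrite normcE_modulus sqr_modulus lerDr sqr_ge0.
Qed.

Lemma Re_mul_real (z : R[i]) (a : R) :
  complex.Re (z * a%:C%C) = complex.Re z * a /\
  complex.Im (z * a%:C%C) = complex.Im z * a.
Proof. by case: z => x y /=; rewrite !mulr0 subr0 add0r. Qed.

Lemma weak_deriv_components I u g : is_weak_deriv I u g ->
  forall phi, test_fun I phi ->
  (\int[leb]_(x in I) (complex.Re (u x) * derive1 phi x) =
    - \int[leb]_(x in I) (complex.Re (g x) * phi x)) /\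
  (\int[leb]_(x in I) (complex.Im (u x) * derive1 phi x) =
    - \int[leb]_(x in I) (complex.Im (g x) * phi x)).
Proof.
move=> w phi /w; rewrite /cintegral => -[E1 E2]; split.
  transitivity (\int[leb]_(x in I) complex.Re (u x * (derive1 phi x)%:C%C)).
    by apply: eq_Rintegral => x _; rewrite (Re_mul_real _ _).1.
  rewrite E1; congr (- _).
  by apply: eq_Rintegral => x _; rewrite (Re_mul_real _ _).1.
transitivity (\int[leb]_(x in I) complex.Im (u x * (derive1 phi x)%:C%C)).
  by apply: eq_Rintegral => x _; rewrite (Re_mul_real _ _).2.
rewrite E2; congr (- _).
by apply: eq_Rintegral => x _; rewrite (Re_mul_real _ _).2.
Qed.

Lemma weak_deriv_prim I u g : ray I -> L2 I u -> L2 I g -> is_weak_deriv I u g ->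
  exists A B,
    {ae leb, forall x, I x ->
       complex.Re (u x) = A + prim ((fun t => complex.Re (g t)) \_ I) x} /\
    {ae leb, forall x, I x ->
       complex.Im (u x) = B + prim ((fun t => complex.Im (g t)) \_ I) x}.
Proof.
move=> rI Lu Lg w.
have mI := ray_measurable rI.
have [mu1 mu2 iu1 iu2 _] := L2_components mI Lu.
have [mg1 mg2 ig1 ig2 _] := L2_components mI Lg.
have wc := weak_deriv_components w.
have [A HA] := weak_derivative_primitive (ray_open rI) (ray_itv rI)
  (measurable_restrict0 mI mu1) (loc_int_sqr mI mu1 iu1) (loc_int_sqr mI mg1 ig1)
  (fun phi t => (wc phi t).1).
have [B HB] := weak_derivative_primitive (ray_open rI) (ray_itv rI)
  (measurable_restrict0 mI mu2) (loc_int_sqr mI mu2 iu2) (loc_int_sqr mI mg2 ig2)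
  (fun phi t => (wc phi t).2).
by exists A, B.
Qed.

Lemma weak_derivP I u : H1 I u -> L2 I (weak_deriv I u) /\ is_weak_deriv I u (weak_deriv I u).
Proof. by move=> [_ ex]; exact: (xgetPex (fun=> 0) ex). Qed.

(* [r] and [k] are the moduli of the continuous representative of [u] and of its
   weak derivative, the latter extended by 0 outside [I]. *)
Record h1_modulus I u (r k : R -> R) : Prop := H1Modulus {
  modulus_cts : continuous r;
  modulus_nneg : forall x, 0 <= r x;
  speed_loc_int : loc_int k;
  speed_nneg : forall x, 0 <= k x;
  modulus_increment : forall x y, x <= y ->
    `|r y - r x| <= \int[leb]_(t in `[x, y]) k t;
  modulus_ae : {ae leb, forall x, I x -> normc (u x) = r x};
  modulus_trace : normc (trace0 I u) = r 0;
  modulus_int : leb.-integrable I (EFin \o (fun x => r x ^+ 2));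
  speed_int : leb.-integrable (I `|` [set 0]) (EFin \o (fun x => k x ^+ 2));
  speed_kinetic : \int[leb]_(x in I `|` [set 0]) (k x ^+ 2) =
    Lpnorm_pow 2 I (weak_deriv I u)
}.

Lemma ray_N0 I : ray I -> ~ I 0.
Proof. by case=> ->; rewrite /Rminus /Rplus /= in_itv/= ?andbT ltxx. Qed.

Lemma ray_half_line I : ray I -> half_line (I `|` [set 0]).
Proof.
case=> ->; [right|left]; rewrite /Rminus /Rplus; apply/seteqP; split => x /=;
  rewrite !in_itv/= ?andbT.
- by move=> [/ltW//|->].
- by rewrite le_eqVlt => /predU1P[->|]; [right|left].
- by move=> [/ltW//|->].
- by rewrite le_eqVlt => /predU1P[<-|]; [right|left].
Qed.

(** The calibration starts at the boundary point and uses closed half-lines, while the norms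
    integrate over open ones; the point 0 is negligible. *)
Lemma ray_add0_integrable I f : ray I -> measurable_fun (I `|` [set 0]) f ->
  leb.-integrable (I `|` [set 0]) (EFin \o f) <-> leb.-integrable I (EFin \o f).
Proof.
move=> rI mf.
have mD := half_line_measurable (ray_half_line rI).
have I0 : (I `|` [set 0]) `\` [set 0] = I.
  apply/seteqP; split => x /=; first by move=> [[]].
  by move=> Ix; split; [left|move=> x0; apply: (ray_N0 rI); rewrite -x0].
rewrite -[in X in _ <-> X]I0; apply: negligible_integrable => //.
- exact/measurable_EFinP.
- exact: lebesgue_measure_set1.
Qed.

Lemma ray_add0_integral I f : ray I ->
  leb.-integrable (I `|` [set 0]) (EFin \o f) ->
  \int[leb]_(x in I `|` [set 0]) f x = \int[leb]_(x in I) f x.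
Proof.
move=> rI fi; have mD := half_line_measurable (ray_half_line rI).
have mI := ray_measurable rI.
rewrite Rintegral_setU//; first by rewrite Rintegral_set1 addr0.
rewrite disj_set2E; apply/eqP/seteqP; split => // x [Ix x0].
by apply: (ray_N0 rI); rewrite -x0.
Qed.

(** The representative is a constant plus the primitive of the weak derivative extended by 0. Being
    continuous on the whole line, it takes the trace as its value at 0. *)
Lemma h1_modulus_exists I u : ray I -> H1 I u -> exists r k, h1_modulus I u r k.
Proof.
move=> rI Hu; have [Lg w] := weak_derivP Hu; have [Lu _] := Hu.
have mI := ray_measurable rI.
set g := weak_deriv I u in Lg w *.
have [mu1 mu2 iu1 iu2 iu] := L2_components mI Lu.
have [mg1 mg2 ig1 ig2 ig] := L2_components mI Lg.
have [A [B [aeA aeB]]] := weak_deriv_prim rI Lu Lg w.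
set G1 := (_ \_ I) in aeA; set G2 := (_ \_ I) in aeB.
have l1 : loc_int G1 by exact: loc_int_sqr.
have l2 : loc_int G2 by exact: loc_int_sqr.
pose f1 x := A + prim G1 x; pose f2 x := B + prim G2 x.
have c1 : continuous f1 by apply: ctsD; [exact: cts_cst|exact: continuous_prim].
have c2 : continuous f2 by apply: ctsD; [exact: cts_cst|exact: continuous_prim].
pose k := (fun x => normc (g x)) \_ I.
have kE x : modulus (G1 x) (G2 x) = k x.
  rewrite /G1 /G2 /k !patchE; case: ifPn => _; first by rewrite normcE_modulus.
  by rewrite /modulus expr0n addr0 sqrtr0.
have mk : measurable_fun I (fun x => normc (g x)).
  have := measurable_modulus mg1 mg2; congr measurable_fun.
  by apply/funext => x; rewrite normcE_modulus.
have lk : loc_int k by exact: loc_int_sqr.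
have kx0 x : 0 <= k x by rewrite -kE modulus_ge0.
have k2E : (fun x => k x ^+ 2) = (fun x => normc (g x) ^+ 2) \_ I.
  by apply/funext => x; rewrite /k !patchE; case: ifPn => // _; rewrite expr0n.
pose r x := modulus (f1 x) (f2 x).
have aer : {ae leb, forall x, I x -> normc (u x) = r x}.
  apply: filterS2 aeA aeB; first exact: (ae_filter_ringOfSetsType leb).
  by move=> x h1 h2 Ix; rewrite normcE_modulus h1// h2.
have mr : measurable_fun setT r.
  by apply: measurable_realfun.continuous_measurable_fun; exact: continuous_modulus.
have mnu : measurable_fun I (fun x => normc (u x)).
  have := measurable_modulus mu1 mu2; congr measurable_fun.
  by apply/funext => x; rewrite normcE_modulus.
have ik : leb.-integrable (I `|` [set 0]) (EFin \o (fun x => k x ^+ 2)).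
  apply/(ray_add0_integrable rI).
    apply: measurable_funTS; rewrite k2E.
    by apply: measurable_restrict0 => //; exact: measurable_funX.
  apply: eq_integrable ig => // x xI.
  by rewrite /= /k patchE xI.
exists r, k; split => //.
- exact: continuous_modulus.
- by move=> x; exact: modulus_ge0.
- have kfun : k = fun t => modulus (G1 t) (G2 t) by apply/funext => t; rewrite kE.
  move=> x y xy; rewrite kfun; apply: modulus_prim_increment => //.
  by rewrite -kfun.
- by rewrite (trace0E rI c1 c2 aeA aeB).
- apply: ae_integrable iu => //.
  + exact: measurable_funX.
  + by apply: measurable_funTS; exact: measurable_funX.
  + apply: filterS aer; first exact: (ae_filter_ringOfSetsType leb).
    by move=> x h Ix; rewrite h.
- rewrite ray_add0_integral// /Lpnorm_pow; apply: eq_Rintegral => x xI.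
  by rewrite /k patchE xI powR_mulrn// normcE_modulus modulus_ge0.
Qed.

Section energy.
Variables (I : set R) (u : R -> R[i]) (r k : R -> R).
Hypotheses (rI : ray I) (Lu : L2 I u) (hm : h1_modulus I u r k).
Local Notation D := (I `|` [set 0]).

Lemma measurable_normc : measurable_fun I (fun x => normc (u x)).
Proof.
have [m1 m2 _] := Lu; have := measurable_modulus m1 m2; congr measurable_fun.
by apply/funext => x; rewrite normcE_modulus.
Qed.

Lemma Lpnorm_pow_modulus p : Lpnorm_pow p I u = \int[leb]_(x in I) (r x `^ p).
Proof.
apply: ae_Rintegral; first exact: ray_measurable.
- by apply: measurable_powR_fun; exact: measurable_normc.
- apply: measurable_powR_fun; apply: measurable_funTS.
  apply: measurable_realfun.continuous_measurable_fun; exact: modulus_cts hm.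
apply: filterS (modulus_ae hm); first exact: (ae_filter_ringOfSetsType leb).
by move=> x h Ix; rewrite h.
Qed.

Let mr : measurable_fun setT r.
Proof. apply: measurable_realfun.continuous_measurable_fun; exact: modulus_cts hm. Qed.

Let ir2 : leb.-integrable D (EFin \o (fun x => r x ^+ 2)).
Proof.
apply/(ray_add0_integrable rI); last exact: modulus_int hm.
by apply: measurable_funTS; exact: measurable_funX.
Qed.

Lemma modulus_bounded : exists M, forall x, D x -> r x <= M.
Proof.
by case: hm => *; apply: (half_line_bounded (ray_half_line rI)) => //; eassumption.
Qed.

(** Boundedness gives the domination [r^(q + 2) <= M^q * r^2]. *)
Lemma modulus_powR_integrable q : 0 <= q ->
  leb.-integrable I (EFin \o (fun x => r x `^ (q + 2))).
Proof.
move=> q0; have [M HM] := modulus_bounded; have mI := ray_measurable rI.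
apply: (le_integrable mI _ _ (integrableZl mI (M `^ q) (modulus_int hm))).
  apply/measurable_EFinP; apply: measurable_powR_fun; exact: measurable_funTS.
move=> x Ix; rewrite /= lee_fin ger0_norm ?powR_ge0//.
have rx := modulus_nneg hm x.
rewrite ger0_norm ?mulr_ge0 ?powR_ge0 ?exprn_ge0//.
rewrite powRD; last by apply/implyP; rewrite gt_eqF// ltr_wpDl.
rewrite powR_mulrn// ler_wpM2r ?exprn_ge0//.
have rM := HM x (or_introl Ix).
by apply: ge0_ler_powR; rewrite ?nnegrE// (le_trans rx).
Qed.

(** Expanding the factor [1 - (r / N)^q] in [half_line_calib] turns the calibrated integral into the
    norms of the action. *)
Lemma side_energy om q N : 0 < om -> 0 < q -> 0 < N ->
  (forall x, D x -> r x <= N) ->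
  forall x, D x ->
  2 * calib om q (r x / N) - calib om q (r 0 / N) <=
  N ^- 2 * (Lpnorm_pow 2 I (weak_deriv I u) + om * Lpnorm_pow 2 I u -
            om * N `^ (- q) * Lpnorm_pow (q + 2) I u).
Proof.
move=> om0 q0 N0 HN x Dx.
have mI := ray_measurable rI.
have mD := half_line_measurable (ray_half_line rI).
have [ik sk] := (speed_int hm, speed_kinetic hm).
have [iE] := half_line_calib (ray_half_line rI) (modulus_cts hm) (modulus_nneg hm)
  (speed_loc_int hm) (speed_nneg hm) (modulus_increment hm) ir2 ik om0 q0 N0 HN.
move=> /(_ x Dx) /le_trans; apply; rewrite ler_wpM2l ?invr_ge0 ?exprn_ge0 ?(ltW N0)//.
set f := fun t => om * r t ^+ 2 * (1 - (r t / N) `^ q).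
have ip := modulus_powR_integrable (ltW q0).
have i2 := modulus_int hm.
have fE t : f t = om * r t ^+ 2 - om * N `^ (- q) * r t `^ (q + 2).
  have rt := modulus_nneg hm t.
  rewrite /f mulrBr mulr1; congr (_ - _).
  rewrite powRM// ?invr_ge0 ?(ltW N0)// powRD; last by apply/implyP; rewrite gt_eqF// addr_gt0.
  rewrite powR_mulrn//.
  have -> : N^-1 `^ q = N `^ (- q) by rewrite -powR_inv1 ?(ltW N0)// -powRrM mulN1r.
  by ring.
have iom2 : leb.-integrable I (EFin \o (fun t => om * r t ^+ 2)).
  exact: (integrableZl mI om i2).
have iomp : leb.-integrable I (EFin \o (fun t => om * N `^ (- q) * r t `^ (q + 2))).
  exact: (integrableZl mI (om * N `^ (- q)) ip).
have ifI : leb.-integrable I (EFin \o f).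
  have -> : f = fun t => om * r t ^+ 2 - om * N `^ (- q) * r t `^ (q + 2).
    exact/funext.
  by have := integrableB mI iom2 iomp; exact.
have ifD : leb.-integrable D (EFin \o f).
  apply/(ray_add0_integrable rI) => //.
  have -> : f = fun t => om * r t ^+ 2 - om * N `^ (- q) * r t `^ (q + 2).
    exact/funext.
  apply: measurable_funTS; apply: measurable_funB.
    by apply: measurable_funM => //; exact: measurable_funX.
  by apply: measurable_funM => //; exact: measurable_powR_fun.
rewrite RintegralD// sk (ray_add0_integral rI ifD).
have -> : f = fun t => om * r t ^+ 2 - om * N `^ (- q) * r t `^ (q + 2).
  exact/funext.
rewrite RintegralB// !RintegralZl// -Lpnorm_pow_modulus addrA.
have -> : Lpnorm_pow 2 I u = \int[leb]_(t in I) (r t ^+ 2); last by [].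
rewrite Lpnorm_pow_modulus; apply: eq_Rintegral => t _.
by rewrite powR_mulrn// (modulus_nneg hm).
Qed.

End energy.

End sobolev_representation.

(** * Real C^1 functions on half-lines *)

Section smooth_on_ray.
Context {R : realType}.
Local Notation leb := (@lebesgue_measure R).
Implicit Types (I : set R) (u g : R -> R[i]) (f F phi : R -> R).

Lemma Rintegral_eq0 I f : (forall x, I x -> f x = 0) -> \int[leb]_(x in I) f x = 0.
Proof. by move=> f0; rewrite /Rintegral integral0_eq// => x Ix; rewrite f0. Qed.

(** A compact subset of an open half-line keeps a positive distance [d] from 0. Taking one endpoint
    at distance [d / 2] and the other beyond a bound of the compact set makes [phi] vanish at
    both. *)
Lemma test_fun_support I phi : ray I -> test_fun I phi ->
  exists a b, [/\ a < b, `[a, b] `<=` I, phi a = 0, phi b = 0 &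
    forall x, ~ `[a, b]%classic x -> phi x = 0 /\ derive1 phi x = 0].
Proof.
move=> rI [dphi _ [K [cK KI K0]]].
have clK := compact_closed (@Rhausdorff R) cK.
have [M [Mr HM]] := compact_bounded cK.
have oC : open (~` K) by exact: closed_openC.
have [d d0 Hd] : exists2 d, 0 < d & forall x, `|x| < d -> ~ K x.
  have : nbhs (0 : R) (~` K).
    by apply: open_nbhs_nbhs; split => // /KI; exact: ray_N0.
  move=> /nbhs_ballP[d /= d0 Hd]; exists d => // x xd; apply: Hd.
  by rewrite /ball/= sub0r normrN.
set N := `|M| + d + 1.
have KN x : K x -> `|x| < N.
  move=> Kx; apply: (@le_lt_trans _ _ (`|M| + d / 2)); last by rewrite /N; lra.
  apply: HM => //; apply: (le_lt_trans (ler_norm M)).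
  by rewrite ltrDl divr_gt0.
have out x : ~ K x -> phi x = 0 /\ derive1 phi x = 0.
  move=> nKx; split; first exact: K0.
  rewrite derive1E.
  have : is_derive x 1 phi 0.
    apply: near_eq_is_derive (is_derive_cst 0 x 1).
    near=> y; rewrite K0//; near: y; exact: open_nbhs_nbhs.
  by move=> dx; exact: derive_val.
have Nd : d < N by rewrite /N; have := normr_ge0 M; lra.
have KdN x : K x -> d <= `|x| < N.
  move=> Kx; rewrite KN// andbT leNgt; apply/negP => xd.
  exact: Hd xd Kx.
case: rI => IE.
- have Kneg x : K x -> x < 0 by move=> /KI; rewrite IE /Rminus /= in_itv.
  exists (- N), (- (d / 2)); split.
  + by lra.
  + by move=> x; rewrite IE /Rminus /= !in_itv/=; move=> /andP[_ h]; lra.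
  + by apply: K0 => /KN; rewrite normrN; have := ler_norm N; lra.
  + apply: K0 => /KdN; rewrite normrN gtr0_norm; last by lra.
    by lra.
  + move=> x nx; apply: out => Kx; apply: nx; rewrite /= in_itv/=.
    have := KdN _ Kx; rewrite (ltr0_norm (Kneg _ Kx)) => /andP[? ?].
    by apply/andP; split; lra.
- have Kpos x : K x -> 0 < x by move=> /KI; rewrite IE /Rplus /= in_itv/= andbT.
  exists (d / 2), N; split.
  + by lra.
  + by move=> x; rewrite IE /Rplus /= !in_itv/= andbT; move=> /andP[h _]; lra.
  + apply: K0 => /KdN; rewrite gtr0_norm; last by lra.
    by lra.
  + by apply: K0 => /KN; have := ler_norm N; lra.
  + move=> x nx; apply: out => Kx; apply: nx; rewrite /= in_itv/=.
    have := KdN _ Kx; rewrite (gtr0_norm (Kpos _ Kx)) => /andP[? ?].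
    by apply/andP; split; lra.
Unshelve. all: by end_near. Qed.

Lemma ray_integration_by_parts I F f phi : ray I ->
  (forall x : R, is_derive x 1 F (f x)) -> continuous f -> test_fun I phi ->
  \int[leb]_(x in I) (F x * derive1 phi x) = - \int[leb]_(x in I) (f x * phi x).
Proof.
move=> rI dF cf tphi; have [a [b [ab abI phia phib out]]] := test_fun_support rI tphi.
have [dphi cdphi _] := tphi.
rewrite (Rintegral_support abI); last by move=> x _ /out[_ ->]; rewrite mulr0.
rewrite [in RHS](Rintegral_support abI); last by move=> x _ /out[-> _]; rewrite mulr0.
have cphi : continuous phi.
  by move=> x; apply: differentiable_continuous; apply/derivable1_diffP.
have cF := der_cts dF.
have dLR (h : R -> R) : continuous h -> (forall x, derivable h x 1) ->
    derivable_oo_LRcontinuous h a b.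
  move=> ch dh; split; first by move=> x _; exact: dh.
    exact: cvg_at_right_filter (ch a).
  exact: cvg_at_left_filter (ch b).
have dLRF := dLR F cF (fun x => @ex_derive _ _ _ _ _ _ _ (dF x)).
have dFE : {in `]a, b[, derive1 F =1 f}.
  by move=> x _; rewrite derive1E; exact: (@derive_val _ _ _ _ _ _ _ (dF x)).
have dphiE : {in `]a, b[, derive1 phi =1 derive1 phi} by move=> x _.
rewrite (Rintegration_by_parts ab (continuous_subspaceT cf) dLRF dFE
  (continuous_subspaceT cdphi) (dLR _ cphi dphi) dphiE).
by rewrite phia phib !mulr0 subrr sub0r.
Qed.

Section real_function.
Variables (I : set R) (u : R -> R[i]) (F f : R -> R).
Hypotheses (rI : ray I) (uF : forall x, I x -> u x = (F x)%:C%C).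
Hypotheses (dF : forall x : R, is_derive x 1 F (f x)) (cf : continuous f).
Hypotheses (iF : leb.-integrable I (EFin \o (fun x => F x ^+ 2))).
Hypotheses (jf : leb.-integrable I (EFin \o (fun x => f x ^+ 2))).

Let cF : continuous F.
Proof. exact: der_cts dF. Qed.

Lemma L2_real (v : R -> R[i]) (h : R -> R) : (forall x, I x -> v x = (h x)%:C%C) ->
  continuous h -> leb.-integrable I (EFin \o (fun x => h x ^+ 2)) -> L2 I v.
Proof.
move=> vh ch ih; split.
- apply: (eq_measurable_fun h); first by move=> x /set_mem Ix; rewrite vh.
  by apply: measurable_funTS; exact: measurable_realfun.continuous_measurable_fun.
- have m0 : measurable_fun I (fun _ : R => 0 : R) by exact: measurable_cst.
  apply: eq_measurable_fun m0.
  by move=> x /set_mem Ix; rewrite vh.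
- apply: eq_integrable ih; first exact: ray_measurable.
  move=> x /set_mem Ix; rewrite /= vh// normcE_modulus /modulus/=.
  by rewrite expr0n addr0 powR_mulrn ?sqrtr_ge0// sqr_sqrtr ?sqr_ge0.
Qed.

Lemma is_weak_deriv_real : is_weak_deriv I u (fun x => (f x)%:C%C).
Proof.
move=> phi tphi; have E := ray_integration_by_parts rI dF cf tphi.
have E1 : \int[leb]_(x in I) complex.Re (u x * (derive1 phi x)%:C%C) =
    \int[leb]_(x in I) (F x * derive1 phi x).
  by apply: eq_Rintegral => x /set_mem Ix; rewrite (Re_mul_real _ _).1 uF.
have E2 : \int[leb]_(x in I) complex.Im (u x * (derive1 phi x)%:C%C) = 0.
  by apply: Rintegral_eq0 => x Ix; rewrite (Re_mul_real _ _).2 uF//= mul0r.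
have E3 : \int[leb]_(x in I) complex.Re ((f x)%:C%C * (phi x)%:C%C) =
    \int[leb]_(x in I) (f x * phi x).
  by apply: eq_Rintegral => x /set_mem Ix; rewrite (Re_mul_real _ _).1.
have E4 : \int[leb]_(x in I) complex.Im ((f x)%:C%C * (phi x)%:C%C) = 0.
  by apply: Rintegral_eq0 => x Ix; rewrite (Re_mul_real _ _).2/= mul0r.
by rewrite /cintegral E1 E2 E3 E4 E; apply/eqP; rewrite eq_complex/= oppr0 !eqxx.
Qed.

Lemma H1_real : H1 I u.
Proof.
split; first exact: L2_real uF cF iF.
exists (fun x => (f x)%:C%C); split; last exact: is_weak_deriv_real.
exact: (@L2_real (fun x => (f x)%:C%C) f).
Qed.

Lemma trace0_real : trace0 I u = (F 0)%:C%C.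
Proof.
rewrite (@trace0E _ I u F (cst 0))//.
- by move=> x; exact: cvg_cst.
- by apply: aeW => x Ix; rewrite uF.
- by apply: aeW => x Ix; rewrite uF.
Qed.

(** [weak_deriv] is a chosen representative, comparable with [f] only almost everywhere. By
    continuity [F] equals a constant plus the primitive of the choice on all of [I], and almost
    everywhere that primitive has the choice as its derivative. *)
Lemma weak_deriv_real_ae :
  {ae leb, forall x, I x -> normc (weak_deriv I u x) ^+ 2 = f x ^+ 2}.
Proof.
have [Lg w] := weak_derivP H1_real; have [Lu _] := H1_real.
have mI := ray_measurable rI.
have [mg1 mg2 ig1 ig2 _] := L2_components mI Lg.
have [A [B [aeA aeB]]] := weak_deriv_prim rI Lu Lg w.
set g := weak_deriv I u in mg1 mg2 ig1 ig2 aeA aeB *.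
set G1 := (_ \_ I) in aeA; set G2 := (_ \_ I) in aeB.
have l1 : loc_int G1 by exact: loc_int_sqr.
have l2 : loc_int G2 by exact: loc_int_sqr.
have aed (h dh : R -> R) (G : R -> R) C : loc_int G -> measurable_fun setT G ->
    (forall x : R, is_derive x 1 h (dh x)) ->
    {ae leb, forall x, I x -> h x = C + prim G x} ->
    {ae leb, forall x, I x -> G x = dh x}.
  move=> lG mG dhP aeh.
  have E : forall x, I x -> h x = C + prim G x.
    apply: ae_eq_continuous aeh; first exact: ray_open.
    - by move=> x _; exact: der_cts dhP x.
    - by move=> x _; apply: ctsD; [exact: cts_cst|exact: continuous_prim].
  apply: filterS (ae_is_derive_prim mG lG); first exact: (ae_filter_ringOfSetsType leb).
  move=> x dG Ix.
  have d1 : is_derive x 1 h (0 + G x).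
    apply: near_eq_is_derive (derD (is_derive_cst C x 1) dG).
    near=> y; rewrite E//; near: y; apply: open_nbhs_nbhs.
    by split => //; exact: ray_open.
  have d2 := dhP x.
  by rewrite -[LHS]add0r -(@derive_val _ _ _ _ _ _ _ d1) (@derive_val _ _ _ _ _ _ _ d2).
have ae1 : {ae leb, forall x, I x -> G1 x = f x}.
  apply: (aed F f G1 A) => //; first exact: measurable_restrict0.
  apply: filterS aeA; first exact: (ae_filter_ringOfSetsType leb).
  by move=> x h Ix; rewrite -h// uF.
have ae2 : {ae leb, forall x, I x -> G2 x = 0}.
  apply: (aed (cst 0) (cst 0) G2 B) => //; first exact: measurable_restrict0.
  apply: filterS aeB; first exact: (ae_filter_ringOfSetsType leb).
  by move=> x h Ix; rewrite -h// uF.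
apply: filterS2 ae1 ae2; first exact: (ae_filter_ringOfSetsType leb).
move=> x; rewrite /G1 /G2 !patchE => h1 h2 Ix.
move: h1 h2; rewrite !mem_set// => h1 h2.
by rewrite normcE_modulus sqr_modulus h1// h2// expr0n addr0.
Unshelve. all: by end_near. Qed.

Lemma kinetic_real : Lpnorm_pow 2 I (weak_deriv I u) = \int[leb]_(x in I) (f x ^+ 2).
Proof.
have [[mg1 mg2 ig] w] := weak_derivP H1_real.
have mI := ray_measurable rI.
have mn : measurable_fun I (fun x => normc (weak_deriv I u x)).
  have := measurable_modulus mg1 mg2; congr measurable_fun.
  by apply/funext => x; rewrite normcE_modulus.
rewrite /Lpnorm_pow.
have -> : \int[leb]_(x in I) (normc (weak_deriv I u x) `^ 2) =
    \int[leb]_(x in I) (normc (weak_deriv I u x) ^+ 2).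
  by apply: eq_Rintegral => x _; rewrite powR_mulrn// normcE_modulus modulus_ge0.
apply: ae_Rintegral => //.
- exact: measurable_funX.
- apply: measurable_funX; apply: measurable_funTS.
  exact: measurable_realfun.continuous_measurable_fun.
- exact: weak_deriv_real_ae.
Qed.

Lemma Lpnorm_pow_real p : Lpnorm_pow p I u = \int[leb]_(x in I) (`|F x| `^ p).
Proof.
apply: eq_Rintegral => x /set_mem Ix; rewrite uF// normcE_modulus /modulus/=.
by rewrite expr0n addr0 sqrtr_sqr.
Qed.

End real_function.
End smooth_on_ray.

Section shifted_integral.
Context {R : realType}.
Local Notation leb := (@lebesgue_measure R).

Lemma integral_shift_pinfty (F f : R -> R) s (l : R) : (forall x, 0 <= f x) ->
  continuous f -> (forall x : R, is_derive x 1 F (f x)) -> F x @[x --> +oo] --> l ->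
  (\int[leb]_(x in `[0%R, +oo[) (f (x + s)%R)%:E)%E = (l - F s)%:E.
Proof.
move=> f0 cf dF Fl.
have dFs (x : R) : is_derive x 1 (fun y => F (y + s)) (f (x + s)).
  have ds : is_derive x 1 (fun y : R => y + s) 1.
    by apply: is_derive_eq; rewrite addr0.
  by have := der_comp ds (dF (x + s)); rewrite mulr1.
have cFs := der_cts dFs.
have cfs : continuous (fun y => f (y + s)).
  by apply: (@cts_comp R (fun y => y + s)) => //; apply: ctsD; [exact: cts_id|exact: cts_cst].
rewrite (@ge0_continuous_FTC2y _ _ (fun y => F (y + s)) 0 l).
- by rewrite add0r EFinB.
- by move=> x _.
- exact: continuous_subspaceT cfs.
- apply: (@cvg_comp _ _ _ (fun y => y + s) F); last exact: Fl.
  exact: cvg_addrr.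
- by move=> x _; have d := dFs x; exact: ex_derive.
- exact: cvg_at_right_filter (cFs 0).
- by move=> x _; rewrite derive1E (@derive_val _ _ _ _ _ _ _ (dFs x)).
Qed.

End shifted_integral.

(** * The normalized soliton and its half-line integrals *)

Section soliton.
Context {R : realType}.
Local Notation leb := (@lebesgue_measure R).
Variables mu om : R.
Hypotheses (mu0 : 0 < mu) (om0 : 0 < om).
Implicit Types (x y s : R).
Local Notation so := (Num.sqrt om).
Local Notation q := (2 * mu).
Local Notation S := (slope om q).
Local Notation g := (calib om q).

(** The rate [mu * so] is chosen so that the power [-1 / mu] decays like [exp (- so * x)]. *)
Definition scosh x : R := (expR (mu * so * x) + expR (- (mu * so * x))) / 2.
Definition ssinh x : R := (expR (mu * so * x) - expR (- (mu * so * x))) / 2.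
Definition stanh x : R := ssinh x / scosh x.

(* The locks keep conversion from unfolding these real functions. *)
Fact soliton_key : unit. Proof. exact: tt. Qed.

(** Normalized to peak 1 at 0; the amplitude required by the nonlinearity is multiplied in at the
    end. *)
Definition soliton : R -> R := locked_with soliton_key (fun x => scosh x `^ (- mu^-1)).

Lemma solitonE x : soliton x = scosh x `^ (- mu^-1).
Proof. by rewrite /soliton unlock. Qed.

Definition dsoliton : R -> R :=
  locked_with soliton_key (fun x => - so * stanh x * soliton x).

Lemma dsolitonE x : dsoliton x = - so * stanh x * soliton x.
Proof. by rewrite /dsoliton unlock. Qed.

Let so0 : 0 < so. Proof. by rewrite sqrtr_gt0. Qed.
Let q0 : 0 < q. Proof. exact: mulr_gt0. Qed.
Let munz : mu != 0. Proof. by rewrite gt_eqF. Qed.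

Lemma scosh_gt0 x : 0 < scosh x.
Proof. by rewrite divr_gt0// addr_gt0// expR_gt0. Qed.

Lemma scosh_sqr x : scosh x ^+ 2 = 1 + ssinh x ^+ 2.
Proof.
rewrite /scosh /ssinh expRN; set e := expR _.
have e0 : e != 0 by rewrite gt_eqF// expR_gt0.
by field.
Qed.

Lemma scosh_ge1 x : 1 <= scosh x.
Proof.
have := scosh_sqr x; have := sqr_ge0 (ssinh x); have := scosh_gt0 x => c0 s0 E.
rewrite leNgt; apply/negP => c1.
have : scosh x ^+ 2 < 1 by rewrite expr_lt1// ltW.
by lra.
Qed.

Lemma is_derive_scosh x : is_derive x 1 scosh (mu * so * ssinh x).
Proof.
have dl c : is_derive x 1 (fun y : R => expR (c * y)) (expR (c * x) * c).
  have dm : is_derive x 1 (fun y : R => c * y) c.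
    by apply: is_derive_eq; rewrite /GRing.scale/=; ring.
  exact: der_comp dm (is_derive_expR _).
have d1 := dl (mu * so); have d2 := dl (- (mu * so)).
have := derZ 2^-1 (derD d1 d2).
rewrite (_ : (fun y => 2^-1 * _) = scosh); last first.
  by apply/funext => y; rewrite /scosh mulrC mulNr.
by move=> d; apply: is_derive_eq d _; rewrite /ssinh mulNr; field.
Qed.

Lemma is_derive_ssinh x : is_derive x 1 ssinh (mu * so * scosh x).
Proof.
have dl c : is_derive x 1 (fun y : R => expR (c * y)) (expR (c * x) * c).
  have dm : is_derive x 1 (fun y : R => c * y) c.
    by apply: is_derive_eq; rewrite /GRing.scale/=; ring.
  exact: der_comp dm (is_derive_expR _).
have d1 := dl (mu * so); have d2 := dl (- (mu * so)).
have := derZ 2^-1 (derD d1 (derN d2)).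
rewrite (_ : (fun y => 2^-1 * _) = ssinh); last first.
  by apply/funext => y; rewrite /ssinh mulrC mulNr.
by move=> d; apply: is_derive_eq d _; rewrite /scosh mulNr; field.
Qed.

Lemma soliton_gt0 x : 0 < soliton x.
Proof. by rewrite solitonE powR_gt0// scosh_gt0. Qed.

Lemma is_derive_soliton x : is_derive x 1 soliton (dsoliton x).
Proof.
have := der_comp (is_derive_scosh x) (is_derive1_powR (- mu^-1) (scosh_gt0 x)).
rewrite [X in is_derive _ _ X _](_ : _ = soliton); last by apply/funext => y; rewrite solitonE.
move=> d; apply: is_derive_eq d _; rewrite dsolitonE /stanh solitonE.
rewrite powRB; last by apply/implyP => _; rewrite gt_eqF// scosh_gt0.
rewrite powRr1 ?ltW ?scosh_gt0//.
by field; rewrite munz gt_eqF// scosh_gt0.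
Qed.

Lemma soliton_powR x : soliton x `^ q = (scosh x ^+ 2)^-1.
Proof.
rewrite solitonE -powRrM.
have -> : - mu^-1 * (2 * mu) = - 2 by field.
by rewrite powRN powR_mulrn// ltW// scosh_gt0.
Qed.

Lemma stanh_sqr x : stanh x ^+ 2 = 1 - soliton x `^ q.
Proof.
rewrite soliton_powR /stanh expr_div_n.
have c0 : scosh x != 0 by rewrite gt_eqF// scosh_gt0.
have := scosh_sqr x => E.
have -> : ssinh x ^+ 2 = scosh x ^+ 2 - 1 by rewrite E; ring.
by field.
Qed.

Lemma is_derive_stanh x : is_derive x 1 stanh (mu * so * soliton x `^ q).
Proof.
have c0 : scosh x != 0 by rewrite gt_eqF// scosh_gt0.
have dV : is_derive x 1 (fun y => (scosh y)^-1) (- (scosh x ^+ 2)^-1 * (mu * so * ssinh x)).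
  have := is_deriveV c0 (is_derive_scosh x).
  by move=> d; apply: is_derive_eq d _.
have d := derM (is_derive_ssinh x) dV; apply: is_derive_eq d _.
rewrite soliton_powR.
have := scosh_sqr x => E.
transitivity (mu * so * (scosh x ^+ 2 - ssinh x ^+ 2) / scosh x ^+ 2); first by field.
have -> : scosh x ^+ 2 - ssinh x ^+ 2 = 1 by rewrite E; ring.
by rewrite mulr1.
Qed.

Lemma continuous_soliton : continuous soliton.
Proof. exact: der_cts is_derive_soliton. Qed.

Lemma continuous_dsoliton : continuous dsoliton.
Proof.
rewrite (_ : dsoliton = (fun x => - so * stanh x * soliton x)); last first.
  by apply/funext => y; rewrite dsolitonE.
apply: ctsM; last exact: continuous_soliton.
by apply: ctsM; [exact: cts_cst|exact: der_cts is_derive_stanh].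
Qed.

Lemma ssinh_ge0 x : 0 <= x -> 0 <= ssinh x.
Proof.
move=> x0; rewrite divr_ge0// subr_ge0 ler_expR.
have : 0 <= mu * so * x by rewrite !mulr_ge0// ltW.
by lra.
Qed.

Lemma scoshN x : scosh (- x) = scosh x.
Proof. by rewrite /scosh mulrN opprK addrC. Qed.

Lemma ssinhN x : ssinh (- x) = - ssinh x.
Proof. by rewrite /ssinh mulrN opprK; ring. Qed.

Lemma solitonN x : soliton (- x) = soliton x.
Proof. by rewrite !solitonE scoshN. Qed.

Lemma dsolitonN x : dsoliton (- x) = - dsoliton x.
Proof. by rewrite !dsolitonE /stanh scoshN ssinhN solitonN; ring. Qed.

Lemma soliton0 : soliton 0 = 1.
Proof.
rewrite solitonE /scosh mulr0 oppr0 expR0.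
have -> : (1 + 1) / 2 = 1 :> R by field.
by rewrite powR1.
Qed.

Lemma soliton_le1 x : soliton x <= 1.
Proof.
rewrite solitonE powRN invf_le1 ?powR_gt0 ?scosh_gt0//.
have -> : 1 = 1 `^ mu^-1 :> R by rewrite powR1.
apply: ge0_ler_powR; rewrite ?nnegrE ?invr_ge0 ?scosh_ge1//; first exact: ltW.
by rewrite ltW// scosh_gt0.
Qed.

Lemma slope_soliton x : 0 <= x -> S (soliton x) = so * stanh x.
Proof.
move=> x0; have t0 : 0 <= stanh x by rewrite divr_ge0 ?ssinh_ge0// ltW// scosh_gt0.
rewrite /slope ger0_norm; last by rewrite ltW// soliton_gt0.
by rewrite -stanh_sqr sqrtrM ?ltW// sqrtr_sqr ger0_norm.
Qed.

Lemma dsoliton_slope x : 0 <= x -> dsoliton x = - (S (soliton x) * soliton x).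
Proof. by move=> x0; rewrite slope_soliton// dsolitonE; ring. Qed.

(** The first integral in squared form holds on both sides of the peak, whereas in [dsoliton_slope]
    the sign depends on the side. *)
Lemma dsoliton_sqr x : dsoliton x ^+ 2 = om * soliton x ^+ 2 - om * soliton x `^ (q + 2).
Proof.
rewrite powRD; last by apply/implyP; rewrite gt_eqF// addr_gt0.
rewrite powR_mulrn ?ltW ?soliton_gt0//.
have -> : dsoliton x ^+ 2 = so ^+ 2 * stanh x ^+ 2 * soliton x ^+ 2.
  by rewrite dsolitonE; ring.
by rewrite stanh_sqr sqr_sqrtr ?ltW//; ring.
Qed.

Lemma soliton_cvg0 : soliton x @[x --> +oo] --> 0.
Proof.
have cV : (fun x => (scosh x)^-1) @ +oo --> (0 : R).
  apply: (@squeeze_cvgr _ _ _ _ (fun=> 0) (fun x => 2 * expR (- (mu * so * x)))).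
  - apply: nearW => x; rewrite invr_ge0 (ltW (scosh_gt0 x))/=.
    rewrite /scosh expRN invf_div ler_pM2l// lef_pV2 ?posrE ?addr_gt0 ?invr_gt0 ?expR_gt0//.
    by rewrite lerDl invr_ge0 expR_ge0.
  - exact: cvg_cst.
  - rewrite -[X in _ --> X](mulr0 2); apply: cvgM; first exact: cvg_cst.
    apply: (@cvg_comp _ _ _ (fun x => mu * so * x) (fun x => expR (- x))); last exact: cvgr_expR.
    by apply: gt0_cvgMry; [exact: mulr_gt0|exact: cvg_id].
have im0 : 0 < mu^-1 by rewrite invr_gt0.
have cp := @continuous_norm_powR R _ im0 0.
have : (fun x => `|(scosh x)^-1| `^ mu^-1) @ +oo --> `|0 : R| `^ mu^-1.
  exact: (@cvg_comp _ _ _ (fun x => (scosh x)^-1) (fun t => `|t| `^ mu^-1) _ _ _ cV cp).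
rewrite normr0 powR0 ?gt_eqF//; apply: cvg_trans; apply: near_eq_cvg.
apply: nearW => x; rewrite ger0_norm ?invr_ge0 ?(ltW (scosh_gt0 x))//.
by rewrite solitonE powRN -powR_inv1 ?(ltW (scosh_gt0 x))// -powRrM mulN1r powRN.
Qed.

(** By the first integral, [phi * phi'' = phi'^2 - mu * om * phi^(q + 2)]. Integrated from [s] to
    infinity, this links the kinetic and power integrals through the boundary term
    [phi s * phi' s]. *)
Lemma is_derive_soliton_dsoliton x :
  is_derive x 1 (fun y => soliton y * dsoliton y)
    (2 * dsoliton x ^+ 2 - mu * om * soliton x `^ (q + 2)).
Proof.
have dd : is_derive x 1 dsoliton
   (- so * (mu * so * soliton x `^ q) * soliton x + - so * stanh x * dsoliton x).
  have d := derM (derZ (- so) (is_derive_stanh x)) (is_derive_soliton x).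
  rewrite (_ : (fun y => - so * stanh y * soliton y) = dsoliton) in d; last first.
    by apply/funext => y; rewrite dsolitonE.
  by apply: is_derive_eq d _; ring.
have d := derM (is_derive_soliton x) dd; apply: is_derive_eq d _.
rewrite powRD; last by apply/implyP; rewrite gt_eqF// addr_gt0.
rewrite powR_mulrn ?ltW ?soliton_gt0//.
have E : so * so = om by rewrite -expr2 sqr_sqrtr// ltW.
transitivity (2 * dsoliton x ^+ 2 - mu * (so * so) * (soliton x `^ q * soliton x ^+ 2)).
  transitivity (- mu * (so * so) * (soliton x `^ q * soliton x ^+ 2) +
      (- so * stanh x * soliton x) * dsoliton x + dsoliton x * dsoliton x); first by ring.
  by rewrite -dsolitonE; ring.
by rewrite E.
Qed.

Definition soliton_energy : R -> R :=
  locked_with soliton_key (prim (fun y => 2 * dsoliton y ^+ 2)).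

Lemma soliton_energyE : soliton_energy = prim (fun y => 2 * dsoliton y ^+ 2).
Proof. by rewrite /soliton_energy unlock. Qed.

Let ce : continuous (fun y => 2 * dsoliton y ^+ 2).
Proof. by apply: ctsM; [exact: cts_cst|exact: ctsX continuous_dsoliton]. Qed.

Lemma is_derive_soliton_energy x :
  is_derive x 1 soliton_energy (2 * dsoliton x ^+ 2).
Proof. by rewrite soliton_energyE; exact: is_derive_prim ce. Qed.

Lemma is_derive_calib_soliton x :
  is_derive x 1 (fun y => g (soliton y)) (calib_deriv om q (soliton x) * dsoliton x).
Proof. exact: der_comp (is_derive_soliton x) (is_derive_calib om _ q0). Qed.

(** The equality case of the calibration: along the soliton, [2 * phi'^2] is up to sign the
    derivative of [g (phi)]. The sign changes at the peak, hence a separate evaluation on each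
    side. *)
Lemma soliton_energy_ge0 x : 0 <= x -> soliton_energy x = g 1 - g (soliton x).
Proof.
rewrite le_eqVlt => /predU1P[<-|x0].
  by rewrite soliton_energyE prim0 soliton0 subrr.
have dF y := derN (is_derive_calib_soliton y).
have cF := der_cts dF.
rewrite soliton_energyE prim_ge0 ?ltW// /Rintegral.
rewrite (@continuous_FTC2 _ _ (fun y => - g (soliton y)) 0 x x0).
- by rewrite /= soliton0; ring.
- exact: continuous_subspaceT ce.
- split.
  + by move=> y _; have d := dF y; exact: ex_derive.
  + exact: cvg_at_right_filter (cF 0).
  + exact: cvg_at_left_filter (cF x).
- move=> y; rewrite in_itv/= => /andP[/ltW y0 _].
  rewrite derive1E (@derive_val _ _ _ _ _ _ _ (dF y)) /calib_deriv.
  have E := dsoliton_slope y0.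
  transitivity (2 * dsoliton y * (- (S (soliton y) * soliton y))); first by ring.
  by rewrite -E; ring.
Qed.

Lemma soliton_energy_le0 x : x <= 0 -> soliton_energy x = g (soliton x) - g 1.
Proof.
rewrite le_eqVlt => /predU1P[->|x0].
  by rewrite soliton_energyE prim0 soliton0 subrr.
have dF y := is_derive_calib_soliton y.
have cF := der_cts dF.
rewrite soliton_energyE prim_le0 ?ltW// /Rintegral.
rewrite (@continuous_FTC2 _ _ (fun y => g (soliton y)) x 0 x0).
- by rewrite /= soliton0; ring.
- exact: continuous_subspaceT ce.
- split.
  + by move=> y _; have d := dF y; exact: ex_derive.
  + exact: cvg_at_right_filter (cF x).
  + exact: cvg_at_left_filter (cF 0).
- move=> y; rewrite in_itv/= => /andP[_ /ltW y0].
  rewrite derive1E (@derive_val _ _ _ _ _ _ _ (dF y)) /calib_deriv.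
  have y0' : 0 <= - y by rewrite oppr_ge0.
  have := dsoliton_slope y0'; rewrite dsolitonN solitonN => /oppr_inj E.
  transitivity (2 * dsoliton y * (S (soliton y) * soliton y)); first by ring.
  by rewrite -E; ring.
Qed.

Lemma soliton_energy_cvg : soliton_energy x @[x --> +oo] --> g 1.
Proof.
have : (fun x => g 1 - g (soliton x)) @ +oo --> g 1 - g 0.
  apply: cvgB; first exact: cvg_cst.
  apply: (@cvg_comp _ _ _ soliton g); first exact: soliton_cvg0.
  exact: continuous_calib.
rewrite calib0 subr0; apply: cvg_trans; apply: near_eq_cvg.
near=> x; have x0 : 0 <= x by near: x; exact: nbhs_pinfty_ge.
by rewrite soliton_energy_ge0.
Unshelve. all: by end_near. Qed.

(** The integral of [phi'^2] over [[s, +oo[]. *)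
Definition soliton_kin : R -> R :=
  locked_with soliton_key (fun s => (g 1 - soliton_energy s) / 2).

Lemma soliton_kinE s : soliton_kin s = (g 1 - soliton_energy s) / 2.
Proof. by rewrite /soliton_kin unlock. Qed.

(** The integral of [phi^(2 mu + 2)] over [[s, +oo[], as found by integrating the derivative of
    [phi * phi']. *)
Definition soliton_pow : R -> R := locked_with soliton_key (fun s =>
  (g 1 - soliton_energy s + soliton s * dsoliton s) / (mu * om)).

Lemma soliton_powE s : soliton_pow s =
  (g 1 - soliton_energy s + soliton s * dsoliton s) / (mu * om).
Proof. by rewrite /soliton_pow unlock. Qed.

Let cd2 : continuous (fun x => dsoliton x ^+ 2).
Proof. exact: ctsX continuous_dsoliton. Qed.

Lemma continuous_soliton_powR : continuous (fun x => soliton x `^ (q + 2)).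
Proof.
rewrite (_ : (fun x => _) = (fun x => `|soliton x| `^ (q + 2))); last first.
  by apply/funext => x; rewrite ger0_norm// ltW// soliton_gt0.
apply: (@cts_comp R soliton (fun t => `|t| `^ (q + 2))); first exact: continuous_soliton.
by apply: continuous_norm_powR; exact: addr_gt0.
Qed.

Lemma integral_dsoliton s :
  (\int[leb]_(x in `[0%R, +oo[) (dsoliton (x + s) ^+ 2)%:E)%E = (soliton_kin s)%:E.
Proof.
have dE (x : R) : is_derive x 1 (fun x => 2^-1 * soliton_energy x) (dsoliton x ^+ 2).
  have d := derZ 2^-1 (is_derive_soliton_energy x).
  by apply: is_derive_eq d _; field.
have El : (fun x => 2^-1 * soliton_energy x) @ +oo --> 2^-1 * g 1.
  by apply: cvgM; [exact: cvg_cst|exact: soliton_energy_cvg].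
rewrite (integral_shift_pinfty s _ cd2 dE El).
  by congr EFin; rewrite soliton_kinE; field.
by move=> x; exact: sqr_ge0.
Qed.

Lemma dsoliton_bound x : `|dsoliton x| <= so.
Proof.
rewrite -(@ler_sqr R) ?nnegrE ?(ltW so0)// real_normK ?num_real//.
rewrite sqr_sqrtr ?(ltW om0)// dsoliton_sqr.
apply: (@le_trans _ _ (om * soliton x ^+ 2)).
  by rewrite gerBl mulr_ge0 ?powR_ge0// ltW.
by rewrite ler_piMr ?(ltW om0)// expr_le1 ?soliton_le1// ltW// soliton_gt0.
Qed.

Lemma integral_soliton_powR s :
  (\int[leb]_(x in `[0%R, +oo[) (soliton (x + s) `^ (q + 2))%:E)%E = (soliton_pow s)%:E.
Proof.
pose F x := (mu * om)^-1 * (soliton_energy x + - (soliton x * dsoliton x)).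
have dF (x : R) : is_derive x 1 F (soliton x `^ (q + 2)).
  have d := derZ (mu * om)^-1 (derD (is_derive_soliton_energy x)
    (derN (is_derive_soliton_dsoliton x))).
  by apply: is_derive_eq d _; field; rewrite munz gt_eqF.
have Fl : F @ +oo --> (mu * om)^-1 * (g 1 + - 0).
  apply: cvgM; first exact: cvg_cst.
  apply: cvgD; first exact: soliton_energy_cvg.
  apply: cvgN.
  (* The boundary term [phi * phi'] vanishes at infinity because [phi'] is bounded by [so]. *)
  have H : (fun x => soliton x * so) @ +oo --> (0 : R).
    by rewrite -[X in _ --> X](mul0r so); apply: cvgM; [exact: soliton_cvg0|exact: cvg_cst].
  have HN : (fun x => - (soliton x * so)) @ +oo --> (0 : R).
    by rewrite -[X in _ --> X]oppr0; exact: cvgN.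
  apply: (squeeze_cvgr _ HN H); apply: nearW => x.
  have := dsoliton_bound x; rewrite ler_norml => /andP[h1 h2].
  by rewrite -mulrN !ler_pM2l ?soliton_gt0// h1.
rewrite (integral_shift_pinfty s _ continuous_soliton_powR dF Fl).
  by congr EFin; rewrite /F soliton_powE; field; rewrite munz gt_eqF.
by move=> x; exact: powR_ge0.
Qed.

Lemma integral_soliton_sqr s :
  (\int[leb]_(x in `[0%R, +oo[) (soliton (x + s) ^+ 2)%:E)%E =
  (om^-1 * soliton_kin s + soliton_pow s)%:E.
Proof.
have E x : soliton (x + s) ^+ 2 = om^-1 * dsoliton (x + s) ^+ 2 + soliton (x + s) `^ (q + 2).
  by rewrite dsoliton_sqr; field; rewrite gt_eqF.
have mT (f : R -> R) : continuous f -> measurable_fun `[(0 : R), +oo[ (fun x => f (x + s)).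
  move=> cf; apply: measurable_funTS; apply: measurable_realfun.continuous_measurable_fun.
  by apply: (@cts_comp R (fun y => y + s)) => //; apply: ctsD; [exact: cts_id|exact: cts_cst].
under eq_integral do rewrite E EFinD.
rewrite ge0_integralD//=.
- under eq_integral do rewrite EFinM.
  rewrite ge0_integralZl//=.
  + by rewrite integral_dsoliton integral_soliton_powR.
  + by apply/measurable_EFinP; exact: (mT (fun x => dsoliton x ^+ 2)).
  + by move=> x _; rewrite lee_fin sqr_ge0.
  + by rewrite lee_fin invr_ge0 ltW.
- by move=> x _; rewrite lee_fin mulr_ge0 ?sqr_ge0// invr_ge0 ltW.
- apply/measurable_EFinP; apply: measurable_funM => //.
  exact: (mT (fun x => dsoliton x ^+ 2)).
- by move=> x _; rewrite lee_fin powR_ge0.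
- by apply/measurable_EFinP; exact: (mT (fun x => soliton x `^ (q + 2)) continuous_soliton_powR).
Qed.

Lemma soliton_kin_ge0 s : 0 <= s -> soliton_kin s = g (soliton s) / 2.
Proof. by move=> s0; rewrite soliton_kinE soliton_energy_ge0//; congr (_ / 2); ring. Qed.

Lemma soliton_kin_le0 s : s <= 0 -> soliton_kin s = (2 * g 1 - g (soliton s)) / 2.
Proof. by move=> s0; rewrite soliton_kinE soliton_energy_le0//; congr (_ / 2); ring. Qed.

Lemma soliton_pow_kin s :
  mu * om * soliton_pow s = 2 * soliton_kin s + soliton s * dsoliton s.
Proof. by rewrite soliton_powE soliton_kinE; field; rewrite munz gt_eqF. Qed.

Lemma soliton_surj b : 0 < b -> b <= 1 -> exists2 s, 0 <= s & soliton s = b.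
Proof.
move=> b0 b1.
have /cvgrPdist_lt/(_ _ b0) H := soliton_cvg0.
have [y [y0 yb]] : exists y, 0 <= y /\ soliton y < b.
  near (+oo%R : set_system R) => y; exists y; split.
    by near: y; exact: nbhs_pinfty_ge.
  have : `|0 - soliton y| < b by near: y; exact: H.
  by rewrite sub0r normrN gtr0_norm// soliton_gt0.
have [|s + Es] := @IVT R soliton 0 y b y0 (continuous_subspaceT continuous_soliton).
  have y1 : soliton y <= 1 by exact: soliton_le1.
  by rewrite soliton0 (min_idPr y1) (max_idPl y1) b1 ltW.
by rewrite in_itv/= => /andP[s0 _]; exists s.
Unshelve. all: by end_near. Qed.

End soliton.

(** * From the optimal boundary value to shifts of the soliton *)

Section optimal_shifts.
Context {R : realType}.
Variables mu om : R.
Hypotheses (mu0 : 0 < mu) (om0 : 0 < om).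
Implicit Types (T v M N B s : R).
Local Notation q := (2 * mu).
Local Notation g := (calib om q).
Local Notation phi := (soliton mu om).
Local Notation dphi := (dsoliton mu om).
Local Notation kin := (soliton_kin mu om).
Local Notation pow := (soliton_pow mu om).

Let q0 : 0 < q. Proof. exact: mulr_gt0. Qed.

(** Since [phi'] is [phi * slope phi] up to sign, multiplying [bdry = 0] by [b^2] gives the balance
    between the terms [phi * phi'] and the point interaction. With this balance the optimal boundary
    energy equals [mu * om] times the power integral of the profile. *)
Lemma bdry_shifts sg w : 0 < sg -> sg <= 1 -> 0 < w ->
  w < Num.sqrt om * (1 + sg ^+ 2) ->
  exists sb ss, [/\ phi ss = sg * phi sb,
    - (phi sb * dphi sb) - phi ss * dphi ss = w * phi sb ^+ 2 &
    forall M B (Eb Es : R -> R), 0 < M -> 0 <= B -> B <= M ->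
      (forall N, M <= N -> g (B / N) <= Eb N) ->
      (forall N, M <= N -> g (sg * B / N) <= Es N) ->
      (2 * g 1 - g (B / M) <= Eb M \/ 2 * g 1 - g (sg * B / M) <= Es M) ->
      exists2 N, M <= N &
        mu * om * (pow sb + pow ss) <= Eb N + Es N - w * (B / N) ^+ 2].
Proof.
move=> sg0 sg1 w0 wlt.
have [e [b [b0 b1 Eb]]] := exists_bdry q0 sg0 sg1 w0 wlt.
have sgb0 : 0 < sg * b by exact: mulr_gt0.
have sgb1 : sg * b <= 1 by rewrite mulr_ile1// ltW.
have [s s0 Es] := soliton_surj mu0 om0 b0 b1.
have [ss ss0 Ess] := soliton_surj mu0 om0 sgb0 sgb1.
(* A negative shift puts the peak inside the larger side. *)
pose sb := if e then s else - s.
have phisb : phi sb = b by rewrite /sb; case: (e); rewrite ?solitonN.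
have dss := dsoliton_slope mu0 om0 ss0.
have ds := dsoliton_slope mu0 om0 s0.
have Ebd : - (phi sb * dphi sb) - phi ss * dphi ss = w * phi sb ^+ 2.
  rewrite phisb dss Ess; move: Eb; rewrite /bdry /sb; case: (e) => Eb.
    rewrite ds Es.
    have -> : w = slope om q b + sg ^+ 2 * slope om q (sg * b).
      by apply/esym/eqP; rewrite -subr_eq0 Eb.
    by ring.
  rewrite dsolitonN ds Es.
  have -> : w = - slope om q b + sg ^+ 2 * slope om q (sg * b).
    by apply/esym/eqP; rewrite -subr_eq0 Eb.
  by ring.
have EK : mu * om * (pow sb + pow ss) = bdry_min om q e w sg b.
  rewrite mulrDr !soliton_pow_kin//.
  have -> : kin ss = g (sg * b) / 2 by rewrite soliton_kin_ge0// Ess.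
  have -> : kin sb = (if e then g b else 2 * g 1 - g b) / 2.
    rewrite /sb; case: (e); first by rewrite soliton_kin_ge0// Es.
    by rewrite soliton_kin_le0// ?solitonN ?Es// oppr_le0.
  move: Ebd; rewrite phisb /bdry_min => Ebd.
  have -> : (if e then g b else 2 * g 1 - g b) + g (sg * b) - w * b ^+ 2 =
      (if e then g b else 2 * g 1 - g b) + g (sg * b) -
      (- (b * dphi sb) - phi ss * dphi ss) by rewrite Ebd.
  move: (if e then _ else _) (g (sg * b)) (b * dphi sb) (phi ss * dphi ss).
  by move=> x y z t; field.
exists sb, ss; split; [by rewrite phisb|exact: Ebd|].
move=> M B Ebb Ess' M0 B0 BM H1 H2 H3; rewrite EK.
exact: (energy_lower_bound om0 q0 (ltW sg0) sg1 b0 b1 Eb M0 B0 BM H1 H2 H3).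
Qed.

Lemma optimal_shifts T v : 0 < T -> 0 < v -> v < Num.sqrt om * (1 + T ^+ 2) ->
  exists sp sm, [/\ phi sp = T * phi sm,
    - (phi sp * dphi sp) - phi sm * dphi sm = v * phi sm ^+ 2 &
    forall M Bp Bm (Ep Em : R -> R), 0 < M -> 0 <= Bm -> Bp = T * Bm ->
      Bp <= M -> Bm <= M ->
      (forall N, M <= N -> g (Bp / N) <= Ep N) ->
      (forall N, M <= N -> g (Bm / N) <= Em N) ->
      (2 * g 1 - g (Bp / M) <= Ep M \/ 2 * g 1 - g (Bm / M) <= Em M) ->
      exists2 N, M <= N &
        mu * om * (pow sp + pow sm) <= Ep N + Em N - v * (Bm / N) ^+ 2].
Proof.
move=> T0 v0 vlt; have [T1|T1] := leP T 1.
  have [sm [sp [h1 h2 h3]]] := bdry_shifts T0 T1 v0 vlt.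
  exists sp, sm; split; [exact: h1|by rewrite -h2 addrC|].
  move=> M Bp Bm Ep Em M0 Bm0 EB BpM BmM H1 H2 H3.
  rewrite EB in H1 H3.
  have {}H3 : 2 * g 1 - g (Bm / M) <= Em M \/ 2 * g 1 - g (T * Bm / M) <= Ep M.
    by case: H3 => H3; [right|left].
  have [N MN HN] := h3 M Bm Em Ep M0 Bm0 BmM H2 H1 H3.
  by exists N => //; rewrite addrC (addrC (Ep N)).
(* For [T > 1] the right side is the larger one. In terms of its boundary value the interaction
   strength is [v / T^2], and the threshold condition keeps its form with [T^-1] as ratio. *)
have Ti0 : 0 < T^-1 by rewrite invr_gt0.
have Ti1 : T^-1 <= 1 by rewrite invf_le1// ltW.
have Tn0 : T != 0 by rewrite gt_eqF.
have w0 : 0 < v / T ^+ 2 by rewrite divr_gt0// exprn_gt0.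
have wlt : v / T ^+ 2 < Num.sqrt om * (1 + T^-1 ^+ 2).
  rewrite ltr_pdivrMr ?exprn_gt0//.
  have -> : Num.sqrt om * (1 + T^-1 ^+ 2) * T ^+ 2 = Num.sqrt om * (1 + T ^+ 2) by field.
  by [].
have [sp [sm [h1 h2 h3]]] := bdry_shifts Ti0 Ti1 w0 wlt.
have Esp : phi sp = T * phi sm by rewrite h1; field.
exists sp, sm; split; [exact: Esp|by rewrite h2 Esp; field|].
move=> M Bp Bm Ep Em M0 Bm0 EB BpM BmM H1 H2 H3.
have Bp0 : 0 <= Bp by rewrite EB mulr_ge0// ltW.
have EBm : Bm = T^-1 * Bp by rewrite EB; field.
rewrite EBm in H2 H3.
have [N MN HN] := h3 M Bp Ep Em M0 Bp0 BpM H1 H2 H3.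
exists N => //; apply: le_trans HN _.
have -> : v / T ^+ 2 * (Bp / N) ^+ 2 = v * (Bm / N) ^+ 2; last by [].
rewrite EB; have N0 : N != 0 by rewrite gt_eqF// (lt_le_trans M0).
by field; rewrite N0.
Qed.

End optimal_shifts.

(** * Integrals over the whole line *)

Section whole_line.
Context {R : realType}.
Local Notation leb := (@lebesgue_measure R).
Implicit Types (w : R -> R[i]) (f : R -> R).

Lemma line_split : [set: R] = @Rminus R `|` ([set 0] `|` @Rplus R).
Proof.
apply/seteqP; split => // x _; rewrite /Rminus /Rplus /= !in_itv/= andbT.
by have [x0|x0|x0] := ltgtP x 0; [left|right; right|right; left].
Qed.

Lemma Rintegral_line f : (forall x, 0 <= f x) ->
  leb.-integrable (@Rminus R) (EFin \o f) -> leb.-integrable (@Rplus R) (EFin \o f) ->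
  \int[leb]_x f x = \int[leb]_(x in @Rminus R) f x + \int[leb]_(x in @Rplus R) f x.
Proof.
move=> f0 im ip.
have mm := @ray_measurable R _ (or_introl erefl).
have mp := @ray_measurable R _ (or_intror erefl).
have m0 : measurable ([set 0] : set (measurableTypeR R)) by exact: measurable_set1.
have m0p : measurable_fun ([set 0] `|` @Rplus R) (EFin \o f).
  apply/measurable_funU => //; split; last exact: (measurable_int leb ip).
  exact: measurable_fun_set1.
rewrite /Rintegral line_split ge0_integral_setU//=; first last.
- apply/disj_set2P/seteqP; split => // x; rewrite /Rminus /Rplus /= !in_itv/= andbT.
  by move=> [h1 [h2|h2]]; move: h1; rewrite ?h2 ?ltxx// ltNge (ltW h2).
- by move=> x _; rewrite lee_fin.
- apply/measurable_funU => //; first exact: measurableU.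
  by split => //; exact: (measurable_int leb im).
- exact: measurableU.
rewrite ge0_integral_setU//=; first last.
- apply/disj_set2P/seteqP; split => // x; rewrite /Rplus /= !in_itv/= andbT.
  by move=> [->]; rewrite ltxx.
- by move=> x _; rewrite lee_fin.
rewrite integral_set1 add0e fineD//; exact: integrable_fin_num.
Qed.

End whole_line.

(** * Integrals and suprema on one side *)

Section ray_facts.
Context {R : realType}.
Local Notation leb := (@lebesgue_measure R).
Implicit Types (I : set R) (w : R -> R[i]) (f : R -> R).

(** [e * x] is the distance to 0, so one formula describes a profile on either side. *)
Lemma integral_ray_sym I e f s (c : R) :
  (I = @Rplus R /\ e = 1 \/ I = @Rminus R /\ e = -1) ->
  (forall x, 0 <= f x) -> continuous f ->
  (\int[leb]_(x in `[0%R, +oo[) (f (x + s)%R)%:E)%E = c%:E ->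
  (\int[leb]_(x in I) (f (e * x + s)%R)%:E)%E = c%:E.
Proof.
move=> Ie f0 cf <-.
have cfe : continuous (fun x => f (e * x + s)).
  apply: (@cts_comp R (fun y => e * y + s)) => //.
  by apply: ctsD; [apply: ctsM; [exact: cts_cst|exact: cts_id]|exact: cts_cst].
have mfe (A : set R) : measurable_fun A (fun x => (f (e * x + s))%:E).
  apply/measurable_EFinP; apply: measurable_funTS.
  exact: measurable_realfun.continuous_measurable_fun.
case: Ie => -[IE eE]; rewrite IE.
  rewrite /Rplus integral_itv_obnd_cbnd//.
  by apply: eq_integral => x _; rewrite eE mul1r.
rewrite /Rminus integral_itv_bndo_bndc//.
have := @ge0_integration_by_substitutionNy R (fun x => f (e * x + s)) 0.
rewrite oppr0 => ->.
- by apply: eq_integral => x _; rewrite /= eE mulrNN mul1r.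
- exact: continuous_subspaceT.
- by move=> x _.
Qed.

Lemma H1_integrable_powR I w q : ray I -> H1 I w -> 0 <= q ->
  leb.-integrable I (EFin \o (fun x => normc (w x) `^ (q + 2))).
Proof.
move=> rI Hw q0; have [r [k hm]] := h1_modulus_exists rI Hw; have [Lw _] := Hw.
apply: (ae_integrable (ray_measurable rI) _ _ _ (modulus_powR_integrable rI hm q0)).
- apply: measurable_powR_fun; apply: measurable_funTS.
  apply: measurable_realfun.continuous_measurable_fun; exact: modulus_cts hm.
- by apply: measurable_powR_fun; exact: measurable_normc.
- apply: filterS (modulus_ae hm); first exact: (ae_filter_ringOfSetsType leb).
  by move=> x h Ix; rewrite h.
Qed.

Lemma H1_Lpnorm_line w q : H1 (@Rminus R) w -> H1 (@Rplus R) w -> 0 <= q ->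
  Lpnorm_pow (q + 2) setT w =
  Lpnorm_pow (q + 2) (@Rminus R) w + Lpnorm_pow (q + 2) (@Rplus R) w.
Proof.
move=> Hm Hp q0; apply: Rintegral_line.
- by move=> x; exact: powR_ge0.
- by apply: H1_integrable_powR => //; left.
- by apply: H1_integrable_powR => //; right.
Qed.

(** [M] is the supremum of the modulus on the side. It is not shown to be attained: the improved
    bound is the limit of [side_energy] along points where the modulus approaches [M]. The clause on
    [M = 0] later provides a positive normalization. *)
Lemma side_sup I w r k : ray I -> L2 I w -> h1_modulus I w r k ->
  exists M, [/\ 0 <= M, forall x, (I `|` [set 0]) x -> r x <= M,
    M = 0 -> {ae leb, forall x, I x -> w x = 0} &
    forall om q, 0 < om -> 0 < q -> 0 < M ->
    2 * calib om q 1 - calib om q (r 0 / M) <=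
    M ^- 2 * (Lpnorm_pow 2 I (weak_deriv I w) + om * Lpnorm_pow 2 I w -
              om * M `^ (- q) * Lpnorm_pow (q + 2) I w)].
Proof.
move=> rI Lw hm; set D := I `|` [set 0].
have [B HB] := modulus_bounded rI hm.
have D0 : D 0 by right.
have hs : has_sup (r @` D).
  by split; [exists (r 0), 0|exists B => _ [x Dx <-]; exact: HB].
pose M := sup (r @` D).
have rM x : D x -> r x <= M by move=> Dx; apply: sup_upper_bound => //; exists x.
have M0 : 0 <= M by exact: le_trans (modulus_nneg hm 0) (rM _ D0).
exists M; split => //.
  move=> ME; apply: filterS (modulus_ae hm); first exact: (ae_filter_ringOfSetsType leb).
  move=> x h Ix; have := rM x (or_introl Ix); rewrite ME -h// => n0.
  apply: eq0_normc; apply/eqP; rewrite eq_le n0/=.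
  by rewrite normcE_modulus modulus_ge0.
move=> om q om0 q0 Mpos; set E := _ ^- 2 * _.
apply/ler_addgt0Pr => e e0.
(* Half of [e], because [calib] at the high point is counted twice. *)
have e2 : 0 < e / 2 by rewrite divr_gt0.
have /cvgrPdist_lt/(_ _ e2)/nbhs_ballP[d /= d0 Hd] := @continuous_calib R om q q0 1.
have dM : 0 < d * M by exact: mulr_gt0.
have [_ [x Dx <-] xM] := sup_adherent dM hs.
have x1 : r x / M <= 1 by rewrite ler_pdivrMr// mul1r rM.
have x2 : 1 - d < r x / M by rewrite ltr_pdivlMr// mulrBl mul1r.
have : `|calib om q 1 - calib om q (r x / M)| < e / 2.
  by apply: Hd; rewrite /ball/= ger0_norm ?subr_ge0//; lra.
rewrite ltr_norml => /andP[_ h].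
have := side_energy rI Lw hm om0 q0 Mpos rM Dx; rewrite -/E.
move: E (calib om q (r 0 / M)) h; move=> E c h1 h2; lra.
Qed.

End ray_facts.

(** * Soliton pieces as Sobolev functions *)

Section soliton_ray.
Context {R : realType}.
Local Notation leb := (@lebesgue_measure R).
Variables (mu om : R) (I : set R) (u : R -> R[i]) (a e s : R).
Hypotheses (mu0 : 0 < mu) (om0 : 0 < om).
Hypothesis Ie : I = @Rplus R /\ e = 1 \/ I = @Rminus R /\ e = -1.
Hypothesis uE : forall x, I x -> u x = (a * soliton mu om (e * x + s))%:C%C.

Let rI : ray I.
Proof. by case: Ie => -[-> _]; [right|left]. Qed.

Let e1 : e ^+ 2 = 1.
Proof. by case: Ie => -[_ ->]; rewrite ?sqrrN expr1n. Qed.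

Let F x := a * soliton mu om (e * x + s).
Let f x := a * e * dsoliton mu om (e * x + s).

Let cl : continuous (fun x : R => e * x + s).
Proof.
by apply: ctsD; [apply: ctsM; [exact: cts_cst|exact: cts_id]|exact: cts_cst].
Qed.

Let dF (x : R) : is_derive x 1 F (f x).
Proof.
have dl : is_derive x 1 (fun x : R => e * x + s) e.
  by apply: is_derive_eq; rewrite /GRing.scale/=; ring.
have d := derZ a (der_comp dl (is_derive_soliton om mu0 (e * x + s))).
by apply: is_derive_eq d _; rewrite /f; ring.
Qed.

Let cf : continuous f.
Proof.
apply: ctsM; first exact: cts_cst.
by apply: cts_comp cl _; exact: continuous_dsoliton.
Qed.

Lemma integral_ray_soliton (h : R -> R) c b : (forall x, 0 <= h x) -> continuous h ->
  (\int[leb]_(x in `[0%R, +oo[) (h (x + s)%R)%:E)%E = c%:E -> 0 <= b ->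
  leb.-integrable I (EFin \o (fun x => b * h (e * x + s))) /\
  \int[leb]_(x in I) (b * h (e * x + s)) = b * c.
Proof.
move=> h0 ch Ih b0; have mI := ray_measurable rI.
have E := integral_ray_sym Ie h0 ch Ih.
have ih : leb.-integrable I (EFin \o (fun x => h (e * x + s))).
  apply/integrableP; split.
    apply/measurable_EFinP; apply: measurable_funTS.
    by apply: measurable_realfun.continuous_measurable_fun; exact: cts_comp.
  under eq_integral do rewrite /= ger0_norm//.
  by rewrite E ltry.
split; first exact: (integrableZl mI b ih).
by rewrite RintegralZl// /Rintegral E.
Qed.

Let cs : continuous (soliton mu om).
Proof. exact: continuous_soliton. Qed.

Let cd : continuous (dsoliton mu om).
Proof. exact: continuous_dsoliton. Qed.

Let iF : leb.-integrable I (EFin \o (fun x => a ^+ 2 * soliton mu om (e * x + s) ^+ 2)) /\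
  \int[leb]_(x in I) (a ^+ 2 * soliton mu om (e * x + s) ^+ 2) =
  a ^+ 2 * (om^-1 * soliton_kin mu om s + soliton_pow mu om s).
Proof.
apply: (@integral_ray_soliton (fun x => soliton mu om x ^+ 2)).
- by move=> x; exact: sqr_ge0.
- exact: ctsX.
- exact: integral_soliton_sqr.
- exact: sqr_ge0.
Qed.

Let jf : leb.-integrable I (EFin \o (fun x => a ^+ 2 * dsoliton mu om (e * x + s) ^+ 2)) /\
  \int[leb]_(x in I) (a ^+ 2 * dsoliton mu om (e * x + s) ^+ 2) =
  a ^+ 2 * soliton_kin mu om s.
Proof.
apply: (@integral_ray_soliton (fun x => dsoliton mu om x ^+ 2)).
- by move=> x; exact: sqr_ge0.
- exact: ctsX.
- exact: integral_dsoliton.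
- exact: sqr_ge0.
Qed.

Let F2E : (fun x => F x ^+ 2) = (fun x => a ^+ 2 * soliton mu om (e * x + s) ^+ 2).
Proof. by apply/funext => x; rewrite /F exprMn. Qed.

Let f2E : (fun x => f x ^+ 2) = (fun x => a ^+ 2 * dsoliton mu om (e * x + s) ^+ 2).
Proof. by apply/funext => x; rewrite /f !exprMn e1 mulr1. Qed.

Let iF2 : leb.-integrable I (EFin \o (fun x => F x ^+ 2)).
Proof. by rewrite F2E; exact: iF.1. Qed.

Let jf2 : leb.-integrable I (EFin \o (fun x => f x ^+ 2)).
Proof. by rewrite f2E; exact: jf.1. Qed.

Lemma soliton_ray_H1 : H1 I u.
Proof. exact: H1_real rI uE dF cf iF2 jf2. Qed.

Lemma soliton_ray_trace : trace0 I u = (a * soliton mu om s)%:C%C.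
Proof. by rewrite (trace0_real rI uE dF) /F mulr0 add0r. Qed.

Lemma soliton_ray_kinetic :
  Lpnorm_pow 2 I (weak_deriv I u) = a ^+ 2 * soliton_kin mu om s.
Proof.
rewrite (kinetic_real rI uE dF cf iF2 jf2) -jf.2; apply: eq_Rintegral => x _.
by rewrite -[LHS]/((fun x => f x ^+ 2) x) f2E.
Qed.

Lemma soliton_ray_L2 :
  Lpnorm_pow 2 I u = a ^+ 2 * (om^-1 * soliton_kin mu om s + soliton_pow mu om s).
Proof.
rewrite (Lpnorm_pow_real uE) -iF.2; apply: eq_Rintegral => x _.
by rewrite powR_mulrn// -normrX ger0_norm ?sqr_ge0// exprMn.
Qed.

Lemma soliton_ray_Lp :
  Lpnorm_pow (2 * mu + 2) I u = `|a| `^ (2 * mu + 2) * soliton_pow mu om s.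
Proof.
have [||||_ <-] := @integral_ray_soliton (fun x => soliton mu om x `^ (2 * mu + 2))
  (soliton_pow mu om s) (`|a| `^ (2 * mu + 2)).
- by move=> x; exact: powR_ge0.
- exact: continuous_soliton_powR.
- exact: integral_soliton_powR.
- exact: powR_ge0.
rewrite (Lpnorm_pow_real uE); apply: eq_Rintegral => x _.
have sx := soliton_gt0 mu om (e * x + s).
by rewrite normrM (gtr0_norm sx) powRM// ltW.
Qed.

Lemma soliton_ray_neq0 : a != 0 -> ~ {ae leb, forall x, u x = 0}.
Proof.
move=> a0 ae0.
have cF : continuous F by exact: der_cts dF.
have [x Ix] : exists x, I x.
  case: Ie => -[-> _]; [exists 1|exists (-1)]; rewrite /Rplus /Rminus /= in_itv/= ?andbT//.
have : F x = 0.
  apply: (@ae_eq_continuous _ I F (fun=> 0)) => //.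
  - exact: ray_open.
  - by move=> y _; exact: cvg_cst.
  - apply: filterS ae0; first exact: (ae_filter_ringOfSetsType leb).
    by move=> y h Iy; move: h; rewrite uE// => -[].
by move/eqP; rewrite mulf_eq0 (negbTE a0) gt_eqF// soliton_gt0.
Qed.

End soliton_ray.

(** * Minimization on the Nehari manifold *)

Section minimization.
Context {R : realType}.
Local Notation leb := (@lebesgue_measure R).
Implicit Types (mu om v tau : R) (w : R -> R[i]).

(** Half the Nehari functional contains every quadratic term of the action; subtracting it leaves
    the power term with coefficient [1/2 - 1/(2 mu + 2)]. *)
Lemma action_nehari mu v om w : 0 < mu -> nehari_fun mu v om w = 0 ->
  action mu v om w = mu / (2 * mu + 2) * Lpnorm_pow (2 * mu + 2) setT w.
Proof.
rewrite /nehari_fun /action => mu0.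
move: (kinetic w) (Lpnorm_pow (2 * mu + 2) setT w) (normc _ ^+ 2) (Lpnorm_pow 2 setT w).
move=> k p t l H.
have -> : k = p + v * t - om * l by lra.
by field; rewrite gt_eqF// addr_gt0// mulr_gt0.
Qed.

(** With [y = (A / N)^2], multiplying the hypothesis by [(mu + 1) * y] makes
    [(mu + 1) * y - y^(mu + 1)] the factor of [X]. It is at most [mu], with equality at [y = 1],
    that is, when [N] is the amplitude [A]. *)
Lemma young_level mu om A N X B : 0 < mu -> 0 < om -> 0 < A ->
  A `^ (2 * mu) = (mu + 1) * om -> 0 < N -> 0 <= X ->
  mu * om * B * N ^+ 2 <= X - om * N `^ (- (2 * mu)) * X ->
  A `^ (2 * mu + 2) * B <= X.
Proof.
move=> mu0 om0 A0 AE N0 X0 H.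
have q0 : 0 < 2 * mu by exact: mulr_gt0.
have m1 : 0 < mu + 1 by rewrite addr_gt0.
set y := (A / N) ^+ 2.
have y0 : 0 < y by rewrite exprn_gt0// divr_gt0.
have AN0 : 0 <= A / N by rewrite divr_ge0// ltW.
have yE : y `^ (mu + 1) = (mu + 1) * om * N `^ (- (2 * mu)) * y.
  rewrite /y -[in LHS](powR_mulrn _ AN0) -powRrM.
  have -> : 2 * (mu + 1) = 2 * mu + 2 by ring.
  rewrite powRD; last by apply/implyP; rewrite gt_eqF// addr_gt0.
  rewrite powR_mulrn// powRM ?invr_ge0 ?(ltW A0) ?(ltW N0)// AE.
  have -> : N^-1 `^ (2 * mu) = N `^ (- (2 * mu)); last by [].
  by rewrite -powR_inv1 ?(ltW N0)// -powRrM mulN1r.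
have Y : (mu + 1) * y - y `^ (mu + 1) <= mu.
  (* Young's inequality for the product of [y] and 1, with conjugate exponents [mu + 1] and
     [(mu + 1) / mu]. *)
  have := @conjugate_powR R y 1 (mu + 1) ((mu + 1) / mu) (ltW y0) ler01 m1.
  rewrite divr_gt0// => /(_ isT).
  have -> : (mu + 1)^-1 + ((mu + 1) / mu)^-1 = 1 by field; rewrite !gt_eqF.
  move=> /(_ erefl); rewrite powR1 mulr1.
  have -> : 1 / ((mu + 1) / mu) = mu / (mu + 1) by field; rewrite !gt_eqF.
  by rewrite -mulrDl ler_pdivlMr// mulrC; lra.
have AE2 : A `^ (2 * mu + 2) = (mu + 1) * om * A ^+ 2.
  rewrite powRD; last by apply/implyP; rewrite gt_eqF// addr_gt0.
  by rewrite AE powR_mulrn// ltW.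
rewrite AE2 -(ler_pM2l mu0).
apply: (@le_trans _ _ (((mu + 1) * y - y `^ (mu + 1)) * X)); last first.
  by rewrite ler_wpM2r.
have -> : ((mu + 1) * y - y `^ (mu + 1)) * X =
    (mu + 1) * y * (X - om * N `^ (- (2 * mu)) * X) by rewrite yE; ring.
have -> : mu * ((mu + 1) * om * A ^+ 2 * B) = (mu + 1) * y * (mu * om * B * N ^+ 2).
  by rewrite /y; field; rewrite gt_eqF.
by rewrite ler_wpM2l// mulr_ge0 ?ltW.
Qed.

Lemma ae_line w : {ae leb, forall x, @Rminus R x -> w x = 0} ->
  {ae leb, forall x, @Rplus R x -> w x = 0} -> {ae leb, forall x, w x = 0}.
Proof.
move=> am ap.
have a0 : {ae leb, forall x : R, x != 0}.
  exists [set 0]; split; [exact: measurable_set1|exact: lebesgue_measure_set1|].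
  by move=> x /= /negP; rewrite negbK => /eqP.
have pF := ae_filter_ringOfSetsType leb.
apply: filterS3 am ap a0 => x h1 h2 h3.
have : [set: R] x by [].
rewrite line_split => -[|[|]] Hx; [exact: h1| |exact: h2].
by move: h3; rewrite Hx eqxx.
Qed.

(** The long hypothesis has the form of the last conclusion of [optimal_shifts], with [K] for the
    energy of the pasted profile. It is applied to the normalized energies of the two halves of
    [w]. *)
Lemma nehari_lower_bound mu v tau om w K : 0 < mu -> 0 < om ->
  (forall M Bp Bm (Ep Em : R -> R), 0 < M -> 0 <= Bm -> Bp = `|tau| * Bm ->
      Bp <= M -> Bm <= M ->
      (forall N, M <= N -> calib om (2 * mu) (Bp / N) <= Ep N) ->
      (forall N, M <= N -> calib om (2 * mu) (Bm / N) <= Em N) ->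
      (2 * calib om (2 * mu) 1 - calib om (2 * mu) (Bp / M) <= Ep M \/
       2 * calib om (2 * mu) 1 - calib om (2 * mu) (Bm / M) <= Em M) ->
      exists2 N, M <= N & K <= Ep N + Em N - v * (Bm / N) ^+ 2) ->
  nehari_manifold mu v tau om w ->
  exists2 N, 0 < N & K * N ^+ 2 <= Lpnorm_pow (2 * mu + 2) setT w -
    om * N `^ (- (2 * mu)) * Lpnorm_pow (2 * mu + 2) setT w.
Proof.
move=> mu0 om0 HK [[Hm Hp Ht] wn0 Iw].
have q0 : 0 < 2 * mu by exact: mulr_gt0.
have rm : ray (@Rminus R) by left.
have rp : ray (@Rplus R) by right.
have [Lm _] := Hm; have [Lp _] := Hp.
have [r1 [k1 hm]] := h1_modulus_exists rm Hm.
have [r2 [k2 hp]] := h1_modulus_exists rp Hp.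
have [M1 [M10 HM1 M1ae M1E]] := side_sup rm Lm hm.
have [M2 [M20 HM2 M2ae M2E]] := side_sup rp Lp hp.
set D1 := (_ `|` _) in HM1; set D2 := (_ `|` _) in HM2.
have D10 : D1 0 by right.
have D20 : D2 0 by right.
(* The larger supremum is the common normalization, and the side to which it belongs supplies the
   improved bound. *)
pose M := Num.max M1 M2.
have M0 : 0 < M.
  rewrite lt_max; apply/orP; apply: contrapT => /not_orP[/negP h1 /negP h2].
  apply: wn0; apply: ae_line.
  - by apply: M1ae; apply/eqP; rewrite eq_le M10 andbT leNgt.
  - by apply: M2ae; apply/eqP; rewrite eq_le M20 andbT leNgt.
have M1M : M1 <= M by rewrite le_max lexx.
have M2M : M2 <= M by rewrite le_max lexx orbT.
pose E I N := N ^- 2 * (Lpnorm_pow 2 I (weak_deriv I w) + om * Lpnorm_pow 2 I w -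
  om * N `^ (- (2 * mu)) * Lpnorm_pow (2 * mu + 2) I w).
have HE I r k N (D := I `|` [set 0]) : ray I -> L2 I w -> h1_modulus I w r k ->
    M <= N -> (forall x, D x -> r x <= M) -> calib om (2 * mu) (r 0 / N) <= E I N.
  move=> rI LI hI MN HN.
  have N0 : 0 < N by exact: lt_le_trans MN.
  have HN' x : D x -> r x <= N by move=> /HN /le_trans; exact.
  have D0 : D 0 by right.
  by have := side_energy rI LI hI om0 q0 N0 HN' D0; rewrite -/(E I N); lra.
have EB : r2 0 = `|tau| * r1 0.
  rewrite -(modulus_trace hp) -(modulus_trace hm) Ht normcM; congr (_ * _).
  by rewrite normcE_modulus /modulus/= expr0n addr0 sqrtr_sqr.
have B1M : r1 0 <= M by apply: le_trans M1M; exact: HM1.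
have B2M : r2 0 <= M by apply: le_trans M2M; exact: HM2.
have Hsup : 2 * calib om (2 * mu) 1 - calib om (2 * mu) (r2 0 / M) <= E (@Rplus R) M \/
    2 * calib om (2 * mu) 1 - calib om (2 * mu) (r1 0 / M) <= E (@Rminus R) M.
  rewrite /M; have [h|h] := leP M1 M2; [left|right].
  - by apply: M2E => //; move: M0; rewrite /M (max_idPr h).
  - by apply: M1E => //; move: M0; rewrite /M (max_idPl (ltW h)).
have [N MN HN] := HK M (r2 0) (r1 0) (E (@Rplus R)) (E (@Rminus R)) M0
  (modulus_nneg hm 0) EB B2M B1M
  (fun N MN => HE _ _ _ N rp Lp hp MN (fun x Dx => le_trans (HM2 x Dx) M2M))
  (fun N MN => HE _ _ _ N rm Lm hm MN (fun x Dx => le_trans (HM1 x Dx) M1M)) Hsup.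
have N0 : 0 < N by exact: lt_le_trans MN.
exists N => //.
have Nn : N != 0 by rewrite gt_eqF.
have Lsum := H1_Lpnorm_line Hm Hp (ltW q0).
have L2sum : Lpnorm_pow 2 setT w = Lpnorm_pow 2 (@Rminus R) w + Lpnorm_pow 2 (@Rplus R) w.
  by have := H1_Lpnorm_line Hm Hp (lexx 0); rewrite add0r.
(* The Nehari condition trades all quadratic terms, the point interaction included, for the power
   term. *)
move: Iw; rewrite /nehari_fun /kinetic (modulus_trace hm) L2sum Lsum.
rewrite -(ler_pM2r (exprn_gt0 2 N0)) in HN.
move: HN; rewrite /E.
move: (Lpnorm_pow 2 Rminus (weak_deriv _ w)) (Lpnorm_pow 2 Rplus (weak_deriv _ w)).
move: (Lpnorm_pow 2 Rminus w) (Lpnorm_pow 2 Rplus w).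
move: (Lpnorm_pow (2 * mu + 2) Rminus w) (Lpnorm_pow (2 * mu + 2) Rplus w).
move: (r1 0) (N `^ _) => b n p1 p2 l1 l2 kk1 kk2 HN HI.
apply: (le_trans HN); rewrite le_eqVlt; apply/orP; left; apply/eqP.
transitivity (kk2 + om * l2 - om * n * p2 + (kk1 + om * l1 - om * n * p1) - v * b ^+ 2).
  by field; rewrite Nn.
apply/eqP; rewrite -subr_eq0 -[X in _ == X]HI; apply/eqP; ring.
Qed.

End minimization.

Theorem theorem3p1 (R : realType) (mu v tau omega : R)
    (mu_gt0 : 0 < mu) (v_gt0 : 0 < v)
    (tau_neq0 : tau != 0) (tau_neq1 : tau != 1) (tau_neqN1 : tau != -1)
    (omega_gt : v ^+ 2 / (tau ^+ 2 + 1) ^+ 2 < omega) :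
  exists u : R -> R[i],
    nehari_manifold mu v tau omega u /\
    forall w : R -> R[i],
      nehari_manifold mu v tau omega w ->
      action mu v omega u <= action mu v omega w.
Proof.
have T0 : 0 < `|tau| by rewrite normr_gt0.
have T1 : 0 < tau ^+ 2 + 1 by rewrite ltr_wpDl// sqr_ge0.
have om0 : 0 < omega.
  by apply: le_lt_trans omega_gt; rewrite divr_ge0 ?sqr_ge0.
(* The hypothesis on [omega] in the square-root form that makes the boundary function positive at
   0. *)
have vlt : v < Num.sqrt omega * (1 + `|tau| ^+ 2).
  rewrite real_normK ?num_real// addrC -ltr_pdivrMr//.
  rewrite -ltr_sqr ?nnegrE ?sqrtr_ge0 ?divr_ge0 ?ltW//.
  by rewrite sqr_sqrtr ?ltW// expr_div_n.
have [sp [sm [h1 h2 h3]]] := optimal_shifts mu_gt0 om0 T0 v_gt0 vlt.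
have q0 : 0 < 2 * mu by exact: mulr_gt0.
have m1 : 0 < (mu + 1) * omega by rewrite mulr_gt0// addr_gt0.
(* The amplitude for which [A * phi] solves [- u'' + omega * u = u^(2 mu + 1)]. *)
pose A := ((mu + 1) * omega) `^ (2 * mu)^-1.
have A0 : 0 < A by exact: powR_gt0.
have AE : A `^ (2 * mu) = (mu + 1) * omega.
  by rewrite -powRrM mulVf ?gt_eqF// powRr1// ltW.
have AE2 : A `^ (2 * mu + 2) = (mu + 1) * omega * A ^+ 2.
  rewrite powRD; last by apply/implyP; rewrite gt_eqF// addr_gt0.
  by rewrite AE powR_mulrn// ltW.
pose phi := soliton mu omega.
(* The shifts are adjusted to [|tau|]; the sign of [tau] goes into the amplitude on the right. *)
pose ap := A * Num.sg tau.
have ap2 : ap ^+ 2 = A ^+ 2 by rewrite exprMn sqr_sg tau_neq0 mulr1.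
have apn : `|ap| = A by rewrite normrM normr_sg tau_neq0 mulr1 gtr0_norm.
pose u x : R[i] := if x < 0 then (A * phi (-1 * x + sm))%:C%C
                   else (ap * phi (1 * x + sp))%:C%C.
have um x : Rminus x -> u x = (A * phi (-1 * x + sm))%:C%C.
  by rewrite /Rminus /= in_itv/= /u => ->.
have up x : Rplus x -> u x = (ap * phi (1 * x + sp))%:C%C.
  by rewrite /Rplus /= in_itv/= andbT /u => x0; rewrite ltNge (ltW x0).
have Im : @Rminus R = @Rplus R /\ -1 = 1 :> R \/ @Rminus R = @Rminus R /\ -1 = -1 :> R.
  by right.
have Ip : @Rplus R = @Rplus R /\ 1 = 1 :> R \/ @Rplus R = @Rminus R /\ 1 = -1 :> R.
  by left.
have Hm := soliton_ray_H1 mu_gt0 om0 Im um.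
have Hp := soliton_ray_H1 mu_gt0 om0 Ip up.
have Lu := H1_Lpnorm_line Hm Hp (ltW q0).
have L2u : Lpnorm_pow 2 setT u = Lpnorm_pow 2 (@Rminus R) u + Lpnorm_pow 2 (@Rplus R) u.
  by have := H1_Lpnorm_line Hm Hp (lexx 0); rewrite add0r.
have tm := soliton_ray_trace mu_gt0 Im um.
have tp := soliton_ray_trace mu_gt0 Ip up.
have Xu : Lpnorm_pow (2 * mu + 2) setT u =
    A `^ (2 * mu + 2) * (soliton_pow mu omega sp + soliton_pow mu omega sm).
  rewrite Lu (soliton_ray_Lp mu_gt0 om0 Im um) (soliton_ray_Lp mu_gt0 om0 Ip up).
  by rewrite apn (gtr0_norm A0) mulrDr addrC.
have Nu : nehari_fun mu v omega u = 0.
  rewrite /nehari_fun /kinetic Xu L2u.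
  rewrite (soliton_ray_kinetic mu_gt0 om0 Im um) (soliton_ray_kinetic mu_gt0 om0 Ip up).
  rewrite (soliton_ray_L2 mu_gt0 om0 Im um) (soliton_ray_L2 mu_gt0 om0 Ip up) ap2 AE2 tm.
  have -> : normc (A * soliton mu omega sm)%:C%C ^+ 2 = A ^+ 2 * soliton mu omega sm ^+ 2.
    by rewrite normcE_modulus sqr_modulus/= expr0n addr0 exprMn.
  have Ep := soliton_pow_kin mu_gt0 om0 sp; have Em := soliton_pow_kin mu_gt0 om0 sm.
  (* Stationarity of the shifts, with [phi * phi'] expressed by kinetic and power integrals, is the
     Nehari condition divided by [A^2]. *)
  have E : v * soliton mu omega sm ^+ 2 =
     2 * soliton_kin mu omega sp + 2 * soliton_kin mu omega sm -
     mu * omega * soliton_pow mu omega sp - mu * omega * soliton_pow mu omega sm.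
    by rewrite -h2 Ep Em; ring.
  transitivity (A ^+ 2 * (2 * soliton_kin mu omega sp + 2 * soliton_kin mu omega sm -
     mu * omega * soliton_pow mu omega sp - mu * omega * soliton_pow mu omega sm -
     v * soliton mu omega sm ^+ 2)).
    by field; rewrite gt_eqF.
  by rewrite E subrr mulr0.
exists u; split.
  split; [split; [exact: Hm|exact: Hp|]| |exact: Nu].
    rewrite tm tp h1 -rmorphM/=; congr (_%:C%C).
    by rewrite /ap [in RHS](numEsg tau); ring.
  by apply: (soliton_ray_neq0 mu_gt0 Im um); rewrite gt_eqF.
move=> w Hw; rewrite (action_nehari mu_gt0 Nu).
have [_ _ Nw] := Hw; rewrite (action_nehari mu_gt0 Nw) Xu.
rewrite ler_wpM2l ?divr_ge0 ?(ltW mu_gt0) ?addr_ge0 ?(ltW q0)//.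
have [N N0 HN] := nehari_lower_bound mu_gt0 om0 h3 Hw.
apply: young_level mu_gt0 om0 A0 AE N0 _ HN.
by apply: Rintegral_ge0 => x _; exact: powR_ge0.
Qed.
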